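(* Suppose Assumptions 1, 2, 3 of the context hold. Let $\epsilon>0$ and $\Lambda\in(0,1)$, and run the two-phase ZS-BCCG method (described in the context) for $\min_{x\in X}\{\Phi(x)=f(x)+\chi(x)\}$ with parameters $$S=S_c(\Lambda)=\lceil\log_2(2/\Lambda)\rceil,$$ $$\tilde T=\tilde T_c(\epsilon)=\Big\lceil\max\Big\{\omega_L(n+4),\ \frac{\omega_L^2(n+4)(2M^2+\sigma^2)}{\tilde D^2},\ \frac{8^2\omega_Lb(n+4)[17L_f^2D_\Phi^2+8(\hat L^2D_\Phi^2+\hat L)]}{\epsilon},\ b^2\omega_L^2\Big[\frac{8\cdot32\sqrt{(n+4)(2M^2+\sigma^2)}}{\epsilon}\Big(2\tilde D+\frac{\hat L^2D_\Phi^2+\hat L}{\tilde D}\Big)\Big]^2\Big\}\Big\rceil,$$ $$\mathcal T=\mathcal T_c(\epsilon,\Lambda)=\Big\lceil\frac{32(n+4)\cdot2(S+1)}{\Lambda}\max\Big\{1,\frac{16(2M^2+\sigma^2)}{\epsilon}\Big\}\Big\rceil.$$ Then the method computes an $(\epsilon,\Lambda)$-solution, i.e. its output $\bar x_*$ satisfies $\mathrm{Prob}\{\|\mathcal P(\bar x_*,\nabla f(\bar x_* ),1/(2\hat L))\|^2>\epsilon\}\le\Lambda$, after at most $S_c(\Lambda)[\tilde T_c(\epsilon)+\mathcal T_c(\epsilon,\Lambda)]$ calls to the stochastic zeroth-order oracle.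
   Context: Notation: $n=n_1+\dots+n_b$, $\mathcal B=\{1,\dots,b\}$, $U_s\in\mathbb R^{n\times n_s}$ with $(U_1,\dots,U_b)=I_n$; $x^{(s)}=U_s^Tx$, $\nabla_sf=U_s^T\nabla f$; $\|\cdot\|$, $\|\cdot\|_s$ are Euclidean norms on $\mathbb R^n$, $\mathbb R^{n_s}$. $X=X_1\times\cdots\times X_b$, each $X_s\subseteq\mathbb R^{n_s}$ closed convex. Problem: $\Phi=f+\chi$ with $f(x)=\mathbb E_\xi[F(x,\xi)]$ (possibly nonconvex), $\xi$ a random variable, $F$ Borel measurable and defined for all $x\in\mathbb R^n$; $\chi(x)=\sum_{s=1}^b\chi_s(x^{(s)})$ with $\chi_s:\mathbb R^{n_s}\to\mathbb R$ closed convex. $\Phi^*=\min_{x\in X}\Phi(x)$. Assumption 1: $\mathbb E[F(x,\xi)]=f(x)$ and $\mathbb E[\nabla F(x,\xi)]=\nabla f(x)$ for all $x$, and $\mathbb E[\|\nabla F(x,\xi)-\nabla f(x)\|^2]\le\sigma^2$ for all $x\in X$. Assumption 2: almost surely in $\xi$, $\|\nabla F(x,\xi)-\nabla F(y,\xi)\|\le L_f\|x-y\|$ for all $x,y$, and for each $s\in\mathcal B$, $\|\nabla_sF(x+U_sh,\xi)-\nabla_sF(x,\xi)\|_s\le L_s\|h\|_s$ for all $x$ and all $h\in\mathbb R^{n_s}$ ($L_f,L_s>0$). Assumption 3: $\|\nabla f(x)\|\le M$ for all $x\in X$. Constants: $\hat L=\max_sL_s$, $\check L=\min_sL_s$, $\omega_L=\hat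 L/\check L+2$, $D_\Phi=[(\Phi(x_1)-\Phi^* )/\hat L]^{1/2}$, and $\tilde D>0$ is a fixed parameter. Generalized gradient: $\phi_s:\mathbb R^{n_s}\to\mathbb R$ is differentiable and 1-strongly convex, $D_{\phi_s}(x,y)=\phi_s(x)-\phi_s(y)-\langle\nabla\phi_s(y),x-y\rangle$. For $\alpha>0$, $P_s(x^{(s)},g^{(s)},\alpha)=\arg\min_{y\in X_s}\{\langle g^{(s)},y\rangle+\frac1\alpha D_{\phi_s}(y,x^{(s)})+\chi_s(y)\}$, $\mathcal P_s(x,g,\alpha)=\frac1\alpha[x^{(s)}-P_s(x^{(s)},g^{(s)},\alpha)]$, and $\mathcal P(x,g,\alpha)=(\mathcal P_1(x,g,\alpha),\dots,\mathcal P_b(x,g,\alpha))$. Zeroth-order gradient: $G_\mu(x,\xi,u)=\frac{F(x+\mu u,\xi)-F(x,\xi)}{\mu}u$; each evaluation counts as one call to the stochastic zeroth-order oracle. Procedure $\mathrm{CndG}_{X_s}(x,g,\alpha,\delta)$ ($x\in X_s$, $g\in\mathbb R^{n_s}$, $\alpha,\delta>0$): start with $u_1=x$, $t=1$. Compute a minimizer $v_{t+1}$ over $u\in X_s$ of $V(u)=\langle g+\frac1\alpha(\nabla\phi_s(u_t)-\nabla\phi_s(x)),u-u_t\rangle+\chi_s(u)-\chi_s(u_t)$. If $V(v_{t+1})\ge-\delta$, return $u_t$; otherwise set $u_{t+1}=(1-\frac2{t+1})u_t+\frac2{t+1}v_{t+1}$, $t\leftarrow t+1$ and repeat. The procedure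 is understood to be well defined and to terminate. Approximate ZS-BCCG method: given $x_1\in X$, $\mu>0$, iteration count $T$, stepsizes $\alpha_k>0$, batch sizes $T_k\ge1$, approximating parameters $\delta_k>0$, probabilities $p_s$ with $\sum_sp_s=1$. Draw i.i.d. block indices $i_k$ with $\mathrm{Prob}\{i_k=s\}=p_s$ and $R\in\{1,\dots,T\}$ with probability mass function $P_R$. At step $k$ draw $u_{k,t}\sim N(0,I_n)$ and oracle samples $\xi_{k,t}$ distributed as $\xi$, $t=1,\dots,T_k$, set $\bar G_{\mu,k}^{(i_k)}=\frac1{T_k}\sum_{t=1}^{T_k}U_{i_k}^TG_\mu(x_k,\xi_{k,t},u_{k,t})$, $x_{k+1}^{(i_k)}=\mathrm{CndG}_{X_{i_k}}(x_k^{(i_k)},\bar G_{\mu,k}^{(i_k)},\alpha_k,\delta_k)$, and $x_{k+1}^{(s)}=x_k^{(s)}$ for $s\ne i_k$. Output $x_R$. All random quantities are mutually independent. Two-phase ZS-BCCG (2-ZS-BCCG): Optimization phase: for $i=1,\dots,S$ independently run approximate ZS-BCCG from the same $x_1$ with $p_s=1/b$, $\alpha_k=1/(2\hat L)$, batch sizes $T_k=T'=\lceil\min\{\max\{\frac{\omega_L\sqrt{(n+4)(2M^2+\sigma^2)\tilde T}}{\tilde D},\omega_L(n+4)\},\tilde T\}\rceil$, iteration limit $T=\lfloor\tilde T/T'\rfloor$, smoothing parameter $0<\mu\le\frac{D_\Phi}{n+4}\sqrt{b/\tilde T}$, $\delta_k=1/(3T)$, and $P_R(k)=\frac{\alpha_k\min_s\{p_s(1-L_s\alpha_k)\}}{\sum_{k=1}^T\alpha_k\min_s\{p_s(1-L_s\alpha_k)\}}$;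 let $\bar x_i$ be the output of run $i$. Post-optimization phase: with fresh independent samples $(\xi_k,u_k)$, $k=1,\dots,\mathcal T$, set $G_{\mu,\mathcal T}(x)=\frac1{\mathcal T}\sum_{k=1}^{\mathcal T}G_\mu(x,\xi_k,u_k)$ and output $\bar x_*\in\arg\min_{\bar x_1,\dots,\bar x_S}\|\mathcal P(\bar x_i,G_{\mu,\mathcal T}(\bar x_i),1/(2\hat L))\|$. The number of oracle calls counted for the post-optimization phase is $S\mathcal T$. *)

(* Defs.v *)
From HB Require Import structures.
From mathcomp Require Export all_boot all_order all_algebra.
From mathcomp Require Export all_classical all_reals all_analysis.
Set Implicit Arguments.
Unset Strict Implicit.
Unset Printing Implicit Defensive.
Import Order.TTheory GRing.Theory Num.Theory.
Import numFieldNormedType.Exports.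
Local Open Scope classical_set_scope.
Local Open Scope ring_scope.

(* Conventions.
   Vectors are row vectors, so U_s^T x is written x *m U s and U_s h is
   written h *m (U s)^T.  The library norm on 'rV is the sup norm: it is used
   for topology and differentiability only, and [enorm] is the norm that the
   mathematics refers to. *)

Notation dim nn := (\sum_s nn s)%N.

(* R^n with its Borel sigma-algebra *)
Definition borel_rV (R : realType) (n : nat) :=
  g_sigma_algebraType (@open 'rV[R]_n).

Definition dot (R : realType) (n : nat) (x y : 'rV[R]_n) : R :=
  \sum_j x 0 j * y 0 j.

Definition enorm (R : realType) (n : nat) (x : 'rV[R]_n) : R :=
  Num.sqrt (dot x x).

(* Meaningful at the points where g is differentiable *)
Definition grad (R : realType) (n : nat) (g : 'rV[R]_n -> R) (x : 'rV[R]_n) :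
    'rV[R]_n :=
  \row_j 'd (g : 'rV[R]_n -> R^o) x (delta_mx 0 j).

Definition differentiable_everywhere (R : realType) (n : nat)
    (g : 'rV[R]_n -> R) : Prop :=
  forall x, differentiable (g : 'rV[R]_n -> R^o) x.

Definition U (R : realType) (b : nat) (nn : 'I_b -> nat) (s : 'I_b) :
    'M[R]_(dim nn, nn s) :=
  submxrow 1%:M s.

Lemma mxrow_U (R : realType) (b : nat) (nn : 'I_b -> nat) :
  \mxrow_s U R nn s = 1%:M.
Proof. exact: submxrowK. Qed.

(* max and min of a family indexed by the blocks (0 < b) *)
Definition max_block (R : realType) (b : nat) (a : 'I_b -> R) : R :=
  sup (range a).
Definition min_block (R : realType) (b : nat) (a : 'I_b -> R) : R :=
  inf (range a).

(* The natural number ceil(x), for x >= 0 *)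
Definition nceil (R : realType) (x : R) : nat := `|Num.ceil x|%N.

Section Problem.
Context {R : realType} {b : nat} {nn : 'I_b -> nat}.
Local Notation V := 'rV[R]_(dim nn).

Definition prodX (X : forall s, set 'rV[R]_(nn s)) : set V :=
  [set x | forall s, X s (x *m U R nn s)].

Definition Phi (f : V -> R) (chi : forall s, 'rV[R]_(nn s) -> R) (x : V) : R :=
  f x + \sum_s chi s (x *m U R nn s).

Definition is_minimum (T : Type) (A : set T) (h : T -> R) (m : R) : Prop :=
  (exists2 x, A x & h x = m) /\ (forall x, A x -> m <= h x).

Definition closed_convex_function (m : nat) (h : 'rV[R]_m -> R) : Prop :=
  convex_function setT h /\ closed [set p : 'rV[R]_m * R | h p.1 <= p.2].

Definition strongly_convex1 (m : nat) (h : 'rV[R]_m -> R) : Prop :=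
  forall (x y : 'rV[R]_m) (t : R), 0 <= t <= 1 ->
    h (t *: x + (1 - t) *: y) <=
    t * h x + (1 - t) * h y - 2^-1 * (t * (1 - t)) * enorm (x - y) ^+ 2.

Definition assumption1 d (Xi : measurableType d) (Q : probability Xi R)
    (F : V -> Xi -> R) (f : V -> R) (X : forall s, set 'rV[R]_(nn s))
    (sigma : R) : Prop :=
  [/\ forall x, Q.-integrable setT (fun xi => (F x xi)%:E) /\
        (\int[Q]_xi (F x xi)%:E = (f x)%:E)%E,
      differentiable_everywhere f,
      {ae Q, forall xi, differentiable_everywhere (F ^~ xi)},
      forall x j,
        Q.-integrable setT (fun xi => (grad (F ^~ xi) x 0 j)%:E) /\
        (\int[Q]_xi (grad (F ^~ xi) x 0 j)%:E = (grad f x 0 j)%:E)%E &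
      forall x, prodX X x ->
        (\int[Q]_xi (enorm (grad (F ^~ xi) x - grad f x) ^+ 2)%:E
          <= (sigma ^+ 2)%:E)%E].

Definition assumption2 d (Xi : measurableType d) (Q : probability Xi R)
    (F : V -> Xi -> R) (Lf : R) (L : 'I_b -> R) : Prop :=
  {ae Q, forall xi,
    (forall x y : V,
      enorm (grad (F ^~ xi) x - grad (F ^~ xi) y) <= Lf * enorm (x - y)) /\
    (forall (s : 'I_b) (x : V) (h : 'rV[R]_(nn s)),
      enorm (grad (F ^~ xi) (x + h *m (U R nn s)^T) *m U R nn s
             - grad (F ^~ xi) x *m U R nn s) <= L s * enorm h)}.

Definition assumption3 (f : V -> R) (X : forall s, set 'rV[R]_(nn s))
    (M : R) : Prop :=
  forall x, prodX X x -> enorm (grad f x) <= M.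

Definition bregman (m : nat) (h : 'rV[R]_m -> R) (x y : 'rV[R]_m) : R :=
  h x - h y - dot (grad h y) (x - y).

Definition prox_block (m : nat) (Xs : set 'rV[R]_m) (chis phis : 'rV[R]_m -> R)
    (x g : 'rV[R]_m) (alpha : R) : 'rV[R]_m :=
  let obj y := dot g y + alpha^-1 * bregman phis y x + chis y in
  get [set y | Xs y /\ forall z, Xs z -> obj y <= obj z].

Definition gen_grad (X : forall s, set 'rV[R]_(nn s))
    (chi phi : forall s, 'rV[R]_(nn s) -> R) (x g : V) (alpha : R) : V :=
  \mxrow_s (alpha^-1 *: (x *m U R nn s
    - prox_block (X s) (chi s) (phi s) (x *m U R nn s) (g *m U R nn s) alpha)).

(* y is returned by the conditional gradient procedure after N passes: u and v
   are its sequences u_1, u_2, ... and v_2, v_3, ... (other indices unused) *)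
Definition cndg_returns (m : nat) (Xs : set 'rV[R]_m)
    (chis phis : 'rV[R]_m -> R) (x g : 'rV[R]_m) (alpha delta : R)
    (y : 'rV[R]_m) : Prop :=
  exists (N : nat) (u v : nat -> 'rV[R]_m),
    let gap t z :=
      dot (g + alpha^-1 *: (grad phis (u t) - grad phis x)) (z - u t)
      + chis z - chis (u t) in
    [/\ (1 <= N)%N /\ u 1%N = x,
        forall t, (1 <= t <= N)%N ->
          Xs (v t.+1) /\ (forall z, Xs z -> gap t (v t.+1) <= gap t z),
        forall t, (1 <= t < N)%N ->
          gap t (v t.+1) < - delta /\
          u t.+1 = (1 - 2 / t.+1%:R) *: u t + (2 / t.+1%:R) *: v t.+1 &
        - delta <= gap N (v N.+1) /\ y = u N].

(* A realization of the procedure as a function of its arguments: it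
   terminates on every input, with a rule for choosing among the minimizers
   that makes the output Borel in (x, g) *)
Definition cndg_procedure (X : forall s, set 'rV[R]_(nn s))
    (chi phi : forall s, 'rV[R]_(nn s) -> R)
    (CndG : forall s, 'rV[R]_(nn s) -> 'rV[R]_(nn s) -> R -> R ->
              'rV[R]_(nn s)) : Prop :=
  forall (s : 'I_b) (alpha delta : R), 0 < alpha -> 0 < delta ->
    (forall x g, X s x ->
      cndg_returns (X s) (chi s) (phi s) x g alpha delta
        (CndG s x g alpha delta)) /\
    measurable_fun
      [set p : borel_rV R (nn s) * borel_rV R (nn s) | X s p.1]
      (fun p => CndG s p.1 p.2 alpha delta : borel_rV R (nn s)).

End Problem.

Section Algorithm.
Context {R : realType} {b : nat} {nn : 'I_b -> nat} {Xi : Type}.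
Local Notation V := 'rV[R]_(dim nn).

Definition Gmu (F : V -> Xi -> R) (mu : R) (x : V) (xi : Xi) (u : V) : V :=
  ((F (x + mu *: u) xi - F x xi) / mu) *: u.

Definition Gmu_mean (F : V -> Xi -> R) (mu : R) (m : nat)
    (xi : nat -> Xi) (u : nat -> V) (x : V) : V :=
  m%:R^-1 *: \sum_(t < m) Gmu F mu x (xi t) (u t).

(* One realization of the approximate ZS-BCCG method.  Steps are numbered from
   0: stage k is the pair of the iterate denoted x_{k+1} in 1-based numbering
   and of the number of evaluations of Gmu made to reach it. *)
Fixpoint zsbccg
    (CndG : forall s, 'rV[R]_(nn s) -> 'rV[R]_(nn s) -> R -> R -> 'rV[R]_(nn s))
    (F : V -> Xi -> R) (mu : R) (alpha : nat -> R) (batch : nat -> nat)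
    (delta : nat -> R) (x1 : V) (block : nat -> 'I_b)
    (xi : nat -> nat -> Xi) (u : nat -> nat -> V) (k : nat) : V * nat :=
  if k is k'.+1 then
    let: (x, calls) :=
      zsbccg CndG F mu alpha batch delta x1 block xi u k' in
    let G := Gmu_mean F mu (batch k') (xi k') (u k') x in
    (\mxrow_s (if s == block k' then
                 CndG s (x *m U R nn s) (G *m U R nn s) (alpha k') (delta k')
               else x *m U R nn s),
     (calls + batch k')%N)
  else (x1, 0%N).

Definition output_pmf (p : 'I_b -> R) (L : 'I_b -> R) (alpha : nat -> R)
    (T : nat) (k : 'I_T) : R :=
  let w j := alpha j * min_block (fun s => p s * (1 - L s * alpha j)) in
  w k / \sum_(j < T) w j.

End Algorithm.

Section Constants.
Context {R : realType} {b : nat}.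
Implicit Types (n S : nat) (L : 'I_b -> R).

Definition Lhat L : R := max_block L.
Definition Lcheck L : R := min_block L.
Definition omegaL L : R := Lhat L / Lcheck L + 2.

Definition S_c (Lambda : R) : nat := nceil (ln (2 / Lambda) / ln 2).

Definition Ttilde_c n L (Lf M sigma DPhi Dt eps : R) : nat :=
  let om := omegaL L in
  let n4 : R := n%:R + 4 in
  let v := 2 * M ^+ 2 + sigma ^+ 2 in
  let c := Lhat L ^+ 2 * DPhi ^+ 2 + Lhat L in
  nceil (Num.max (om * n4)
        (Num.max (om ^+ 2 * n4 * v / Dt ^+ 2)
        (Num.max (8 ^+ 2 * om * b%:R * n4 *
                    (17 * Lf ^+ 2 * DPhi ^+ 2 + 8 * c) / eps)
                 (b%:R ^+ 2 * om ^+ 2 *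
                    (8 * 32 * Num.sqrt (n4 * v) / eps *
                       (2 * Dt + c / Dt)) ^+ 2)))).

Definition Tpost_c n S (M sigma eps Lambda : R) : nat :=
  nceil (32 * (n%:R + 4) * (2 * (S%:R + 1)) / Lambda *
         Num.max 1 (16 * (2 * M ^+ 2 + sigma ^+ 2) / eps)).

Definition batch_size n L (M sigma Dt : R) (Tt : nat) : nat :=
  let om := omegaL L in
  let n4 : R := n%:R + 4 in
  nceil (Num.min
    (Num.max (om * Num.sqrt (n4 * (2 * M ^+ 2 + sigma ^+ 2) * Tt%:R) / Dt)
             (om * n4))
    Tt%:R).

End Constants.

Section Randomness.
Context {R : realType}.

Definition sigma_of d (T : measurableType d) (Om : Type) (Y : Om -> T) :
    set (set Om) :=
  preimage_set_system setT Y measurable.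

(* for Y with values in a finite set with the discrete sigma-algebra *)
Definition sigma_of_discrete (T Om : Type) (Y : Om -> T) : set (set Om) :=
  preimage_set_system setT Y setT.

Definition mutually_independent d (Om : measurableType d)
    (P : probability Om R) (I : Type) (G : I -> set (set Om)) : Prop :=
  forall (m : nat) (j : 'I_m -> I), injective j ->
  forall A : 'I_m -> set Om, (forall r, G (j r) (A r)) ->
    (P (\bigcap_(r in [set: 'I_m]) A r) = \prod_(r < m) P (A r))%E.

(* Y ~ N(0, I_n): the law of Y is the product of n copies of N(0, 1) *)
Definition std_gaussian d (Om : measurableType d) (P : probability Om R)
    (n : nat) (Y : Om -> 'rV[R]_n) : Prop :=
  forall B : 'I_n -> set R, (forall j, measurable (B j)) ->
    P [set w | forall j, B j (Y w 0 j)] =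
    (\prod_(j < n) normal_prob 0%R 1%R (B j))%E.

(* All the random draws of the two-phase method with S runs.  Steps k and
   samples t are numbered from 0; in run i only the steps k < T and samples
   t < T' are used, and in the post-optimization phase only k < Tpost.  Thus
   [stop i] = R - 1 in 1-based numbering. *)
Record draws (Om Xi : Type) (b n S T : nat) := Draws {
  block : 'I_S -> nat -> Om -> 'I_b ;
  stop : 'I_S -> Om -> 'I_T ;
  sample : 'I_S -> nat -> nat -> Om -> Xi ;
  dir : 'I_S -> nat -> nat -> Om -> 'rV[R]_n ;
  post_sample : nat -> Om -> Xi ;
  post_dir : nat -> Om -> 'rV[R]_n
}.

Variant draw_label (S T T' Tpost : nat) :=
  | LBlock of 'I_S & 'I_T
  | LStop of 'I_S
  | LSample of 'I_S & 'I_T & 'I_T'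
  | LDir of 'I_S & 'I_T & 'I_T'
  | LPostSample of 'I_Tpost
  | LPostDir of 'I_Tpost.

Definition draw_sigma (Om : Type) d (Xi : measurableType d) (b n S T : nat)
    (T' Tpost : nat) (D : draws Om Xi b n S T)
    (l : draw_label S T T' Tpost) : set (set Om) :=
  match l with
  | LBlock i k => sigma_of_discrete (block D i k)
  | LStop i => sigma_of_discrete (stop D i)
  | LSample i k t => sigma_of (sample D i k t)
  | LDir i k t => sigma_of (dir D i k t : Om -> borel_rV R n)
  | LPostSample k => sigma_of (post_sample D k)
  | LPostDir k => sigma_of (post_dir D k : Om -> borel_rV R n)
  end.

(* the first clause says that all draws are random variables *)
Definition draws_law d (Om : measurableType d) (P : probability Om R)
    d' (Xi : measurableType d') (Q : probability Xi R)
    (b n S T T' Tpost : nat) (p : 'I_b -> R) (PR : 'I_T -> R)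
    (D : draws Om Xi b n S T) : Prop :=
  (forall l : draw_label S T T' Tpost, draw_sigma D l `<=` measurable) /\
  mutually_independent P
    (fun l : draw_label S T T' Tpost => draw_sigma D l) /\
  [/\ forall i (k : 'I_T) s, P (block D i k @^-1` [set s]) = (p s)%:E,
      forall i k, P (stop D i @^-1` [set k]) = (PR k)%:E,
      forall i (k : 'I_T) (t : 'I_T') (B : set Xi), measurable B ->
        P (sample D i k t @^-1` B) = Q B &
      forall i (k : 'I_T) (t : 'I_T'), std_gaussian P (dir D i k t)] /\
  [/\ forall (k : 'I_Tpost) (B : set Xi), measurable B ->
        P (post_sample D k @^-1` B) = Q B &
      forall k : 'I_Tpost, std_gaussian P (post_dir D k)].

End Randomness.

Section TwoPhase.
Context {R : realType} {b : nat} {nn : 'I_b -> nat} {Om Xi : Type} {S T : nat}.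
Local Notation V := 'rV[R]_(dim nn).

(* Run i of the optimization phase, at stage k: constant stepsize 1/(2 Lhat),
   constant batch size T', accuracy 1/(3T) *)
Definition opt_run
    (CndG : forall s, 'rV[R]_(nn s) -> 'rV[R]_(nn s) -> R -> R -> 'rV[R]_(nn s))
    (F : V -> Xi -> R) (L : 'I_b -> R) (mu : R) (T' : nat) (x1 : V)
    (D : draws Om Xi b (dim nn) S T) (i : 'I_S) (w : Om) (k : nat) : V * nat :=
  zsbccg CndG F mu (fun=> (2 * Lhat L)^-1) (fun=> T') (fun=> (3 * T%:R)^-1) x1
    (fun k => block D i k w) (fun k t => sample D i k t w)
    (fun k t => dir D i k t w) k.

Definition xbar CndG (F : V -> Xi -> R) (L : 'I_b -> R) (mu : R) (T' : nat)
    (x1 : V) (D : draws Om Xi b (dim nn) S T) (w : Om) (i : 'I_S) : V :=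
  (opt_run CndG F L mu T' x1 D i w (stop D i w)).1.

Definition Gpost (F : V -> Xi -> R) (mu : R) (Tpost : nat)
    (D : draws Om Xi b (dim nn) S T) (w : Om) (x : V) : V :=
  Gmu_mean F mu Tpost (fun k => post_sample D k w) (fun k => post_dir D k w) x.

(* Evaluations of Gmu when all S runs are carried to their iteration limit T,
   plus Tpost evaluations for each of the S candidates *)
Definition oracle_calls CndG (F : V -> Xi -> R) (L : 'I_b -> R) (mu : R)
    (T' Tpost : nat) (x1 : V) (D : draws Om Xi b (dim nn) S T) (w : Om) : nat :=
  (\sum_(i < S) (opt_run CndG F L mu T' x1 D i w T).2 + S * Tpost)%N.

End TwoPhase.

(* Main.v *)
Require Import Defs.
From HB Require Import structures.
From mathcomp Require Import ring lra zify measurable_realfun.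
Set Implicit Arguments.
Unset Strict Implicit.
Unset Printing Implicit Defensive.
Import Order.TTheory GRing.Theory Num.Theory.
Import numFieldNormedType.Exports.
Local Open Scope classical_set_scope.
Local Open Scope ring_scope.

(* Write nu_k for the difference between the averaged estimate of step k and the
   gradient of f at x_k, P(x) for the generalized gradient at x, a = 1/(2 Lhat).
   The stopping rule of CndG gives an approximate proximal step, hence path by path
     Phi(x_{k+1}) + (a/4) |P_s(x_k)|^2 <= Phi(x_k) + (3a/2) |(nu_k)_s|^2 + 2 delta
   for s = i_k; the constants of the method leave room for these crude factors.
   Summing over k and taking expectations bounds E |P(x_R)|^2 by eps/8.  The size of
   nu_k comes from Gmu = <grad F, u> u + r, where the Gaussian moments bound the
   second moments of both terms by (2n+4) E |grad F|^2 and a multiple of mu^2 n^3;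
   E |nu_k|^2 is then a bias plus a variance divided by the batch size.
   By Markov's inequality each of the S independent runs has |P|^2 > eps/4 with
   probability at most 1/2, so all of them fail with probability at most Lambda/2.
   In the second phase P(x, g) is 1-Lipschitz in g, and with probability at least
   1 - Lambda/2 all S estimates are accurate enough for the minimizer of the
   estimated norms to satisfy |P|^2 <= 2 (eps/4) + eps/2. *)

(** * Euclidean and block vectors *)

(** Independence is given only for the elementary draws, while the method is adaptive. Every random
    quantity is therefore shown measurable for the sigma-algebra generated by an explicit set of
    draw labels, and disjoint sets of labels give independent sigma-algebras. No conditional
    expectation is formed: for independent X and Y the integral of phi (X, Y) is an iterated
    integral over two copies of the sample space, and the inner one is bounded with X frozen.
    Existence of proximal points is not a hypothesis either. Termination of CndG at every accuracy
    supplies approximate minimizers, and strong convexity makes them converge; the same limit yields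
    measurability of the generalized gradient. The constant stepsize makes the random index R
    uniform, so a moment at x_R is an average over the steps. The accuracy 1/(3T) adds 2/3 in total
    to the initial gap, which the summand Lhat of Lhat^2 DPhi^2 + Lhat absorbs. In the second phase
    all candidates share their samples, hence a union bound over the S estimates instead of the
    product available for the independent runs. *)

Section Dot.
Context {R : realType}.
Implicit Types n : nat.

Lemma dotC n (x y : 'rV[R]_n) : dot x y = dot y x.
Proof. by apply: eq_bigr => j _; rewrite mulrC. Qed.

Lemma dotDl n (x y z : 'rV[R]_n) : dot (x + y) z = dot x z + dot y z.
Proof. by rewrite -big_split; apply: eq_bigr => j _; rewrite mxE mulrDl. Qed.

Lemma dotZl n a (x z : 'rV[R]_n) : dot (a *: x) z = a * dot x z.
Proof. by rewrite mulr_sumr; apply: eq_bigr => j _; rewrite mxE mulrA. Qed.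

Lemma dotDr n (x y z : 'rV[R]_n) : dot z (x + y) = dot z x + dot z y.
Proof. by rewrite dotC dotDl !(dotC z). Qed.

Lemma dotZr n a (x z : 'rV[R]_n) : dot z (a *: x) = a * dot z x.
Proof. by rewrite dotC dotZl (dotC z). Qed.

Lemma dotNl n (x z : 'rV[R]_n) : dot (- x) z = - dot x z.
Proof. by rewrite -scaleN1r dotZl mulN1r. Qed.

Lemma dotNr n (x z : 'rV[R]_n) : dot z (- x) = - dot z x.
Proof. by rewrite dotC dotNl (dotC z). Qed.

Lemma dotBl n (x y z : 'rV[R]_n) : dot (x - y) z = dot x z - dot y z.
Proof. by rewrite dotDl dotNl. Qed.

Lemma dotBr n (x y z : 'rV[R]_n) : dot z (x - y) = dot z x - dot z y.
Proof. by rewrite dotDr dotNr. Qed.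

Lemma dot0l n (z : 'rV[R]_n) : dot 0 z = 0.
Proof. by rewrite -(scale0r 0) dotZl mul0r. Qed.

Lemma dot0r n (z : 'rV[R]_n) : dot z 0 = 0.
Proof. by rewrite dotC dot0l. Qed.

Lemma dot_ge0 n (x : 'rV[R]_n) : 0 <= dot x x.
Proof. by apply: sumr_ge0 => j _; rewrite -expr2 sqr_ge0. Qed.

Lemma enorm_sqr n (x : 'rV[R]_n) : enorm x ^+ 2 = dot x x.
Proof. by rewrite sqr_sqrtr ?dot_ge0. Qed.

Lemma enorm_ge0 n (x : 'rV[R]_n) : 0 <= enorm x.
Proof. exact: sqrtr_ge0. Qed.

Lemma enorm0 n : enorm (0 : 'rV[R]_n) = 0.
Proof. by rewrite /enorm dot0l sqrtr0. Qed.

Lemma enormZ n a (x : 'rV[R]_n) : enorm (a *: x) = `|a| * enorm x.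
Proof. by rewrite /enorm dotZl dotZr mulrA -expr2 sqrtrM ?sqr_ge0// sqrtr_sqr. Qed.

Lemma enormN n (x : 'rV[R]_n) : enorm (- x) = enorm x.
Proof. by rewrite -scaleN1r enormZ normrN1 mul1r. Qed.

Lemma enormB n (x y : 'rV[R]_n) : enorm (x - y) = enorm (y - x).
Proof. by rewrite -enormN opprB. Qed.

Lemma enorm_eq0 n (x : 'rV[R]_n) : enorm x = 0 -> x = 0.
Proof.
move=> /eqP; rewrite sqrtr_eq0 => x0; have {x0} /eqP : dot x x = 0.
  by apply/eqP; rewrite eq_le x0 dot_ge0.
rewrite psumr_eq0; last by move=> j _; rewrite -expr2 sqr_ge0.
move=> /allP x0; apply/rowP => j; rewrite mxE; apply/eqP.
by have := x0 j (mem_index_enum _); rewrite mulf_eq0 orbb.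
Qed.

(** Cauchy-Schwarz, by expanding the square of [enorm y *: x - enorm x *: y]. *)
Lemma dot_le n (x y : 'rV[R]_n) : dot x y <= enorm x * enorm y.
Proof.
have [/enorm_eq0 ->|x0] := eqVneq (enorm x) 0.
  by rewrite enorm0 mul0r dot0l.
have [/enorm_eq0 ->|y0] := eqVneq (enorm y) 0.
  by rewrite enorm0 mulr0 dot0r.
have x1 : 0 < enorm x by rewrite lt_def x0 enorm_ge0.
have y1 : 0 < enorm y by rewrite lt_def y0 enorm_ge0.
have := dot_ge0 (enorm y *: x - enorm x *: y).
rewrite dotBl !dotBr !dotZl !dotZr (dotC y x) -!enorm_sqr.
set a := enorm x in x1 *; set b := enorm y in y1 *; set c := dot x y => h.
have ab : 0 < a * b by rewrite mulr_gt0.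
by rewrite -(ler_pM2l ab); nra.
Qed.

Lemma enormD n (x y : 'rV[R]_n) : enorm (x + y) <= enorm x + enorm y.
Proof.
rewrite -ler_sqr ?nnegrE ?addr_ge0 ?enorm_ge0//.
rewrite enorm_sqr dotDl !dotDr (dotC y x) -!enorm_sqr.
have := dot_le x y; nra.
Qed.

Lemma young_dot n (x y : 'rV[R]_n) (c : R) : 0 < c ->
  2 * dot x y <= c * dot x x + c^-1 * dot y y.
Proof.
move=> c0; have := dot_ge0 (c *: x - y).
rewrite dotBl !dotBr !dotZl !dotZr (dotC y x) => h.
rewrite -(ler_pM2l c0) mulrDr !mulrA divff ?gt_eqF// mul1r; nra.
Qed.

Lemma dotD_le n (x y : 'rV[R]_n) :
  dot (x + y) (x + y) <= 2 * dot x x + 2 * dot y y.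
Proof.
have := dot_ge0 (x - y).
rewrite dotBl !dotBr !dotDl !dotDr (dotC y x); lra.
Qed.

Lemma ler_norm_enorm n (x : 'rV[R]_n) j : `|x 0 j| <= enorm x.
Proof.
rewrite -sqrtr_sqr ler_sqrt ?dot_ge0// /dot (bigD1 j)//= -expr2 lerDl.
by apply: sumr_ge0 => i _; rewrite -expr2 sqr_ge0.
Qed.

End Dot.

Section Blocks.
Context {R : realType} {b : nat} {nn : 'I_b -> nat}.
Local Notation V := 'rV[R]_(dim nn).

Lemma mulmx_U (x : V) s : x *m U R nn s = submxrow x s.
Proof. by rewrite /U mul_submxrow mulmx1. Qed.

Lemma mxrow_mulU (v : forall s, 'rV[R]_(nn s)) s :
  (\mxrow_s v s) *m U R nn s = v s.
Proof. by rewrite mulmx_U mxrowK. Qed.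

Lemma mxrow_U_id (x : V) : \mxrow_s (x *m U R nn s) = x.
Proof.
rewrite -[RHS]submxrowK; apply: eq_mxrow => s; exact: mulmx_U.
Qed.

Lemma dot_blocks (x y : V) :
  dot x y = \sum_s dot (x *m U R nn s) (y *m U R nn s).
Proof.
have dotE k (u v : 'rV[R]_k) : dot u v = (u *m v^T) 0 0.
  by rewrite mxE; apply: eq_bigr => j _; rewrite mxE.
rewrite dotE -{1}(mxrow_U_id x) -{1}(mxrow_U_id y) tr_mxrow mul_mxrow_mxcol.
by rewrite summxE; apply: eq_bigr => s _; rewrite dotE.
Qed.

Lemma dot_trU (g : V) s (h : 'rV[R]_(nn s)) :
  dot g (h *m (U R nn s)^T) = dot (g *m U R nn s) h.
Proof.
have dotE k (u v : 'rV[R]_k) : dot u v = (u *m v^T) 0 0.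
  by rewrite mxE; apply: eq_bigr => j _; rewrite mxE.
by rewrite !dotE trmx_mul trmxK mulmxA.
Qed.

(** Taking a dependent family [h] instead of one vector of block [s] makes the conditional well
    typed in block [r] without a cast. *)
Lemma mulmx_trU (h : forall s, 'rV[R]_(nn s)) s :
  h s *m (U R nn s)^T = \mxrow_r (if r == s then h r else 0).
Proof.
rewrite -[RHS]mulmx1 -trmx1 -(mxrow_U R nn) tr_mxrow mul_mxrow_mxcol.
rewrite [RHS](bigD1 s)//= eqxx [X in _ + X]big1 ?addr0// => r /negbTE ->.
exact: mul0mx.
Qed.

Lemma eq_blocks (x y : V) :
  (forall s, x *m U R nn s = y *m U R nn s) -> x = y.
Proof.
by move=> xy; rewrite -(mxrow_U_id x) -(mxrow_U_id y); apply: eq_mxrow.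
Qed.

End Blocks.

(** * Borel measurability of vector-valued maps *)

Section BorelVectors.
Context {R : realType}.

Lemma ball_rVE n (x y : 'rV[R]_n) (e : R) :
  ball x e y <-> 0 < e /\ forall j, `|x 0 j - y 0 j| < e.
Proof.
split => -[e0 h]; split => //; first by move=> j; exact: h.
by move=> i j; rewrite ord1; exact: h.
Qed.

Lemma continuous_measurable_rV n (g : 'rV[R]_n -> R) :
  continuous g -> measurable_fun setT (g : borel_rV R n -> R).
Proof.
move=> cg; apply: (@measurability _ _ (borel_rV R n) R setT g _
  (RGenOInfty.measurableE R)).
move=> _ [_ [x ->] <-]; rewrite setTI; apply: sub_sigma_algebra.
by apply: open_comp => [z _|]; [exact: cg|exact: interval_open].
Qed.

(** For the converse direction, an open set is the union of the countably many sup-norm cubes with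
    rational centre and radius that it contains, and the preimage of a cube is a finite intersection
    of coordinate conditions. *)
Lemma measurable_rV d (T : measurableType d) (D : set T) n (g : T -> 'rV[R]_n) :
  measurable_fun D (g : T -> borel_rV R n) <->
  forall j, measurable_fun D (fun w => g w 0 j).
Proof.
split=> [mg j|mg].
  have mj : measurable_fun setT ((fun x => x 0 j) : borel_rV R n -> R).
    by apply: continuous_measurable_rV; exact: coord_continuous.
  exact: (measurableT_comp mj mg).
move=> mD; apply: (@measurability _ _ T (borel_rV R n) D g (@open 'rV[R]_n)) => //.
move=> _ [B openB <-].
pose q (i : 'rV[rat]_n * rat) : set 'rV[R]_n :=
  [set y | forall j, `|ratr (i.1 0 j) - y 0 j| < ratr i.2].
pose I := [set i : 'rV[rat]_n * rat | q i `<=` B].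
have -> : B = \bigcup_(i in setT) (if i \in I then q i else set0).
  apply/seteqP; split => [x Bx|x [i _]]; last first.
    by case: ifPn => // /set_mem Ii; exact: Ii.
  have : nbhs x B by exact: open_nbhs_nbhs.
  rewrite -nbhs_ballE => -[e /= e0 xeO].
  have [|r] := @rat_in_itvoo R 0 (e / 2); first by rewrite divr_gt0.
  rewrite in_itv/= => /andP[r0 re].
  have : exists c : 'rV[rat]_n, forall j, `|ratr (c 0 j) - x 0 j| < ratr r.
    have /choice[c cP] : forall j, exists c : rat, `|ratr c - x 0 j| < ratr r.
      move=> j.
      have [|c] := @rat_in_itvoo R (x 0 j - ratr r) (x 0 j + ratr r); first by lra.
      rewrite in_itv/= => /andP[c1 c2]; exists c.
      by rewrite ltr_norml; apply/andP; split; lra.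
    by exists (\row_j c j) => j; rewrite mxE.
  move=> [c cP]; exists (c, r) => //; rewrite mem_set//.
  move=> y yq; apply: xeO; apply/ball_rVE; split => // j.
  have := yq j; have := cP j; rewrite !ltr_norml/= => /andP[? ?] /andP[? ?].
  by apply/andP; split; lra.
rewrite preimage_bigcup setI_bigcupr.
apply: countable_bigcupT_measurable => // i.
case: ifPn => _; last by rewrite preimage_set0 setI0.
rewrite (_ : _ `&` _ = D `&` \bigcap_(j in setT)
   (D `&` (fun w => `|ratr (i.1 0 j) - g w 0 j|) @^-1` `]-oo, ratr i.2[)); last first.
  apply/seteqP; split => w /= [Dw h]; split => //.
    by move=> j _ /=; split => //; rewrite in_itv/=; exact: h.
  by move=> j; have [_] := h j Logic.I; rewrite /= in_itv.
apply: measurableI => //; apply: fin_bigcap_measurable => // j _.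
have mh : measurable_fun D (fun w => `|ratr (i.1 0 j) - g w 0 j|).
  by apply: measurableT_comp => //; exact: measurable_funB.
by apply: mh => //; exact: measurable_itv.
Qed.

Lemma measurable_coord n j : measurable_fun setT ((fun x => x 0 j) : borel_rV R n -> R).
Proof. by apply: continuous_measurable_rV; exact: coord_continuous. Qed.

Section Operations.
Context d (T : measurableType d) (D : set T).

Lemma measurable_coord_comp n (g : T -> borel_rV R n) j :
  measurable_fun D g -> measurable_fun D (fun w => (g w : 'rV_n) 0 j).
Proof. by move/measurable_rV. Qed.

Lemma measurable_rVD n (g h : T -> 'rV[R]_n) :
  measurable_fun D (g : T -> borel_rV R n) ->
  measurable_fun D (h : T -> borel_rV R n) ->
  measurable_fun D ((fun w => g w + h w) : T -> borel_rV R n).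
Proof.
move=> /measurable_rV mg /measurable_rV mh; apply/measurable_rV => j.
by under eq_fun do rewrite mxE; exact: measurable_funD.
Qed.

Lemma measurable_rVZ n (c : T -> R) (h : T -> 'rV[R]_n) :
  measurable_fun D c ->
  measurable_fun D (h : T -> borel_rV R n) ->
  measurable_fun D ((fun w => c w *: h w) : T -> borel_rV R n).
Proof.
move=> mc /measurable_rV mh; apply/measurable_rV => j.
by under eq_fun do rewrite mxE; exact: measurable_funM.
Qed.

Lemma measurable_rVN n (h : T -> 'rV[R]_n) :
  measurable_fun D (h : T -> borel_rV R n) ->
  measurable_fun D ((fun w => - h w) : T -> borel_rV R n).
Proof.
move=> mh; under eq_fun do rewrite -scaleN1r.
by apply: measurable_rVZ => //; exact: measurable_cst.
Qed.

Lemma measurable_rVB n (g h : T -> 'rV[R]_n) :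
  measurable_fun D (g : T -> borel_rV R n) ->
  measurable_fun D (h : T -> borel_rV R n) ->
  measurable_fun D ((fun w => g w - h w) : T -> borel_rV R n).
Proof. by move=> mg mh; apply: measurable_rVD => //; exact: measurable_rVN. Qed.

Lemma measurable_rV_sum n (I : Type) (r : seq I) (h : I -> T -> 'rV[R]_n) :
  (forall i, measurable_fun D (h i : T -> borel_rV R n)) ->
  measurable_fun D ((fun w => \sum_(i <- r) h i w) : T -> borel_rV R n).
Proof.
move=> mh; apply/measurable_rV => j.
under eq_fun do rewrite summxE.
by apply: measurable_sum => i; have /measurable_rV := mh i.
Qed.

Lemma measurable_rV_mulmx n m (A : 'M[R]_(n, m)) (h : T -> 'rV[R]_n) :
  measurable_fun D (h : T -> borel_rV R n) ->
  measurable_fun D ((fun w => h w *m A) : T -> borel_rV R m).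
Proof.
move=> /measurable_rV mh; apply/measurable_rV => j.
under eq_fun do rewrite mxE.
by apply: measurable_sum => i; apply: measurable_funM => //; exact: measurable_cst.
Qed.

Lemma measurable_dot n (g h : T -> 'rV[R]_n) :
  measurable_fun D (g : T -> borel_rV R n) ->
  measurable_fun D (h : T -> borel_rV R n) ->
  measurable_fun D (fun w => dot (g w) (h w)).
Proof.
move=> /measurable_rV mg /measurable_rV mh.
by apply: measurable_sum => i; exact: measurable_funM.
Qed.

Lemma measurable_mxrow b (nn : 'I_b -> nat)
    (g : forall s, T -> 'rV[R]_(nn s)) :
  (forall s, measurable_fun D (g s : T -> borel_rV R (nn s))) ->
  measurable_fun D ((fun w => \mxrow_s g s w) : T -> borel_rV R (dim nn)).
Proof.
move=> mg; apply/measurable_rV => j; under eq_fun do rewrite mxE.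
exact: measurable_coord_comp.
Qed.

End Operations.

End BorelVectors.

(** * Gradients and proximal points *)

Lemma cvg_dot (R : realType) (n : nat) (T : Type) (F : set_system T)
    (FF : Filter F) (u v : T -> 'rV[R]_n) (x y : 'rV[R]_n) :
  u @ F --> x -> v @ F --> y -> dot (u t) (v t) @[t --> F] --> dot x y.
Proof.
move=> ux vy; apply: (cvg_big (op := +%R)) => [|j _]; first exact: add_continuous.
have coord (w : T -> 'rV[R]_n) (z : 'rV[R]_n) : w @ F --> z -> w t 0 j @[t --> F] --> z 0 j.
  move=> wz; apply: (@cvg_comp _ _ _ w (fun z : 'rV[R]_n => z 0 j) _ _ _ wz).
  exact: coord_continuous.
by apply: cvgM; exact: coord.
Qed.

Section Gradient.
Context {R : realType} {n : nat}.
Implicit Types (g : 'rV[R]_n -> R) (x y h : 'rV[R]_n).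

Lemma diff_grad g x h : differentiable (g : 'rV[R]_n -> R^o) x ->
  'd (g : 'rV[R]_n -> R^o) x h = dot (grad g x) h.
Proof.
move=> dg; rewrite [in LHS](row_sum_delta h) linear_sum.
by apply: eq_bigr => j _; rewrite linearZ mxE mulrC.
Qed.

Lemma is_derive_line g x h (t : R) :
  differentiable (g : 'rV[R]_n -> R^o) (x + t *: h) ->
  is_derive t (1 : R) (fun s => g (x + s *: h) : R^o) (dot (grad g (x + t *: h)) h).
Proof.
move=> dg.
have E : (fun s : R => s^-1 *: (((fun s => g (x + s *: h) : R^o) \o shift t) (s *: (1 : R^o)) - g (x + t *: h) : R^o)) =
     (fun s : R => s^-1 *: (((g : 'rV[R]_n -> R^o) \o shift (x + t *: h)) (s *: h) - g (x + t *: h))).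
  apply/funext => s /=; congr (_ *: (g _ - _)).
  by rewrite scalerDl addrCA [s *: 1]mulr1.
split; first by rewrite /derivable E; exact: diff_derivable.
by rewrite /derive E -diff_grad// -deriveE.
Qed.

(** The mean value theorem applies to [p], whose derivative is at most 0 on the segment. Only the
    increment of the gradient along [h] is bounded, so the lemma serves both the blockwise constants
    L_s and, through g and -g, the global constant Lf. *)
Lemma taylor_upper g x h (K : R) : differentiable_everywhere g ->
  (forall t : R, 0 <= t <= 1 -> dot (grad g (x + t *: h) - grad g x) h <= K * t) ->
  g (x + h) <= g x + dot (grad g x) h + K / 2.
Proof.
move=> dg hK.
pose p (t : R) : R := g (x + t *: h) - t * dot (grad g x) h - K / 2 * t ^+ 2.
pose dp (t : R) : R := dot (grad g (x + t *: h)) h - dot (grad g x) h - K * t.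
have dpP t : is_derive t (1 : R) p (dp t).
  have := is_derive_line (dg (x + t *: h)) => H.
  apply: is_derive_eq.
  have sc (u v : R) : u *: (v : R^o) = u * v by [].
  rewrite /dp scaler0 add0r !sc !mulr1; congr (_ - _).
  by rewrite mulrDr -mulrDl -splitr.
have pcont : {within `[0, 1], continuous p}.
  apply: continuous_subspaceT => t.
  by apply/differentiable_continuous/derivable1_diffP; have [] := dpP t.
have [c] := MVT ltr01 (fun t _ => dpP t) pcont.
rewrite in_itv/= => /andP[c0 c1].
rewrite /p scale1r scale0r addr0 => e.
have := hK c; rewrite (ltW c0) (ltW c1) dotBl => /(_ isT) hc.
move: e; rewrite /dp mul1r expr1n mulr1 mul0r expr0n mulr0 !subr0 mulr1.
move: hc; move: (grad g (x + c *: h)) => A; clear.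
by move: (dot A h) (dot (grad g x) h) => u v; lra.
Qed.

(** Divide the strong convexity inequality at the point x + t (y - x) by t and let t decrease to
    0. *)
Lemma strong_convex_grad g x y : differentiable_everywhere g ->
  strongly_convex1 g ->
  g x + dot (grad g x) (y - x) + 2^-1 * dot (y - x) (y - x) <= g y.
Proof.
move=> dg sg.
have := is_derive_line (dg (x + 0 *: (y - x))).
rewrite scale0r addr0 => -[d0 d0E].
suff : dot (grad g x) (y - x) <= g y - g x - 2^-1 * dot (y - x) (y - x) by lra.
rewrite -d0E.
pose q (t : R) := t^-1 * (g (x + t *: (y - x)) - g x).
have qc : q t @[t --> 0^'] --> (dot (grad g x) (y - x)).
  move: d0; rewrite /derivable -d0E /derive /=.
  under eq_fun do rewrite addr0 [_ *: 1]mulr1 scale0r addr0.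
  by [].
pose r (t : R) := g y - g x - 2^-1 * (1 - t) * dot (y - x) (y - x).
have qr t : 0 < t < 1 -> q t <= r t.
  move=> /andP[t0 t1]; rewrite /q ler_pdivrMl//.
  have := sg y x t; rewrite (ltW t0) (ltW t1) => /(_ isT).
  rewrite enorm_sqr (_ : t *: y + (1 - t) *: x = x + t *: (y - x)); last first.
    by rewrite scalerBl scalerBr scale1r addrCA.
  by rewrite /r; lra.
have rc : r t @[t --> 0] --> r 0.
  rewrite /r; apply: cvgB; first exact: cvg_cst.
  apply: cvgM; last exact: cvg_cst.
  apply: cvgM; first exact: cvg_cst.
  by apply: cvgB; [exact: cvg_cst|exact: cvg_id].
have -> : g y - g x - 2^-1 * dot (y - x) (y - x) = r 0 by rewrite /r subr0 mulr1.
rewrite d0E.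
apply: (@ler_cvg_to _ (0^'+) _ _ q r) => //.
- by apply: cvg_dnbhs_at_right.
- by apply: cvg_at_right_filter; exact: rc.
- near=> t; apply: qr; apply/andP; split; first by near: t; exact: nbhs_right_gt.
  by near: t; exact: nbhs_right_lt.
Unshelve. all: by end_near. Qed.

End Gradient.

Section Prox.
Context {R : realType} {m : nat}.
Variables (Xs : set 'rV[R]_m) (chi phi : 'rV[R]_m -> R).
Hypothesis Xs_closed : closed Xs.
Hypothesis Xs_convex : convex_set Xs.
Hypothesis chi_cc : closed_convex_function chi.
Hypothesis phi_diff : differentiable_everywhere phi.
Hypothesis phi_sc : strongly_convex1 phi.

Definition prox_obj (x g : 'rV[R]_m) (a : R) (y : 'rV[R]_m) : R :=
  dot g y + a^-1 * bregman phi y x + chi y.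

(** Minimality up to [delta] with the quadratic growth of a strongly convex objective built in.
    Testing two such points against each other bounds their distance, and with [delta = 0] it
    describes the exact proximal point. *)
Definition approx_prox (x g : 'rV[R]_m) (a delta : R) (y : 'rV[R]_m) : Prop :=
  Xs y /\ forall z, Xs z ->
    prox_obj x g a y - delta + (2 * a)^-1 * dot (z - y) (z - y) <= prox_obj x g a z.

Lemma convex_comb (x y : 'rV[R]_m) (t : R) : Xs x -> Xs y -> 0 <= t <= 1 ->
  Xs ((1 - t) *: x + t *: y).
Proof.
move=> xX yX /andP[t0 t1].
have := Xs_convex (Itv01 t0 t1) (mem_set yX) (mem_set xX).
by rewrite inE addrC.
Qed.

Lemma cndg_returns_in (x g y : 'rV[R]_m) (a delta : R) : Xs x ->
  cndg_returns Xs chi phi x g a delta y -> Xs y.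
Proof.
move=> xX [N [u [v [[N1 u1] hv hu [_ ->]]]]].
have : forall t, (1 <= t <= N)%N -> Xs (u t).
  elim => [//|t IH] /andP[_ tN]; have [->|t0] := posnP t; first by rewrite u1.
  have [|_ ->] := hu t; first by rewrite t0.
  apply: convex_comb.
  - by apply: IH; rewrite t0 ltnW.
  - by have [|] := hv t; first by rewrite t0 ltnW.
  - rewrite divr_ge0 ?ler0n//= ler_pdivrMr ?ltr0n// mul1r ler_nat.
    by rewrite ltnS.
by apply; rewrite N1 leqnn.
Qed.

Lemma cndg_returns_gap (x g y : 'rV[R]_m) (a delta : R) :
  cndg_returns Xs chi phi x g a delta y -> forall z, Xs z ->
  - delta <= dot (g + a^-1 *: (grad phi y - grad phi x)) (z - y) + chi z - chi y.
Proof.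
move=> [N [u [v [[N1 u1] hv hu [h ->]]]]] z zX.
have [|_ /(_ z zX) h'] := hv N; first by rewrite N1 leqnn.
exact: le_trans h h'.
Qed.

(** The stopping test bounds below, over all of [Xs], the objective linearized in its Bregman part
    only. Strong convexity of [phi] at [y] turns the linearization back into the objective and
    leaves the quadratic surplus. *)
Lemma cndg_returns_approx (x g y : 'rV[R]_m) (a delta : R) : 0 < a -> Xs x ->
  cndg_returns Xs chi phi x g a delta y -> approx_prox x g a delta y.
Proof.
move=> a0 xX hy; split; first exact: cndg_returns_in hy.
move=> z zX; have := cndg_returns_gap hy zX.
have := strong_convex_grad y z phi_diff phi_sc.
move=> h1 h2.
have {}h1 : a^-1 * (phi y + dot (grad phi y) (z - y) + 2^-1 * dot (z - y) (z - y))
    <= a^-1 * phi z by rewrite ler_pM2l ?invr_gt0.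
move: h1 h2; rewrite /prox_obj /bregman.
generalize (grad phi x) (grad phi y) => gx gy.
rewrite invfM !dotDl !dotNl !dotZl !dotDl !dotNl !dotDr !dotNr.
lra.
Qed.

Section Existence.
Variables (x g : 'rV[R]_m) (a : R).
Hypothesis a_gt0 : 0 < a.
Hypothesis approxE : forall delta : R, 0 < delta -> exists y, approx_prox x g a delta y.
Local Notation obj := (prox_obj x g a).

Lemma approx_prox_dist d1 d2 y1 y2 :
  approx_prox x g a d1 y1 -> approx_prox x g a d2 y2 ->
  dot (y1 - y2) (y1 - y2) <= a * (d1 + d2).
Proof.
move=> [X1 h1] [X2 h2]; have := h1 _ X2; have := h2 _ X1.
rewrite -(opprB y1 y2) !dotNl !dotNr opprK invfM => k1 k2.
have : a * (a^-1 * dot (y1 - y2) (y1 - y2)) <= a * (d1 + d2) by rewrite ler_pM2l//; lra.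
by rewrite mulrA divff ?gt_eqF// mul1r.
Qed.

(** Approximate proximal points at accuracies 1/(k+1) form a Cauchy sequence by quadratic growth.
    Their limit is minimal: [phi] is continuous, and [chi] passes to the limit through its closed
    epigraph. *)
Lemma exact_prox : exists p, approx_prox x g a 0 p.
Proof.
pose e (k : nat) : R := k.+1%:R^-1.
have e0 k : 0 < e k by rewrite invr_gt0 ltr0n.
have ecvg : e k @[k --> \oo] --> 0 by exact: cvg_harmonic.
have /choice[y yP] : forall k, exists y, approx_prox x g a (e k) y.
  by move=> k; exact: approxE.
have de k i : (k <= i)%N -> enorm (y i - y k) <= Num.sqrt (2 * a * e k).
  move=> ki; rewrite ler_sqrt; last by rewrite !mulr_ge0// ltW.
  apply: le_trans (approx_prox_dist (yP i) (yP k)) _.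
  have : e i <= e k by rewrite lef_pV2 ?posrE ?ltr0n// ler_nat.
  by move=> ei; rewrite [leRHS](_ : _ = a * (e k + e k)); [rewrite ler_pM2l// lerD2r|ring].
have ycvg : cvg (y @ \oo).
  apply: cauchy_cvg; apply: cauchy_exP => eps eps0.
  have : \forall k \near \oo, e k < eps ^+ 2 / (2 * a).
    have /cvgr_lt := ecvg; apply; apply: divr_gt0; first by rewrite exprn_gt0.
    by rewrite mulr_gt0.
  move=> [k _ /(_ k (leqnn _)) /= ek]; exists (y k).
  exists k => // i /= ki; apply/ball_rVE; split => // j.
  have := ler_norm_enorm (y k - y i) j; rewrite !mxE => h.
  rewrite (le_lt_trans h)// enormB (le_lt_trans (de _ _ ki))//.
  rewrite -[ltRHS]ger0_norm ?(ltW eps0)// -sqrtr_sqr ltr_sqrt ?exprn_gt0//.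
  by move: ek; rewrite ltr_pdivlMr ?mulr_gt0// mulrC.
pose p := lim (y @ \oo).
have yp : y k @[k --> \oo] --> p by [].
have Xp : Xs p.
  have nX : \forall k \near \oo, Xs (y k) by apply: nearW => k; have [] := yP k.
  exact: (@closed_cvg nat _ \oo _ y Xs Xs_closed nX p yp).
pose sm y := dot g y + a^-1 * bregman phi y x.
have smc : sm (y k) @[k --> \oo] --> sm p.
  apply: cvgD; first by apply: cvg_dot yp; exact: cvg_cst.
  apply: cvgM; first exact: cvg_cst.
  apply: cvgB; last first.
    by apply: cvg_dot; [exact: cvg_cst|apply: cvgB => //; exact: cvg_cst].
  apply: cvgB; last exact: cvg_cst.
  apply: (cvg_comp y (phi : _ -> R^o) yp).
  exact: differentiable_continuous (phi_diff p).
(* Solving the inequality of [approx_prox] for [chi (y k)] gives an upper bound [r k] that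
   converges, so the pairs [(y k, r k)] stay in the epigraph of [chi] and so does their limit. *)
have key z : Xs z -> chi p <= obj z - sm p - (2 * a)^-1 * dot (z - p) (z - p).
  move=> Xz.
  have dc : dot (z - y k) (z - y k) @[k --> \oo] --> dot (z - p) (z - p).
    have cc : (z - y k) @[k --> \oo] --> z - p by apply: cvgB => //; exact: cvg_cst.
    exact: cvg_dot.
  pose r k := obj z + e k - sm (y k) - (2 * a)^-1 * dot (z - y k) (z - y k).
  have rc : r k @[k --> \oo] --> obj z + 0 - sm p - (2 * a)^-1 * dot (z - p) (z - p).
    apply: cvgB; last by apply: cvgM => //; exact: cvg_cst.
    by apply: cvgB => //; apply: cvgD => //; exact: cvg_cst.
  rewrite -[obj z]addr0.
  have epi : closed [set q : 'rV[R]_m * R | chi q.1 <= q.2] by have [] := chi_cc.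
  have yr : (y k, r k) @[k --> \oo] --> (p, obj z + 0 - sm p - (2 * a)^-1 * dot (z - p) (z - p)).
    exact: (cvg_pair yp rc).
  suff nE : \forall k \near \oo, [set q : 'rV[R]_m * R | chi q.1 <= q.2] (y k, r k).
    exact: (@closed_cvg nat _ \oo _ (fun k => (y k, r k)) _ epi nE _ yr).
  apply: nearW => k /=.
  have [_ /(_ z Xz)] := yP k; rewrite /r /prox_obj -/(sm _); lra.
exists p; split => // z Xz; have := key z Xz.
by rewrite [prox_obj _ _ _ p]/prox_obj -/(sm p); lra.
Qed.

(** [prox_block] is a [get], meaningful once a minimizer exists. The point of [exact_prox] is one,
    and its quadratic growth makes it the only one, so the chosen point inherits the growth
    inequality. *)
Lemma prox_blockP : approx_prox x g a 0 (prox_block Xs chi phi x g a).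
Proof.
have [p pP] := exact_prox.
have [Xq qmin] : [set y | Xs y /\ forall z, Xs z -> obj y <= obj z]
    (prox_block Xs chi phi x g a).
  apply: getPex; exists p; have [Xp h] := pP; split => // z Xz.
  apply: le_trans (h z Xz); rewrite subr0 lerDl mulr_ge0 ?dot_ge0//.
  by rewrite invr_ge0 mulr_ge0// ltW.
set q := prox_block _ _ _ _ _ _ in Xq qmin *.
suff -> : q = p by [].
have [Xp h] := pP; have := h q Xq; have := qmin p Xp; rewrite subr0 => h1 h2.
have h3 : (2 * a)^-1 * dot (q - p) (q - p) <= 0 by lra.
apply/eqP; rewrite -subr_eq0; apply/eqP/enorm_eq0/eqP.
move: h3; rewrite pmulr_rle0 ?invr_gt0 ?mulr_gt0// -enorm_sqr => h3.
by rewrite -sqrf_eq0 eq_le h3 sqr_ge0.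
Qed.

End Existence.

(** Each growth inequality is tested at the other point. In the sum the terms in [phi] and [chi]
    cancel and only the difference of the linear parts remains. *)
Lemma prox_block_dist (x g1 g2 : 'rV[R]_m) (a d1 d2 : R) y1 y2 : 0 < a ->
  approx_prox x g1 a d1 y1 -> approx_prox x g2 a d2 y2 ->
  dot (y1 - y2) (y1 - y2) <= a * (d1 + d2) + a * dot (g1 - g2) (y2 - y1).
Proof.
move=> a_gt0 [X1 h1] [X2 h2]; have := h1 _ X2; have := h2 _ X1.
have -> : dot (g1 - g2) (y2 - y1) = dot g1 y2 - dot g1 y1 - (dot g2 y2 - dot g2 y1).
  by rewrite dotBl (dotBr y2 y1 g1) (dotBr y2 y1 g2).
rewrite -(opprB y1 y2) ![dot (- (y1 - y2)) _]dotNl ![dot _ (- (y1 - y2))]dotNr.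
rewrite opprK invfM /prox_obj; set D := dot (y1 - y2) _ => k1 k2.
have : a * (a^-1 * D) <=
    a * (d1 + d2 + (dot g1 y2 - dot g1 y1 - (dot g2 y2 - dot g2 y1))).
  by rewrite ler_pM2l//; lra.
by rewrite mulrA divff ?gt_eqF// mul1r; lra.
Qed.

(** Used at two accuracies: [d = 0] makes the proximal map Lipschitz in the gradient, and [d > 0]
    compares the output of [CndG] for the estimated gradient with the exact point for the true
    one. *)
Lemma approx_prox_lipschitz (x g1 g2 : 'rV[R]_m) (a d : R) y1 y2 : 0 < a -> 0 <= d ->
  approx_prox x g1 a d y1 -> approx_prox x g2 a 0 y2 ->
  dot (y1 - y2) (y1 - y2) <= 2 * (a * d) + a ^+ 2 * dot (g1 - g2) (g1 - g2).
Proof.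
move=> a0 d0 h1 h2; have := prox_block_dist a0 h1 h2.
have := young_dot (g1 - g2) (y2 - y1) a0.
rewrite -(opprB y1 y2) !dotNl !dotNr opprK addr0.
set D := dot (y1 - y2) _; set E := dot (g1 - g2) (g1 - g2).
set Z := dot (g1 - g2) _ => k1 k2.
have : a * (2 * - Z) <= a * (a * E + a^-1 * D) by rewrite ler_pM2l.
rewrite mulrDr [a * (a^-1 * _)]mulrA divff ?gt_eqF// mul1r; lra.
Qed.

End Prox.

(** * Descent along one block *)

Section Descent.
Context {R : realType}.

Lemma strong_monotone m (phi : 'rV[R]_m -> R) x y :
  differentiable_everywhere phi -> strongly_convex1 phi ->
  dot (y - x) (y - x) <= dot (grad phi y - grad phi x) (y - x).
Proof.
move=> dphi sphi.
have := strong_convex_grad x y dphi sphi; have := strong_convex_grad y x dphi sphi.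
generalize (grad phi x) (grad phi y) => gx gy.
rewrite -(opprB y x); move: (y - x) => d; rewrite dotBl !dotNr !dotNl; lra.
Qed.

(** Put D = |y - x|^2. The stopping test at z = x and strong monotonicity of [grad phi] give a
    decrease of D/a, up to [delta]. It is spent exactly: D/(4a) on the smoothness term, since L <=
    1/(2a), D/(4a) on the error g - gx by Young, and D/(2a) on replacing [y] by the exact point [p].
    The last two also cost a and a/2 times |g - gx|^2, and the replacement of [y] a second
    [delta]. *)
Lemma block_descent m (Xs : set 'rV[R]_m) (chi phi : 'rV[R]_m -> R)
    (x g gx y p : 'rV[R]_m) (a delta L : R) :
  convex_set Xs -> differentiable_everywhere phi -> strongly_convex1 phi ->
  0 < a -> 0 < delta -> L <= (2 * a)^-1 -> Xs x ->
  cndg_returns Xs chi phi x g a delta y -> approx_prox Xs chi phi x gx a 0 p ->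
  chi y + dot gx (y - x) + L / 2 * dot (y - x) (y - x)
    + a / 4 * dot (a^-1 *: (x - p)) (a^-1 *: (x - p))
  <= chi x + 3 / 2 * a * dot (g - gx) (g - gx) + 2 * delta.
Proof.
move=> Xc dphi sphi a0 d0 La Xx hy hp.
have gapx := cndg_returns_gap hy Xx.
have mono := strong_monotone x y dphi sphi.
have lip := approx_prox_lipschitz a0 (ltW d0)
  (cndg_returns_approx Xc dphi sphi a0 Xx hy) hp.
have par := dotD_le (x - y) (y - p); rewrite addrA subrK in par.
have young := young_dot (g - gx) (- (y - x)) (mulr_gt0 (ltr0n R 2) a0).
move: gapx mono par young; generalize (grad phi y) (grad phi x) => gy gpx.
rewrite -(opprB y x) dotZl dotZr mulrA.
set d := y - x; set N := dot (g - gx) _ in lip *; set E := dot (y - p) _ in lip *.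
rewrite !dotNr !dotNl opprK invfM.
set D := dot d d; set B := dot (x - p) _.
rewrite (_ : dot (g + _) d = dot g d + a^-1 * (dot gy d - dot gpx d)); last first.
  by rewrite dotDl dotZl dotBl.
rewrite (_ : dot (gy - gpx) d = dot gy d - dot gpx d); last by rewrite dotBl.
rewrite (_ : dot (g - gx) d = dot g d - dot gx d); last by rewrite dotBl.
move=> gapx mono par young.
have ai : 0 < a^-1 by rewrite invr_gt0.
have mono' : a^-1 * D <= a^-1 * (dot gy d - dot gpx d) by rewrite ler_pM2l.
have lip' : a^-1 * E <= 2 * delta + a * N.
  have : a^-1 * E <= a^-1 * (2 * (a * delta) + a ^+ 2 * N) by rewrite ler_pM2l.
  rewrite (_ : a^-1 * (_ + _) = 2 * delta + a * N)//.
  by field; rewrite gt_eqF.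
have par' : a^-1 * B <= a^-1 * (2 * D + 2 * E) by rewrite ler_pM2l.
have D0 : 0 <= D by exact: dot_ge0.
have La' : L * D <= 2^-1 / a * D by apply: ler_wpM2r => //; rewrite -invfM.
have -> : a / 4 / a * (a^-1 * B) = 4^-1 * (a^-1 * B).
  by field; rewrite gt_eqF.
lra.
Qed.

End Descent.

(** * Independence *)

Definition indep_rv (R : realType) d (Om : measurableType d) (P : probability Om R)
    d1 (T1 : measurableType d1) d2 (T2 : measurableType d2)
    (X : Om -> T1) (Y : Om -> T2) : Prop :=
  forall A B, measurable A -> measurable B ->
    (P (X @^-1` A `&` Y @^-1` B) = P (X @^-1` A) * P (Y @^-1` B))%E.

Section Decoupling.
Local Open Scope ereal_scope.
Context (R : realType) d (Om : measurableType d) (P : probability Om R).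
Context d1 (T1 : measurableType d1) d2 (T2 : measurableType d2).
Variables (X : Om -> T1) (Y : Om -> T2).
Hypotheses (mX : measurable_fun setT X) (mY : measurable_fun setT Y).
Hypothesis XY : indep_rv P X Y.

Let mfX : {mfun Om >-> T1} := HB.pack X (isMeasurableFun.Build _ _ _ _ X mX).
Let mfY : {mfun Om >-> T2} := HB.pack Y (isMeasurableFun.Build _ _ _ _ Y mY).
Let Z (w : Om) := (X w, Y w).
Let mZ : measurable_fun setT Z. Proof. exact: measurable_fun_pair. Qed.
Let mfZ : {mfun Om >-> (T1 * T2)%type} :=
  HB.pack Z (isMeasurableFun.Build _ _ _ _ Z mZ).

Let lawZ S : measurable S ->
  (distribution P mfX \x distribution P mfY) S = distribution P mfZ S.
Proof.
by move=> mS; apply: product_measure_unique => // A B mA mB; exact: XY.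
Qed.

(** The law of the pair is the product of the marginal laws, by uniqueness of product measures;
    Tonelli applies there, and both integrals are carried back to [P]. *)
Lemma ge0_integral_indep (phi : T1 * T2 -> \bar R) :
  measurable_fun setT phi -> (forall z, 0 <= phi z) ->
  \int[P]_w phi (X w, Y w) = \int[P]_w \int[P]_w' phi (X w, Y w').
Proof.
move=> mphi phi0.
transitivity (\int[distribution P mfZ]_z phi z).
  by rewrite ge0_integral_distribution.
transitivity (\int[distribution P mfX \x distribution P mfY]_z phi z).
  by apply: eq_measure_integral => S mS _; exact/esym/lawZ.
rewrite fubini_tonelli1//.
rewrite ge0_integral_distribution//.
- apply: eq_integral => w _ /=; rewrite /fubini_F ge0_integral_distribution//.
  by apply: measurableT_comp => //; exact: measurable_pair1.
- exact: measurable_fun_fubini_tonelli_F.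
- by move=> x; apply: integral_ge0.
Qed.

Lemma integral_indep (phi : T1 * T2 -> \bar R) :
  measurable_fun setT phi -> P.-integrable setT (fun w => phi (X w, Y w)) ->
  \int[P]_w phi (X w, Y w) = \int[P]_w \int[P]_w' phi (X w, Y w').
Proof.
move=> mphi iphi.
have iZ : (distribution P mfX \x distribution P mfY).-integrable setT phi.
  apply/integrableP; split => //.
  rewrite (eq_measure_integral (distribution P mfZ)) => [|S mS _]; last exact: lawZ.
  rewrite ge0_integral_distribution//; last exact: measurableT_comp.
  by have /integrableP[] := iphi.
have mF := measurable_fubini_F iZ.
have iF := integrable_fubini_F iZ.
transitivity (\int[distribution P mfZ]_z phi z).
  by rewrite integral_distribution.
transitivity (\int[distribution P mfX \x distribution P mfY]_z phi z).
  by apply: eq_measure_integral => S mS _; exact/esym/lawZ.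
rewrite -integral12_prod_meas1// integral_distribution//.
  apply: eq_integral => w _.
  have mphiw : measurable_fun setT (fun y => phi (X w, y)).
    by apply: measurableT_comp => //; exact: measurable_pair1.
  rewrite /= /fubini_F [LHS]integralE [RHS]integralE.
  congr (_ - _).
    rewrite ge0_integral_distribution//; last exact: measurable_funepos.
    by apply: eq_integral => w' _; rewrite /= !funeposE.
  rewrite ge0_integral_distribution//; last exact: measurable_funeneg.
    by apply: eq_integral => w' _; rewrite /= !funenegE.
apply/integrableP; split; first exact: measurableT_comp.
rewrite -[X in X < _](@ge0_integral_distribution _ _ _ _ _ P mfX (abse \o fubini_F (distribution P mfY) phi))//.
  by have /integrableP[] := iF.
  exact: measurableT_comp.
by move=> y; exact: abse_ge0.
Qed.

(** The form in which conditioning on [X] is used: a bound for every frozen value [X w] suffices. *)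
Lemma ge0_integral_indep_le (phi : T1 * T2 -> \bar R) (h : Om -> \bar R) :
  measurable_fun setT phi -> (forall z, 0 <= phi z) -> measurable_fun setT h ->
  (forall w, \int[P]_w' phi (X w, Y w') <= h w) ->
  \int[P]_w phi (X w, Y w) <= \int[P]_w h w.
Proof.
move=> mphi phi0 mh le; rewrite ge0_integral_indep//; apply: ge0_le_integral => //.
- by move=> w _; exact: integral_ge0.
- apply: (measurable_fun_fubini_tonelli_F (fun z => phi (X z.1, Y z.2))) => //.
  apply: measurableT_comp => //; apply: measurable_fun_pair.
    exact: (measurableT_comp mX (@measurable_fst _ _ _ _)).
  exact: (measurableT_comp mY (@measurable_snd _ _ _ _)).
Qed.

End Decoupling.

Section ExpectationProduct.
Local Open Scope ereal_scope.
Context (R : realType) d (Om : measurableType d) (P : probability Om R).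
Variables (X Y : Om -> R).
Hypotheses (mX : measurable_fun setT X) (mY : measurable_fun setT Y).
Hypothesis XY : indep_rv P X Y.

Lemma ge0_integralM_indep : (forall w, (0 <= X w)%R) -> (forall w, (0 <= Y w)%R) ->
  \int[P]_w (X w * Y w)%:E = \int[P]_w (X w)%:E * \int[P]_w (Y w)%:E.
Proof.
move=> X0 Y0.
transitivity (\int[P]_w (`|X w| * `|Y w|)%:E).
  by apply: eq_integral => w _; rewrite !ger0_norm.
rewrite (ge0_integral_indep mX mY XY (phi := fun z => (`|z.1| * `|z.2|)%:E)) //=.
- under eq_integral => w _.
    under eq_integral => w' _ do rewrite EFinM.
    rewrite ge0_integralZl//=; last first.
      by apply/measurable_EFinP; apply: measurableT_comp.
    over.
  rewrite ge0_integralZr//=.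
  + by congr (_ * _); apply: eq_integral => w _; rewrite ger0_norm.
  + by apply/measurable_EFinP; apply: measurableT_comp.
  + by apply: integral_ge0 => w _; rewrite lee_fin.
- apply/measurable_EFinP; apply: measurable_funM; apply: measurableT_comp => //.
Qed.
End ExpectationProduct.

Section ExpectationProduct2.
Local Open Scope ereal_scope.
Context (R : realType) d (Om : measurableType d) (P : probability Om R).
Variables (X Y : Om -> R).
Hypothesis XY : indep_rv P X Y.
Hypotheses (iX : P.-integrable setT (EFin \o X)) (iY : P.-integrable setT (EFin \o Y)).

Let mX : measurable_fun setT X.
Proof. by apply/measurable_EFinP; exact: measurable_int iX. Qed.
Let mY : measurable_fun setT Y.
Proof. by apply/measurable_EFinP; exact: measurable_int iY. Qed.

Lemma indep_rv_comp d1 (T1 : measurableType d1) d2 (T2 : measurableType d2)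
    d3 (T3 : measurableType d3) d4 (T4 : measurableType d4)
    (X' : Om -> T1) (Y' : Om -> T2) (f : T1 -> T3) (g : T2 -> T4) :
  indep_rv P X' Y' -> measurable_fun setT f -> measurable_fun setT g ->
  indep_rv P (f \o X') (g \o Y').
Proof.
move=> XY' mf mg A B mA mB; apply: (XY' (f @^-1` A) (g @^-1` B)).
  by rewrite -[_ @^-1` _]setTI; exact: mf.
by rewrite -[_ @^-1` _]setTI; exact: mg.
Qed.

Lemma integrableM_indep : P.-integrable setT (EFin \o (X \* Y)%R).
Proof.
apply/integrableP; split.
  by apply/measurable_EFinP; exact: measurable_funM.
rewrite /=; under eq_integral do rewrite normrM.
rewrite (ge0_integralM_indep (X := @Num.norm _ R \o X) (Y := @Num.norm _ R \o Y)) //=.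
- rewrite lte_mul_pinfty//.
  + exact: integral_ge0.
  + apply/fin_numPlt; rewrite (lt_le_trans (ltNyr 0))//=; last exact: integral_ge0.
    by have /integrableP[_] := iX.
  + by have /integrableP[_] := iY.
- exact: measurableT_comp.
- exact: measurableT_comp.
- exact: indep_rv_comp.
Qed.

Lemma integralM_indep :
  \int[P]_w (X w * Y w)%:E = \int[P]_w (X w)%:E * \int[P]_w (Y w)%:E.
Proof.
rewrite (integral_indep mX mY XY (phi := fun z => (z.1 * z.2)%:E)) /=.
- under eq_integral => w _.
    under eq_integral => w' _ do rewrite EFinM.
    rewrite integralZl//=.
    over.
  have EY : \int[P]_w (Y w)%:E \is a fin_num by exact: integrable_fin_num.
  by rewrite -[X in _ = _ * X]fineK// -integralZr//=; apply: eq_integral => w _; rewrite fineK.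
- by apply/measurable_EFinP; exact: measurable_funM.
- exact: integrableM_indep.
Qed.
End ExpectationProduct2.

(** * Independence of disjoint groups of events *)

Section Grouping.
Local Open Scope ereal_scope.
Context (R : realType) d (Om : measurableType d) (P : probability Om R).
Variables (I : finType) (G : I -> set (set Om)).
Hypotheses (GT : forall i, G i setT) (GI : forall i, setI_closed (G i))
  (Gm : forall i, G i `<=` measurable).
Hypothesis Gindep : forall A : I -> set Om, (forall i, G i (A i)) ->
  P (\bigcap_i A i) = \prod_i P (A i).

(** Rectangles: one event per index, trivial outside [J]. Unlike the union of the families [G i],
    they are stable under intersection, and they generate the same sigma-algebra. *)
Definition gen_events (J : pred I) : set (set Om) :=
  [set E | exists2 A : I -> set Om,
     (forall i, G i (A i)) /\ (forall i, ~~ J i -> A i = setT) &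
     E = \bigcap_i A i].

Lemma gen_events_setI J : setI_closed (gen_events J).
Proof.
move=> _ _ [A [GA AT] ->] [B [GB BT] ->]; exists (fun i => A i `&` B i).
  split => [i|i Ji]; first exact: GI.
  by rewrite AT// BT// setIT.
by rewrite -bigcapI.
Qed.

Lemma gen_events_sub (J : pred I) i : J i -> G i `<=` gen_events J.
Proof.
move=> Ji A GA; exists (fun j => if j == i then A else setT).
  split => [j|j]; first by case: eqP => [->|].
  by case: eqP => [->|//]; rewrite Ji.
apply/seteqP; split => [w Aw j _ /=|w /(_ i Logic.I)]; first by case: eqP.
by rewrite eqxx.
Qed.

Lemma gen_eventsT J : gen_events J setT.
Proof.
exists (fun=> setT); first by split.
by apply/seteqP; split.
Qed.

Lemma gen_events_measurable J : gen_events J `<=` measurable.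
Proof.
move=> _ [A [GA _] ->]; apply: fin_bigcap_measurable => // i _.
exact: Gm (GA i).
Qed.

Lemma gen_events_indep (J K : pred I) A B : (forall i, ~~ (J i && K i)) ->
  gen_events J A -> gen_events K B -> P (A `&` B) = P A * P B.
Proof.
move=> JK [A' [GA AT] ->] [B' [GB BT] ->].
rewrite -bigcapI !Gindep//; last by move=> i; exact: GI.
rewrite -big_split/=; apply: eq_bigr => i _.
have := JK i; rewrite negb_and => /orP[Ji|Ki].
  by rewrite AT// setTI probability_setT mul1e.
by rewrite BT// setIT probability_setT mule1.
Qed.

Lemma sigma_events_measurable J : <<s gen_events J >> `<=` measurable.
Proof.
by apply: smallest_sub; [exact: sigma_algebra_measurable|exact: gen_events_measurable].
Qed.

(** A pi-lambda argument: P (A [&] B) and P A * P B are finite measures in A that agree on the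
    rectangles. Applied once in each argument, it passes from rectangles to the two generated
    sigma-algebras. *)
Let extend (J : pred I) (B : set Om) : measurable B ->
  (forall A, gen_events J A -> P (A `&` B) = P A * P B) ->
  forall A, <<s gen_events J >> A -> P (A `&` B) = P A * P B.
Proof.
move=> mB h A sA.
pose m1 : {measure set Om -> \bar R} := mrestr P mB.
pose r : {nonneg R} := NngNum (fine_ge0 (measure_ge0 P B)).
pose m2 : {measure set Om -> \bar R} := mscale r P.
have rE : r%:num%:E = P B by rewrite /r /= fineK// fin_num_measure.
rewrite muleC -rE -[LHS]/(m1 A) -[RHS]/(m2 A).
have cover : \bigcup_(k : nat) [set: Om] = [set: Om].
  by apply/seteqP; split => // w _; exists 0%N.
apply: (g_sigma_algebra_measure_unique _ (@gen_events_measurable J)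
  (fun=> setT) (fun=> gen_eventsT J) cover m1 m2) sA.
- exact: gen_events_setI.
- by move=> C JC; rewrite /m1 /m2 /mrestr /mscale /= /mrestr /mscale rE h// muleC.
- move=> _; rewrite /m1 /= /mrestr setTI.
  by rewrite (le_lt_trans (probability_le1 P mB))// ltry.
Qed.

Lemma sigma_events_indep (J K : pred I) A B : (forall i, ~~ (J i && K i)) ->
  <<s gen_events J >> A -> <<s gen_events K >> B -> P (A `&` B) = P A * P B.
Proof.
move=> JK sA sB; have mA := sigma_events_measurable sA.
apply: extend sA; first exact: sigma_events_measurable sB.
move=> C JC; rewrite setIC muleC; apply: extend sB.
  exact: gen_events_measurable JC.
by move=> E KE; rewrite setIC muleC; exact: gen_events_indep JK _ _.
Qed.

(** [Om] again, with only the events determined by the group [J]. Measurability of a map out of this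
    space says that the map depends on that group alone, as adaptedness does for a filtration. *)
Definition subspace_events (J : pred I) := g_sigma_algebraType (gen_events J).

Lemma measurable_subspace_gen (J : pred I) i d' (T : measurableType d') (X : Om -> T) :
  J i -> (forall B, measurable B -> G i (X @^-1` B)) ->
  measurable_fun setT (X : subspace_events J -> T).
Proof.
move=> Ji GX _ B mB; rewrite setTI.
by apply: sub_sigma_algebra; apply: (gen_events_sub Ji); exact: GX.
Qed.

Lemma measurable_subspace (J : pred I) d' (T : measurableType d') (X : Om -> T) :
  measurable_fun setT (X : subspace_events J -> T) -> measurable_fun setT X.
Proof.
by move=> mX _ B mB; apply: (@sigma_events_measurable J); exact: mX.
Qed.

Lemma indep_rv_subspace (J K : pred I) d1 (T1 : measurableType d1)
    d2 (T2 : measurableType d2) (X : Om -> T1) (Y : Om -> T2) :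
  (forall i, ~~ (J i && K i)) ->
  measurable_fun setT (X : subspace_events J -> T1) ->
  measurable_fun setT (Y : subspace_events K -> T2) -> indep_rv P X Y.
Proof.
move=> JK mX mY A B mA mB; apply: (sigma_events_indep JK).
  by rewrite -[_ @^-1` _]setTI; exact: mX.
by rewrite -[_ @^-1` _]setTI; exact: mY.
Qed.

Lemma gen_events_mono (J K : pred I) : (forall i, J i -> K i) ->
  gen_events J `<=` gen_events K.
Proof.
move=> JK _ [A [GA AT] ->]; exists A => //; split => // i Ki.
by apply: AT; apply: contraNN Ki; exact: JK.
Qed.

Lemma measurable_subspace_mono (J K : pred I) d' (T : measurableType d') (X : Om -> T) :
  (forall i, J i -> K i) ->
  measurable_fun setT (X : subspace_events J -> T) ->
  measurable_fun setT (X : subspace_events K -> T).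
Proof.
move=> JK mX _ B mB; rewrite setTI.
apply: (sub_sigma_algebra2 (gen_events_mono JK)).
by rewrite -[_ @^-1` _]setTI; exact: mX.
Qed.

(** By induction on [r]: the intersection over the tail lies in the sigma-algebra of the union [U]
    of its groups, which is disjoint from the group of the head. *)
Lemma sigma_events_prod (K : eqType) (r : seq K) (J : K -> pred I) (E : K -> set Om) :
  uniq r -> (forall i j l, i != j -> ~~ (J i l && J j l)) ->
  (forall i, <<s gen_events (J i) >> (E i)) ->
  P (\big[setI/setT]_(i <- r) E i) = \prod_(i <- r) P (E i).
Proof.
move=> ur Jd EJ; pose U r l := has (fun i => J i l) r.
have mU : forall r, <<s gen_events (U r) >> (\big[setI/setT]_(i <- r) E i).
  elim=> [|i s IH].
    by rewrite big_nil; exact: (@measurableT _ (subspace_events (U [::]))).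
  rewrite big_cons; apply: (@measurableI _ (subspace_events (U (i :: s)))).
    by apply: sub_sigma_algebra2 (EJ i); apply: gen_events_mono => l Jl; rewrite /U /= Jl.
  by apply: sub_sigma_algebra2 IH; apply: gen_events_mono => l Ul; rewrite /U /= [has _ s]Ul orbT.
elim: r ur => [|i s IH] /=; first by rewrite !big_nil probability_setT.
move=> /andP[i_s us]; rewrite !big_cons -IH//.
apply: (sigma_events_indep (J := J i) (K := U s)) => //.
move=> l; apply/negP => /andP[Jil /hasP[j js Jjl]].
have ij : i != j by apply: contraNneq i_s => ->.
by have := Jd i j l ij; rewrite Jil Jjl.
Qed.

End Grouping.


(** * Integrals of real functions, laws and finite random choices *)

Lemma integral_probability1 (R : realType) d (Om : measurableType d)
  (P : probability Om R) : (\int[P]_w (1 : R)%:E = 1)%E.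
Proof. by rewrite (integral_cst P measurableT 1) mul1e; exact: probability_setT. Qed.

Lemma integral_cst_probability (R : realType) d (Om : measurableType d)
  (P : probability Om R) (c : R) : (\int[P]_w c%:E = c%:E)%E.
Proof.
rewrite (integral_cst P measurableT c%:E).
by rewrite -[RHS]mule1; congr (_ * _)%E; exact: probability_setT.
Qed.

Section IntegralSum.
Context (R : realType) d (T : measurableType d) (mu : {measure set T -> \bar R}).

Lemma integrable_sumr (I : Type) (r : seq I) (F : I -> T -> R) :
  (forall i, mu.-integrable setT (EFin \o F i)) ->
  mu.-integrable setT (EFin \o (fun x => \sum_(i <- r) F i x)).
Proof.
move=> iF; rewrite (_ : _ \o _ = fun x => (\sum_(i <- r) (F i x)%:E)%E).
  by apply: integrable_sum => // i _; exact: iF.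
by apply/funext => x /=; rewrite sumEFin.
Qed.

Lemma integral_sumr (I : Type) (r : seq I) (F : I -> T -> R) :
  (forall i, mu.-integrable setT (EFin \o F i)) ->
  (\int[mu]_x (\sum_(i <- r) F i x)%:E = \sum_(i <- r) \int[mu]_x (F i x)%:E)%E.
Proof.
move=> iF; under eq_integral do rewrite -sumEFin.
by rewrite integral_sum// => i _; exact: iF.
Qed.

Lemma ge0_integral_sumr (I : Type) (r : seq I) (F : I -> T -> R) :
  (forall i, measurable_fun setT (F i)) -> (forall i x, 0 <= F i x) ->
  (\int[mu]_x (\sum_(i <- r) F i x)%:E = \sum_(i <- r) \int[mu]_x (F i x)%:E)%E.
Proof.
move=> mF F0; under eq_integral do rewrite -sumEFin.
rewrite ge0_integral_sum//.
  by move=> i; exact/measurable_EFinP.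
by move=> i x _; rewrite lee_fin.
Qed.

Lemma integrableZ (k : R) (f : T -> R) : mu.-integrable setT (EFin \o f) ->
  mu.-integrable setT (EFin \o (fun x => k * f x)).
Proof.
move=> i; rewrite (_ : _ \o _ = fun x => (k%:E * (EFin \o f) x)%E).
  exact: integrableZl.
by apply/funext => x.
Qed.

Lemma integralZ (k : R) (f : T -> R) : mu.-integrable setT (EFin \o f) ->
  (\int[mu]_x (k * f x)%:E = k%:E * \int[mu]_x (f x)%:E)%E.
Proof.
by move=> i; under eq_integral do rewrite EFinM; exact: integralZl.
Qed.

Lemma ge0_integralZ (k : R) (f : T -> R) : measurable_fun setT f ->
  0 <= k -> (forall x, 0 <= f x) ->
  (\int[mu]_x (k * f x)%:E = k%:E * \int[mu]_x (f x)%:E)%E.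
Proof.
move=> mf k0 f0; under eq_integral do rewrite EFinM.
rewrite ge0_integralZl//; first exact/measurable_EFinP.
by move=> x _; rewrite lee_fin.
Qed.

Lemma ge0_integralDr (f g : T -> R) : measurable_fun setT f ->
  measurable_fun setT g -> (forall x, 0 <= f x) -> (forall x, 0 <= g x) ->
  (\int[mu]_x (f x + g x)%:E = \int[mu]_x (f x)%:E + \int[mu]_x (g x)%:E)%E.
Proof.
move=> mf mg f0 g0; under eq_integral do rewrite EFinD.
rewrite ge0_integralD//; try exact/measurable_EFinP.
all: by move=> x _; rewrite lee_fin.
Qed.

Lemma ge0_le_integralr (f g : T -> R) : measurable_fun setT f ->
  measurable_fun setT g -> (forall x, 0 <= f x) -> (forall x, f x <= g x) ->
  (\int[mu]_x (f x)%:E <= \int[mu]_x (g x)%:E)%E.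
Proof.
move=> mf mg f0 fg; apply: ge0_le_integral => //.
- by move=> x _; rewrite lee_fin.
- exact/measurable_EFinP.
- exact/measurable_EFinP.
- by move=> x _; rewrite lee_fin.
Qed.

Lemma ge0_integrable (f : T -> R) : measurable_fun setT f ->
  (forall x, 0 <= f x) -> (\int[mu]_x (f x)%:E < +oo)%E ->
  mu.-integrable setT (EFin \o f).
Proof.
move=> mf f0 foo; apply/integrableP; split; first exact/measurable_EFinP.
by under eq_integral => x _ do rewrite /= ger0_norm//.
Qed.

Lemma integrableDr (f g : T -> R) : mu.-integrable setT (EFin \o f) ->
  mu.-integrable setT (EFin \o g) ->
  mu.-integrable setT (EFin \o (fun x => f x + g x)).
Proof. by move=> mf mg; exact: (integrableD measurableT mf mg). Qed.

Lemma integrableBr (f g : T -> R) : mu.-integrable setT (EFin \o f) ->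
  mu.-integrable setT (EFin \o g) ->
  mu.-integrable setT (EFin \o (fun x => f x - g x)).
Proof. by move=> mf mg; exact: (integrableB measurableT mf mg). Qed.

Lemma integralDr (f g : T -> R) : mu.-integrable setT (EFin \o f) ->
  mu.-integrable setT (EFin \o g) ->
  (\int[mu]_x (f x + g x)%:E = \int[mu]_x (f x)%:E + \int[mu]_x (g x)%:E)%E.
Proof. by move=> mf mg; exact: (integralD measurableT mf mg). Qed.

Lemma integralBr (f g : T -> R) : mu.-integrable setT (EFin \o f) ->
  mu.-integrable setT (EFin \o g) ->
  (\int[mu]_x (f x - g x)%:E = \int[mu]_x (f x)%:E - \int[mu]_x (g x)%:E)%E.
Proof. by move=> mf mg; exact: (integralB measurableT mf mg). Qed.

Lemma markov_ge0 (f : T -> R) (t C : R) : measurable_fun setT f ->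
  (forall x, 0 <= f x) -> 0 < t -> (\int[mu]_x (f x)%:E <= C%:E)%E ->
  (mu [set x | (t < f x)%R] <= (C / t)%:E)%E.
Proof.
move=> mf f0 t0 fC; set B := [set x | _].
have mB : measurable B.
  have mt : measurable_fun setT (fun x => t < f x).
    by apply: measurable_fun_ltr => //; exact: measurable_cst.
  by have := mt measurableT [set true] I; rewrite setTI.
have mE : measurable_fun setT (EFin \o f) by exact/measurable_EFinP.
have : (t%:E * mu B <= C%:E)%E.
  apply: le_trans fC; rewrite -(integral_cst mu mB t%:E).
  apply: le_trans (_ : \int[mu]_(x in B) (f x)%:E <= _)%E.
    apply: ge0_le_integral => //.
    - by move=> x _; rewrite lee_fin ltW.
    - exact: measurable_funS mE.
    - by move=> x Bx; rewrite lee_fin ltW.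
  by apply: ge0_subset_integral => // x _; rewrite lee_fin.
move=> h; have := lee_wpmul2l (_ : 0 <= (t^-1)%:E)%E h.
rewrite muleA -!EFinM mulVf ?gt_eqF// mul1e mulrC; apply.
by rewrite lee_fin invr_ge0 ltW.
Qed.

Lemma ae_integral_ge0 (f : T -> R) : measurable_fun setT f ->
  {ae mu, forall x, 0 <= f x} -> (0 <= \int[mu]_x (f x)%:E)%E.
Proof.
move=> mf f0; rewrite integralE.
have mE : measurable_fun setT (EFin \o f) by exact/measurable_EFinP.
suff -> : (\int[mu]_x (EFin \o f)^\- x = 0)%E by rewrite sube0 integral_ge0.
rewrite (ae_eq_integral (cst 0%E)) ?integral0//.
  exact: measurable_funeneg.
apply: filterS f0 => x fx _.
by rewrite funenegE -EFinN -EFin_max max_r// oppr_le0.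
Qed.

End IntegralSum.

Lemma ae_integral_le (R : realType) d (T : measurableType d) (P : probability T R)
    (f : T -> R) (K : R) : P.-integrable setT (EFin \o f) ->
  {ae P, forall x, f x <= K} -> (\int[P]_x (f x)%:E <= K%:E)%E.
Proof.
move=> jf fK.
have ic : P.-integrable setT (EFin \o (fun=> K)).
  exact: finite_measure_integrable_cst.
have : (0 <= \int[P]_x (K - f x)%:E)%E.
  apply: ae_integral_ge0.
    by apply/measurable_EFinP; apply: measurable_int (integrableBr ic jf).
  by apply: filterS fK => x; rewrite subr_ge0.
rewrite integralBr// integral_cst_probability.
by rewrite sube_ge0// integrable_fin_num// orbT.
Qed.

Section Law.
Local Open Scope ereal_scope.
Context (R : realType) d (Om : measurableType d) (P : probability Om R).
Context d1 (T1 : measurableType d1) (nu : {measure set T1 -> \bar R}).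
Variable X : Om -> T1.
Hypothesis mX : measurable_fun setT X.
Hypothesis law : forall B, measurable B -> P (X @^-1` B) = nu B.

Let mfX : {mfun Om >-> T1} := HB.pack X (isMeasurableFun.Build _ _ _ _ X mX).

Lemma ge0_integral_law (f : T1 -> \bar R) : measurable_fun setT f ->
  (forall x, 0 <= f x) -> \int[P]_w f (X w) = \int[nu]_x f x.
Proof.
move=> mf f0; transitivity (\int[distribution P mfX]_x f x).
  by rewrite ge0_integral_distribution.
by apply: eq_measure_integral => B mB _; exact: law.
Qed.

Lemma integral_law (f : T1 -> \bar R) : measurable_fun setT f ->
  \int[P]_w f (X w) = \int[nu]_x f x.
Proof.
move=> mf; rewrite [LHS]integralE [RHS]integralE; congr (_ - _).
  rewrite -ge0_integral_law//; last exact: measurable_funepos.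
  by apply: eq_integral => w _; rewrite !funeposE.
rewrite -ge0_integral_law//; last exact: measurable_funeneg.
by apply: eq_integral => w _; rewrite !funenegE.
Qed.

Lemma integrable_law (f : T1 -> \bar R) :
  nu.-integrable setT f -> P.-integrable setT (fun w => f (X w)).
Proof.
move=> /integrableP[mf foo]; apply/integrableP; split.
  exact: measurableT_comp.
rewrite (ge0_integral_law (f := abse \o f))//; first exact: measurableT_comp.
by move=> x; exact: abse_ge0.
Qed.

End Law.

Section FiniteChoice.
Context (R : realType) (I : finType).

Lemma measurable_finite_choice d (T : measurableType d) d' (T' : measurableType d')
    (c : T -> I) (h : I -> T -> T') :
  (forall i, measurable (c @^-1` [set i])) -> (forall i, measurable_fun setT (h i)) ->
  measurable_fun setT (fun w => h (c w) w).
Proof.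
move=> mc mh _ B mB; rewrite setTI.
rewrite (_ : _ @^-1` B = \bigcup_(i in [set: I]) (c @^-1` [set i] `&` h i @^-1` B)).
  apply: fin_bigcup_measurable => // i _; apply: measurableI => //.
  by rewrite -[_ @^-1` _]setTI; exact: mh.
apply/seteqP; split => [w Bw|w [i _ [/= <-]]//]; by exists (c w).
Qed.

Context d (Om : measurableType d) (P : probability Om R).

(** Split along the values of [c]. Each indicator has only to be independent of its own [h i].
    Applied to the random block of a step and to the random output index. *)
Lemma integral_finite_choice (c : Om -> I) (p : R) (h : I -> Om -> R) :
  (forall i, P (c @^-1` [set i]) = p%:E) -> (forall i, measurable (c @^-1` [set i])) ->
  (forall i, measurable_fun setT (h i)) -> (forall i w, 0 <= h i w) ->
  (forall i, indep_rv P (fun w => (c w == i)%:R : R) (h i)) ->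
  (\int[P]_w (h (c w) w)%:E = \sum_i p%:E * \int[P]_w (h i w)%:E)%E.
Proof.
move=> cp mc mh h0 ind.
have E w : h (c w) w = \sum_i (c w == i)%:R * h i w.
  rewrite (bigD1 (c w))//= eqxx mul1r big1 ?addr0// => i /negbTE.
  by rewrite eq_sym => ->; rewrite mul0r.
have iE i w : (c w == i)%:R = \1_(c @^-1` [set i]) w :> R.
  rewrite indicE; congr (nat_of_bool _)%:R.
  by apply/eqP/idP => [ci|]; [apply/mem_set|move/set_mem].
have mI i : measurable_fun setT (fun w => (c w == i)%:R : R).
  by under eq_fun do rewrite iE; exact: measurable_indic.
under eq_integral do rewrite E.
rewrite ge0_integral_sumr; last 2 first.
- by move=> i; exact: measurable_funM.
- by move=> i w; rewrite mulr_ge0.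
apply: eq_bigr => i _; rewrite ge0_integralM_indep//; congr (_ * _)%E.
rewrite -(cp i) -(setIT (c @^-1` _)) -integral_indic//.
by apply: eq_integral => w _; rewrite iE.
Qed.

End FiniteChoice.

(** * Gaussian moments *)

Section Density.
Local Open Scope ereal_scope.
Context d (T : measurableType d) (R : realType).
Variables (mu nu : {measure set T -> \bar R}) (g : T -> R).
Hypotheses (mg : measurable_fun setT g) (g0 : forall x, (0 <= g x)%R).
Hypothesis nuE : forall A, measurable A -> nu A = \int[mu]_(x in A) (g x)%:E.

Import HBNNSimple.

(** The density is known on sets; simple functions and monotone convergence extend it to nonnegative
    integrands. *)
Lemma ge0_integral_density (f : T -> \bar R) : measurable_fun setT f ->
  (forall x, 0 <= f x) -> \int[nu]_x f x = \int[mu]_x (f x * (g x)%:E).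
Proof.
move=> mf f0; pose h := nnsfun_approx measurableT mf.
have hn n : \int[nu]_x (h n x)%:E = \int[mu]_x ((h n x)%:E * (g x)%:E).
  have key r : (0 <= r)%R -> r%:E * nu (h n @^-1` [set r]) =
      \int[mu]_x ((r * \1_(h n @^-1` [set r]) x)%:E * (g x)%:E).
    move=> r0; rewrite nuE// integral_mkcond.
    rewrite (_ : \int[mu]_x _ =
        \int[mu]_x (\1_(h n @^-1` [set r]) x * g x)%:E); last first.
      apply: eq_integral => x _; rewrite /patch indicE.
      by case: ifPn; rewrite ?mul1r ?mul0r.
    rewrite -ge0_integralZl//.
    - by apply: eq_integral => x _; rewrite -!EFinM mulrA.
    - by apply/measurable_EFinP; exact: measurable_funM.
    - by move=> x _; rewrite lee_fin mulr_ge0.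
  rewrite integralT_nnsfun sintegralE.
  transitivity (\sum_(r \in range (h n))
      \int[mu]_x ((r * \1_(h n @^-1` [set r]) x)%:E * (g x)%:E)).
    by apply: eq_fsbigr => r /set_mem [x _ <-]; exact: key.
  rewrite -ge0_integral_fsum//.
  - apply: eq_integral => x _; rewrite [in RHS]fimfunE -fsumEFin//.
    rewrite ge0_mule_fsuml// => r; exact: nnfun_muleindic_ge0.
  - move=> r; apply/measurable_EFinP; apply: measurable_funM => //.
    by apply: measurable_funM.
  - by move=> r x _; rewrite mule_ge0 ?lee_fin//; exact: nnfun_muleindic_ge0.
have fE x : (EFin \o h n) x @[n --> \oo] --> f x.
  by apply: cvg_nnsfun_approx => // y _.
transitivity (limn (fun n => \int[nu]_x (h n x)%:E)).
  rewrite -monotone_convergence//.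
  - by apply: eq_integral => x _; apply/esym/cvg_lim => //; exact: fE.
  - by move=> n; apply/measurable_EFinP.
  - by move=> n x _; rewrite lee_fin.
  - by move=> x _ a b ab; rewrite lee_fin; exact/lefP/nd_nnsfun_approx.
under eq_fun do rewrite hn.
rewrite -monotone_convergence//.
- apply: eq_integral => x _; apply/cvg_lim => //.
  by apply: cvgeZr => //; exact: fE.
- by move=> n; apply/measurable_EFinP; exact: measurable_funM.
- by move=> n x _; rewrite mule_ge0 ?lee_fin.
- move=> x _ a b ab; rewrite lee_wpmul2r ?lee_fin//.
  exact/lefP/nd_nnsfun_approx.
Qed.
End Density.

Section GaussianMoments.
Context (R : realType).
Notation mu := (@lebesgue_measure R).
Let phi (x : R) : R := expR (- (x ^+ 2 / 2)).

Let phi_ge0 x : 0 <= phi x. Proof. exact: expR_ge0. Qed.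

Let dphi (x : R) : is_derive x (1 : R) phi (- x * phi x).
Proof.
apply: is_derive_eq.
have sc (u v : R) : u *: (v : R^o) = u * v by [].
rewrite /phi scaler0 scaler0 add0r !sc !mulr1 mulrC; congr (- _ * _).
by rewrite mulrDr !(mulrC 2^-1) -splitr.
Qed.

Let phi_cont : continuous phi.
Proof.
move=> x; apply/differentiable_continuous/derivable1_diffP.
by have [] := dphi x.
Qed.

Let phi_cvg : phi x @[x --> +oo] --> (0 : R).
Proof.
rewrite /phi; apply: (cvg_comp (fun x => x ^+ 2 / 2) (fun x => expR (- x))).
  apply: gt0_cvgMly; last exact: cvgr_expr2.
  by rewrite invr_gt0.
exact: cvgr_expR.
Qed.

Let tail x : 0 <= x ->
  (\int[mu]_(t in `[x, +oo[) (t * phi t)%:E = (phi x)%:E)%E.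
Proof.
move=> x0; rewrite (@ge0_continuous_FTC2y _ _ (fun t => - phi t) _ 0).
- by rewrite -EFinB sub0r opprK.
- by move=> t xt; rewrite mulr_ge0// (le_trans x0).
- apply: continuous_subspaceT => t; apply: cvgM; [exact: cvg_id|exact: phi_cont].
- by rewrite -oppr0; apply: cvgN.
- by move=> t _; apply: derivableN; have [] := dphi t.
- by apply: cvg_at_right_filter; apply: cvgN; exact: phi_cont.
- move=> t _; rewrite derive1E deriveN; last by have [] := dphi t.
  by have [_ ->] := dphi t; rewrite mulNr opprK.
Qed.

Let monomial k t : 0 <= t ->
  (\int[mu]_(x in `[0%R, t]) (x ^+ k)%:E = (t ^+ k.+1 / k.+1%:R)%:E)%E.
Proof.
rewrite le_eqVlt => /predU1P[<-|t0].
  by rewrite set_itv1 integral_set1 expr0n mul0r.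
have dF (x : R) : is_derive x (1 : R) (fun x : R => x ^+ k.+1 / k.+1%:R) (x ^+ k).
  have d1 : is_derive x (1 : R) (fun x : R => x ^+ k.+1) (k.+1%:R * x ^+ k).
    split; first exact: exprn_derivable.
    by rewrite exp_derive [_ *: 1]mulr1.
  apply: is_derive_eq.
  have sc (u v : R) : u *: (v : R^o) = u * v by [].
  rewrite ?scaler0 ?add0r ?addr0 !sc mulrA mulVf ?mul1r// pnatr_eq0//.
rewrite (@continuous_FTC2 _ _ (fun x => x ^+ k.+1 / k.+1%:R))//.
- by rewrite expr0n mul0r sube0.
- by apply: continuous_subspaceT => x; exact: exprn_continuous.
- have cF : continuous (fun x : R => x ^+ k.+1 / k.+1%:R).
    by move=> x; apply/differentiable_continuous/derivable1_diffP; have [] := dF x.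
  split; first by move=> x _; have [] := dF x.
  + by apply: cvg_at_right_filter; exact: cF.
  + by apply: cvg_at_left_filter; exact: cF.
- by move=> x _; rewrite derive1E; have [_ ->] := dF x.
Qed.

Let M k := (\int[mu]_(x in `[0%R, +oo[) (x ^+ k * phi x)%:E)%E.

Let mphi : measurable_fun setT phi.
Proof. exact: continuous_measurable_fun. Qed.

Let itv_indic (I : interval R) (h : R -> R) :
  (\int[mu]_(x in [set` I]) (h x)%:E = \int[mu]_x (h x * (x \in I)%:R)%:E)%E.
Proof.
rewrite integral_mkcond; apply: eq_integral => x _; rewrite /patch.
by rewrite mem_setE; case: ifPn => _; rewrite ?mulr1 ?mulr0.
Qed.

(** Integration by parts written with Tonelli: [phi x] is the integral of t phi(t) over t >= x, so
    [M k] is a double integral over 0 <= x <= t. Integrating x^k in x first produces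
    t^(k+1)/(k+1). *)
Let moment_rec k : (M k.+2 = k.+1%:R%:E * M k)%E.
Proof.
(* The conditions 0 <= x, 0 <= t and x <= t become factors of the integrand, so that Tonelli applies
   on the whole plane. *)
pose g (x : R) := x ^+ k * (x \in `[0, +oo[)%:R.
pose h (t : R) := t * phi t * (t \in `[0, +oo[)%:R.
pose c (z : R * R) : R := if z.1 <= z.2 then 1 else 0.
pose f z := (g z.1 * h z.2 * c z)%:E.
have g0 x : 0 <= g x.
  by rewrite /g in_itv/= andbT; case: (leP 0 x) => [x0|_]; rewrite ?mulr1 ?mulr0// exprn_ge0.
have h0 t : 0 <= h t.
  by rewrite /h in_itv/= andbT; case: (leP 0 t) => [x0|_]; rewrite ?mulr1 ?mulr0// mulr_ge0.
have c0 z : 0 <= c z by rewrite /c; case: ifP.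
have mb (b : R -> bool) : measurable_fun setT b ->
    measurable_fun setT (fun x => (b x)%:R : R).
  move=> mb; rewrite (_ : (fun x => _) = fun x => if b x then 1 else 0 : R).
    by apply: measurable_fun_ifT => //; exact: measurable_cst.
  by apply/funext => x; case: (b x).
have mi : measurable_fun setT (fun x : R => (x \in `[0, +oo[)%:R : R).
  apply: mb; under eq_fun do rewrite in_itv/= andbT.
  by apply: measurable_fun_ler => //; exact: measurable_cst.
have mg : measurable_fun setT g by apply: measurable_funM => //; exact: measurable_funX.
have mh : measurable_fun setT h by apply: measurable_funM => //; exact: measurable_funM.
have mc : measurable_fun setT c.
  apply: measurable_fun_ifT => //; try exact: measurable_cst.
  exact: measurable_fun_ler.
have f0 z : (0 <= f z)%E.
  by rewrite lee_fin; apply: mulr_ge0; [apply: mulr_ge0; [exact: g0|exact: h0]|exact: c0].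
have mf : measurable_fun setT f.
  apply/measurable_EFinP; apply: measurable_funM => //.
  by apply: measurable_funM; apply: measurableT_comp.
have := @fubini_tonelli _ _ _ _ R mu mu f mf f0.
rewrite (_ : (\int[mu]_x _)%E = M k); last first.
  rewrite /M itv_indic; apply: eq_integral => x _.
  have [x0|x0] := leP 0 x; last first.
    have gx : g x = 0 by rewrite /g in_itv/= andbT leNgt x0 mulr0.
    rewrite in_itv/= andbT leNgt x0 mulr0.
    by rewrite integral0_eq// => t _; rewrite /f /= gx !mul0r.
  rewrite in_itv/= andbT x0 mulr1 EFinM -tail// itv_indic -ge0_integralZl//.
  - apply: eq_integral => t _; rewrite /f -EFinM; congr EFin.
    rewrite /g /h /c /= !in_itv/= !andbT x0 mulr1 -!mulrA.
    have [xt|xt] := leP x t; last by rewrite !mulr0.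
    by rewrite (le_trans x0 xt) !mulr1.
  - apply/measurable_EFinP; apply: measurable_funM; first exact: measurable_funM.
    by apply: mb; under eq_fun do rewrite in_itv/= andbT; exact: measurable_fun_ler.
  - move=> t _; rewrite lee_fin in_itv/= andbT.
    by case: (leP x t) => [xt|_]; rewrite ?mulr0// mulr1 mulr_ge0// (le_trans x0).
  - by rewrite lee_fin exprn_ge0.
move=> ->.
have e1 : (\int[mu]_y \int[mu]_x f (x, y) = (k.+1%:R^-1)%:E * M k.+2)%E.
  rewrite /M itv_indic -ge0_integralZl//.
  2:{ apply/measurable_EFinP; apply: measurable_funM => //.
      by apply: measurable_funM => //; exact: measurable_funX. }
  2:{ move=> t _; rewrite lee_fin in_itv/= andbT.
      by case: (leP 0 t) => [xt|_]; rewrite ?mulr0// mulr1 mulr_ge0// exprn_ge0. }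
  apply: eq_integral => t _.
  have [t0|t0] := leP 0 t; last first.
    have ht : h t = 0 by rewrite /h in_itv/= andbT leNgt t0 mulr0.
    rewrite in_itv/= andbT leNgt t0 !mulr0 mule0.
    by rewrite integral0_eq// => x _; rewrite /f /= ht mulr0 mul0r.
  rewrite in_itv/= andbT t0 mulr1.
  rewrite (_ : _ * _ = (t * phi t)%:E * (t ^+ k.+1 / k.+1%:R)%:E)%E; last first.
    by rewrite -!EFinM; congr EFin; rewrite !exprS; ring.
  rewrite -monomial// itv_indic -ge0_integralZl//.
  - apply: eq_integral => x _; rewrite /f -EFinM; congr EFin.
    rewrite /g /h /c /= !in_itv/= !andbT t0 mulr1.
    by case: (leP 0 x) => x0; case: (leP x t) => xt; rewrite /=; ring.
  - apply/measurable_EFinP; apply: measurable_funM; first exact: measurable_funX.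
    apply: mb; under eq_fun do rewrite in_itv/=.
    by apply: measurable_and; apply: measurable_fun_ler => //; exact: measurable_cst.
  - move=> x _; rewrite lee_fin in_itv/=.
    by case: (leP 0 x) => [x0|_]; rewrite ?mulr0// mulr_ge0// exprn_ge0.
  - by rewrite lee_fin mulr_ge0.
rewrite e1.
by rewrite muleA -EFinM divff ?pnatr_eq0// mul1e.
Qed.


Local Notation N01 := (normal_prob (0 : R) 1).

Let peak := @normal_peak R 1.

Let pdfE x : normal_pdf (0 : R) 1 x = peak * phi x.
Proof.
by rewrite /normal_pdf oner_eq0 /normal_fun subr0 expr1n mulNr.
Qed.

Let integral_N01 (f : R -> R) : measurable_fun setT f -> (forall x, 0 <= f x) ->
  (\int[N01]_x (f x)%:E = peak%:E * \int[mu]_x (f x * phi x)%:E)%E.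
Proof.
move=> mf f0.
rewrite (@ge0_integral_density _ _ _ mu N01 (normal_pdf 0 1))//.
- rewrite -ge0_integralZl//.
  + by apply: eq_integral => x _; rewrite -!EFinM pdfE mulrCA.
  + by apply/measurable_EFinP; exact: measurable_funM.
  + by move=> x _; rewrite lee_fin mulr_ge0.
  + by rewrite lee_fin normal_peak_ge0.
- exact: measurable_normal_pdf.
- exact: normal_pdf_ge0.
- exact/measurable_EFinP.
Qed.

Let even_moment k : ~~ odd k ->
  (\int[N01]_x (x ^+ k)%:E = peak%:E * (2%:E * M k))%E.
Proof.
move=> k2; rewrite integral_N01//.
2: by move=> x; exact: exprn_even_ge0.
congr (_ * _)%E; rewrite ge0_symfun_integralT.
- by rewrite /M set_itvcy.
- by move=> x; rewrite mulr_ge0// exprn_even_ge0.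
- by move=> x; apply: cvgM; [exact: exprn_continuous|exact: phi_cont].
- by move=> x /=; rewrite /phi sqrrN exprNn -signr_odd (negbTE k2) expr0 mul1r.
Qed.

(** Neither [peak] nor the Gaussian integral is evaluated: the total mass 1 of the normal law fixes
    their product, and the recursion gives the higher even moments. *)
Let normalization : (peak%:E * (2%:E * M 0) = 1)%E.
Proof.
rewrite -even_moment//.
under eq_integral do rewrite expr0.
rewrite (integral_cst N01 measurableT 1).
by rewrite mul1e; exact: probability_setT.
Qed.

Lemma gauss_moment2 : (\int[N01]_x (x ^+ 2)%:E = 1)%E.
Proof. by rewrite even_moment// moment_rec mul1e normalization. Qed.

Lemma gauss_moment4 : (\int[N01]_x (x ^+ 4)%:E = 3%:E)%E.
Proof.
rewrite even_moment// !moment_rec mul1e (muleCA 2%:E) (muleCA peak%:E).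
by rewrite normalization mule1.
Qed.

Lemma gauss_moment6 : (\int[N01]_x (x ^+ 6)%:E = 15%:E)%E.
Proof.
rewrite even_moment// !moment_rec mul1e (muleA 5%:E) (muleCA 2%:E).
by rewrite (muleCA peak%:E) normalization mule1 -EFinM -natrM.
Qed.

(** Positive and negative parts have equal integrals by the symmetry of Lebesgue measure and of the
    density. Their difference is 0 because they are finite, the positive part being at most 1 +
    x^2. *)
Lemma gauss_moment1 : (\int[N01]_x x%:E = 0)%E.
Proof.
pose p x : R := Num.max x 0.
have p0 x : 0 <= p x by rewrite le_max lexx orbT.
have mp : measurable_fun setT p.
  by apply: measurable_funrpos.
have refl (f : R -> R) : measurable_fun setT f -> (forall x, 0 <= f x) ->
    (\int[mu]_x (f (- x))%:E = \int[mu]_x (f x)%:E)%E.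
  move=> mf f0.
  transitivity (\int[pushforward mu (-%R : _ -> measurableTypeR R)]_x (f x)%:E)%E.
    rewrite ge0_integral_pushforward//; first exact/measurable_EFinP.
    by move=> y _; rewrite lee_fin.
  by apply: eq_measure_integral => //= A mA _; exact: lebesgue_measureN.
rewrite integralE.
have -> : (\int[N01]_x (EFin : R -> _)^\- x = \int[N01]_x (EFin : R -> _)^\+ x)%E.
  transitivity (\int[N01]_x (p (- x))%:E)%E.
    by apply: eq_integral => x _; rewrite funenegE EFin_max.
  transitivity (\int[N01]_x (p x)%:E)%E; last first.
    by apply: eq_integral => x _; rewrite funeposE EFin_max.
  rewrite !integral_N01//.
  2: by apply: measurableT_comp.
  congr (_ * _)%E.
  rewrite -[RHS]refl.
  - by apply: eq_integral => x _; rewrite /phi sqrrN.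
  - exact: measurable_funM.
  - by move=> x; rewrite mulr_ge0.
rewrite subee// (_ : \int[N01]_x _ = \int[N01]_x (p x)%:E)%E; last first.
  by apply: eq_integral => x _; rewrite funeposE EFin_max.
have i2 : (\int[N01]_x (1 + x ^+ 2)%:E < +oo)%E.
  under eq_integral do rewrite EFinD.
  rewrite ge0_integralD//.
  - by rewrite gauss_moment2 integral_probability1 -EFinD ltry.
  - by move=> x _; rewrite lee_fin sqr_ge0.
  - by apply/measurable_EFinP; exact: measurable_funX.
rewrite ge0_fin_numE; last by apply: integral_ge0 => x _; rewrite lee_fin.
apply: le_lt_trans i2; apply: ge0_le_integral => //.
- by move=> x _; rewrite lee_fin.
- exact/measurable_EFinP.
- by apply/measurable_EFinP; apply: measurable_funD => //; exact: measurable_funX.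
- move=> x _; rewrite lee_fin /p ge_max; apply/andP; split.
    have := sqr_ge0 (x - 1); nra.
  by rewrite addr_ge0// sqr_ge0.
Qed.

End GaussianMoments.

(** * Standard Gaussian vectors *)

Section StdGaussian.
Context (R : realType) d (Om : measurableType d) (P : probability Om R) (n : nat).
Variable u : Om -> 'rV[R]_n.
Hypothesis mu : measurable_fun setT (u : Om -> borel_rV R n).
Hypothesis gu : std_gaussian P u.
Local Notation N01 := (normal_prob (0 : R) 1).

Let mui j : measurable_fun setT (fun w => u w 0 j).
Proof. exact: measurable_coord_comp. Qed.

Let G (j : 'I_n) := sigma_of (fun w => u w 0 j).

Let GT j : G j setT.
Proof. by exists setT => //; rewrite setTI preimage_setT. Qed.

Let GI j : setI_closed (G j).
Proof.
move=> _ _ [A mA <-] [B mB <-]; exists (A `&` B); first exact: measurableI.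
by rewrite !setTI preimage_setI.
Qed.

Let Gm j : G j `<=` measurable.
Proof. by move=> _ [B mB <-]; exact: mui. Qed.

Let N01T : N01 setT = 1%E. Proof. exact: probability_setT. Qed.

Let law j B : measurable B -> P ((fun w => u w 0 j) @^-1` B) = N01 B.
Proof.
move=> mB; pose A i := if i == j then B else setT.
have mA i : measurable (A i) by rewrite /A; case: ifP.
rewrite (_ : _ @^-1` _ = [set w | forall i, A i (u w 0 i)]); last first.
  apply/seteqP; split => w /=; last by move=> /(_ j); rewrite /A eqxx.
  by move=> Bw i; rewrite /A; case: eqP => // ->.
rewrite gu// (bigD1 j)//= /A eqxx big1 ?mule1// => i /negbTE ->.
exact: N01T.
Qed.

Let Gindep (A : 'I_n -> set Om) : (forall j, G j (A j)) ->
  P (\bigcap_j A j) = (\prod_j P (A j))%E.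
Proof.
move=> GA.
have /choice[B BP] : forall j, exists B, measurable B /\ A j = (fun w => u w 0 j) @^-1` B.
  by move=> j; have [B mB <-] := GA j; exists B; rewrite setTI.
rewrite (_ : \bigcap_j A j = [set w | forall j, B j (u w 0 j)]); last first.
  apply/seteqP; split => w.
    by move=> h j; have := h j Logic.I; rewrite (BP j).2.
  by move=> h j _; rewrite (BP j).2; exact: h.
rewrite gu; last by move=> j; exact: (BP j).1.
by apply: eq_bigr => j _; rewrite (BP j).2 law//; exact: (BP j).1.
Qed.

Lemma ge0_integral_gauss_coord (f : R -> R) j : measurable_fun setT f ->
  (forall x, 0 <= f x) ->
  (\int[P]_w (f (u w 0 j))%:E = \int[N01]_x (f x)%:E)%E.
Proof.
move=> mf f0; apply: (ge0_integral_law (nu := N01) (mui j) (law j) (f := EFin \o f)).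
  exact/measurable_EFinP.
by move=> x; rewrite lee_fin.
Qed.

Let pow_coord k j : ~~ odd k ->
  (\int[P]_w (u w 0 j ^+ k)%:E = \int[N01]_x (x ^+ k)%:E)%E.
Proof.
move=> k2; apply: (ge0_integral_gauss_coord (f := fun x => x ^+ k)).
  exact: measurable_funX.
by move=> x; exact: exprn_even_ge0.
Qed.

Let integrable_coord j : P.-integrable setT (EFin \o (fun w => u w 0 j)).
Proof.
have i2 : P.-integrable setT (EFin \o (fun w => 1 + u w 0 j ^+ 2)).
  apply: ge0_integrable.
  - by apply: measurable_funD => //; exact: measurable_funX.
  - by move=> w; rewrite addr_ge0// sqr_ge0.
  - rewrite ge0_integralDr//; last 2 first.
    + exact: measurable_funX.
    + by move=> w; rewrite sqr_ge0.
    by rewrite pow_coord// gauss_moment2 integral_probability1 -EFinD ltry.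
apply: le_integrable i2 => //; first exact/measurable_EFinP.
move=> w _ /=; rewrite lee_fin [leRHS]ger0_norm ?addr_ge0 ?sqr_ge0//.
by rewrite ler_norml; apply/andP; split;
  have := sqr_ge0 (u w 0 j - 1); have := sqr_ge0 (u w 0 j + 1); nra.
Qed.

Let mean_coord j : (\int[P]_w (u w 0 j)%:E = 0)%E.
Proof.
by rewrite (integral_law (nu := N01) (mui j) (law j) (f := EFin))// gauss_moment1.
Qed.

Local Notation sub := (subspace_events G).

Let m_sub (J : pred 'I_n) j : J j ->
  measurable_fun setT ((fun w => u w 0 j) : sub J -> R).
Proof.
by move=> Jj; apply: (measurable_subspace_gen GT Jj) => B mB; exists B; rewrite ?setTI.
Qed.

Let indep_coord i j : i != j -> indep_rv P (fun w => u w 0 i) (fun w => u w 0 j).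
Proof.
move=> ij; apply: (indep_rv_subspace GT GI Gm Gindep (J := pred1 i) (K := pred1 j)).
- by move=> k /=; case: eqP => // ->; rewrite (negbTE ij).
- by apply: m_sub => /=.
- by apply: m_sub => /=.
Qed.

Lemma integrable_gauss_coordM i j :
  P.-integrable setT (EFin \o (fun w => u w 0 i * u w 0 j)).
Proof.
have [<-|ij] := eqVneq i j; last first.
  exact: (integrableM_indep (indep_coord ij) (integrable_coord i) (integrable_coord j)).
under eq_fun do rewrite -expr2.
apply: ge0_integrable.
- exact: measurable_funX.
- by move=> w; rewrite sqr_ge0.
- by rewrite pow_coord// gauss_moment2 ltry.
Qed.

Lemma integral_gauss_coordM i j :
  (\int[P]_w (u w 0 i * u w 0 j)%:E = ((i == j)%:R)%:E)%E.
Proof.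
have [<-|ij] := eqVneq i j; last first.
  by rewrite (integralM_indep (indep_coord ij))// ?mean_coord ?mul0e.
by under eq_integral do rewrite -expr2; rewrite pow_coord// gauss_moment2.
Qed.

Lemma integral_gauss_dot2 (c : 'rV[R]_n) :
  (\int[P]_w (dot c (u w) ^+ 2)%:E = (dot c c)%:E)%E.
Proof.
have E w : dot c (u w) ^+ 2 =
    \sum_i \sum_j (c 0 i * c 0 j) * (u w 0 i * u w 0 j).
  rewrite expr2 {1}/dot mulr_suml; apply: eq_bigr => i _.
  by rewrite /dot mulr_sumr; apply: eq_bigr => j _; rewrite mulrACA.
under eq_integral do rewrite E.
have ii i j := integrableZ (c 0 i * c 0 j) (integrable_gauss_coordM i j).
rewrite integral_sumr => [|i]; last by apply: integrable_sumr => j.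
rewrite /dot -sumEFin; apply: eq_bigr => i _.
rewrite integral_sumr// (bigD1 i)//= big1 ?adde0.
  by rewrite integralZ ?integral_gauss_coordM ?eqxx ?mule1//; exact: integrable_gauss_coordM.
move=> j ji; rewrite integralZ; last exact: integrable_gauss_coordM.
by rewrite integral_gauss_coordM eq_sym (negbTE ji) mule0.
Qed.

Let off (c : 'rV[R]_n) k : 'rV[R]_n := \row_i (if i == k then 0 else c 0 i).

Let dot_off c k (x : 'rV[R]_n) : dot c x = c 0 k * x 0 k + dot (off c k) x.
Proof.
rewrite /dot (bigD1 k)//= [in RHS](bigD1 k)//= mxE eqxx mul0r add0r.
by congr (_ + _); apply: eq_bigr => i /negbTE ik; rewrite mxE ik.
Qed.

Let dot_off_off c k : dot (off c k) (off c k) = dot c c - c 0 k ^+ 2.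
Proof.
rewrite /dot (bigD1 k)//= [in RHS](bigD1 k)//= mxE eqxx mul0r add0r expr2.
rewrite addrAC subrr add0r.
by apply: eq_bigr => i /negbTE ik; rewrite mxE ik.
Qed.

(** Removing coordinate k leaves a form [dot (off c k) u] independent of u_k, so mixed fourth
    moments need no enumeration. From (s + r)^2 <= 2 s^2 + 2 r^2 come 2 * 3 * c_k^2 and 2 (|c|^2 -
    c_k^2). The sum over k is (2n + 4) |c|^2, twice the exact value. *)
Let coord_bound c k :
  (\int[P]_w (dot c (u w) ^+ 2 * u w 0 k ^+ 2)%:E
    <= (4 * c 0 k ^+ 2 + 2 * dot c c)%:E)%E.
Proof.
have mdot a : measurable_fun setT (fun w => dot a (u w)).
  by apply: measurable_dot => //; exact: measurable_cst.
have le w : dot c (u w) ^+ 2 * u w 0 k ^+ 2 <=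
    2 * c 0 k ^+ 2 * u w 0 k ^+ 4 + 2 * (dot (off c k) (u w) ^+ 2 * u w 0 k ^+ 2).
  rewrite (dot_off c k); have := sqr_ge0 (c 0 k * u w 0 k - dot (off c k) (u w)).
  set a := c 0 k; set b := u w 0 k; set r := dot _ _ => h.
  have := mulr_ge0 h (sqr_ge0 b); lra.
have m2 := measurable_funX 2 (mui k).
have ms := measurable_funX 2 (mdot (off c k)).
apply: le_trans (ge0_le_integralr P _ _ _ le) _.
- by apply: measurable_funM => //; exact: measurable_funX.
- by apply: measurable_funD; apply: measurable_funM => //;
    [exact: measurable_funX|exact: measurable_funM].
- by move=> w; rewrite mulr_ge0 ?sqr_ge0.
have ij : indep_rv P (fun w => dot (off c k) (u w) ^+ 2) (fun w => u w 0 k ^+ 2).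
  apply: (indep_rv_subspace GT GI Gm Gindep (J := predC1 k) (K := pred1 k)).
  - by move=> i /=; case: eqP.
  - apply: measurable_funX; apply: measurable_sum => i.
    have [->|ik] := eqVneq i k.
      by under eq_fun do rewrite mxE eqxx mul0r; exact: measurable_cst.
    by apply: measurable_funM; [exact: measurable_cst|exact: m_sub].
  - by apply: measurable_funX; apply: m_sub => /=.
have sq0 (f : Om -> R) w : 0 <= f w ^+ 2 by rewrite sqr_ge0.
rewrite ge0_integralDr.
- rewrite (ge0_integralZ P (measurable_funX 4 (mui k))).
  2: by rewrite mulr_ge0// sqr_ge0.
  2: by move=> w; exact: exprn_even_ge0.
  rewrite (ge0_integralZ P (measurable_funM ms m2))//.
  2: by move=> w; rewrite mulr_ge0// sqr_ge0.
  rewrite pow_coord// gauss_moment4 (ge0_integralM_indep ms m2 ij)//.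
  2: by move=> w; rewrite sqr_ge0.
  2: by move=> w; rewrite sqr_ge0.
  rewrite integral_gauss_dot2 pow_coord// gauss_moment2 mule1 dot_off_off.
  by rewrite -!EFinM -EFinD lee_fin; lra.
- by apply: measurable_funM => //; exact: measurable_funX.
- by apply: measurable_funM => //; exact: measurable_funM.
- move=> w; apply: mulr_ge0; last exact: exprn_even_ge0.
  by apply: mulr_ge0 => //; exact: sqr_ge0.
- by move=> w; rewrite mulr_ge0// mulr_ge0 ?sqr_ge0.
Qed.

Lemma integral_gauss_dot2_norm (c : 'rV[R]_n) :
  (\int[P]_w (dot c (u w) ^+ 2 * dot (u w) (u w))%:E
    <= ((2 * n%:R + 4) * dot c c)%:E)%E.
Proof.
have mdot : measurable_fun setT (fun w => dot c (u w)).
  by apply: measurable_dot => //; exact: measurable_cst.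
have E w : dot c (u w) ^+ 2 * dot (u w) (u w) =
    \sum_k dot c (u w) ^+ 2 * u w 0 k ^+ 2.
  by rewrite /dot mulr_sumr; apply: eq_bigr => k _; rewrite (expr2 (u w 0 k)).
under eq_integral do rewrite E.
rewrite ge0_integral_sumr.
- apply: le_trans (_ : (\sum_k (4 * c 0 k ^+ 2 + 2 * dot c c)%:E <= _)%E).
    by apply: lee_sum => k _; exact: coord_bound.
  rewrite sumEFin lee_fin big_split/= -mulr_sumr sumr_const card_ord.
  rewrite (_ : \sum_i c 0 i ^+ 2 = dot c c); last by apply: eq_bigr => i _; rewrite expr2.
  by rewrite -mulr_natl; lra.
- by move=> k; apply: measurable_funM; apply: measurable_funX.
- by move=> k w; rewrite mulr_ge0 ?sqr_ge0.
Qed.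

(** Expand the cube as a triple sum and apply the arithmetic-geometric inequality to each product.
    With a_i = u_i^2 it reduces the sixth moment of the norm to those of the coordinates, whence 15
    n^3. *)
Let cube_sum_le (a : 'I_n -> R) : (forall i, 0 <= a i) ->
  (\sum_i a i) ^+ 3 <= n%:R ^+ 2 * \sum_i a i ^+ 3.
Proof.
move=> a0.
have amgm x y z : 0 <= x -> 0 <= y -> 0 <= z ->
    x * y * z <= 3^-1 * (x ^+ 3 + y ^+ 3 + z ^+ 3) :> R.
  move=> x0 y0 z0.
  have h : 0 <= (x + y + z) * ((x - y) ^+ 2 + (y - z) ^+ 2 + (z - x) ^+ 2).
    by apply: mulr_ge0; rewrite ?addr_ge0// sqr_ge0.
  lra.
have -> : (\sum_i a i) ^+ 3 = \sum_i \sum_j \sum_k a i * a j * a k.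
  rewrite !exprS expr0 mulr1 mulr_suml; apply: eq_bigr => i _.
  rewrite mulr_suml mulr_sumr; apply: eq_bigr => j _.
  by rewrite mulrA mulr_sumr.
apply: le_trans (_ : \sum_i \sum_j \sum_k 3^-1 * (a i ^+ 3 + a j ^+ 3 + a k ^+ 3) <= _).
  by do 3 (apply: ler_sum => ? _); exact: amgm.
set c := \sum_i a i ^+ 3.
have e1 i j : \sum_k 3^-1 * (a i ^+ 3 + a j ^+ 3 + a k ^+ 3) =
    3^-1 * (n%:R * a i ^+ 3 + n%:R * a j ^+ 3 + c).
  by rewrite -mulr_sumr !big_split/= !sumr_const card_ord !mulr_natl.
under eq_bigr do under eq_bigr do rewrite e1.
have e2 i : \sum_j 3^-1 * (n%:R * a i ^+ 3 + n%:R * a j ^+ 3 + c) =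
    3^-1 * (n%:R ^+ 2 * a i ^+ 3 + 2 * n%:R * c).
  rewrite -mulr_sumr !big_split/= !sumr_const card_ord -mulr_sumr -/c.
  by rewrite -(mulr_natl (_ * _)) -(mulr_natl c); congr (_ * _); ring.
under eq_bigr do rewrite e2.
rewrite -mulr_sumr !big_split/= !sumr_const card_ord -mulr_sumr -/c -(mulr_natl (_ * c)).
lra.
Qed.

Lemma integral_gauss_norm6 :
  (\int[P]_w (dot (u w) (u w) ^+ 3)%:E <= (15 * n%:R ^+ 3)%:E)%E.
Proof.
have le w : dot (u w) (u w) ^+ 3 <= n%:R ^+ 2 * \sum_i u w 0 i ^+ 6.
  apply: le_trans (cube_sum_le _) _ => [i|]; first by rewrite -expr2 sqr_ge0.
  by rewrite ler_wpM2l ?sqr_ge0//; apply: ler_sum => i _; rewrite -expr2 -exprM.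
have m6 i := measurable_funX 6 (mui i).
have u6 i w : 0 <= u w 0 i ^+ 6 by exact: exprn_even_ge0.
apply: le_trans (ge0_le_integralr P _ _ _ le) _.
- by apply: measurable_funX; exact: measurable_dot.
- apply: measurable_funM; first exact: measurable_cst.
  by apply: measurable_sum => i; exact: m6.
- by move=> w; rewrite exprn_ge0// dot_ge0.
rewrite ge0_integralZ ?sqr_ge0//.
- rewrite ge0_integral_sumr//.
  under eq_bigr do rewrite pow_coord// gauss_moment6.
  by rewrite sumEFin sumr_const card_ord -EFinM lee_fin -[15 *+ n]mulr_natl; lra.
- by apply: measurable_sum => i; exact: m6.
- by move=> w; apply: sumr_ge0.
Qed.

End StdGaussian.

(** * Stochastic gradients *)

Section LipschitzGradient.
Context {R : realType} {n : nat}.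

Lemma gradN (g : 'rV[R]_n -> R) x : differentiable (g : 'rV[R]_n -> R^o) x ->
  grad (fun y => - g y) x = - grad g x.
Proof.
move=> dg; apply/rowP => j; rewrite !mxE.
by rewrite (diffN dg).
Qed.

Lemma taylor_abs (g : 'rV[R]_n -> R) (K : R) x h : differentiable_everywhere g ->
  (forall y z, enorm (grad g y - grad g z) <= K * enorm (y - z)) ->
  `|g (x + h) - g x - dot (grad g x) h| <= K / 2 * dot h h.
Proof.
move=> dg gK.
have bound t : 0 <= t <= 1 ->
    enorm (grad g (x + t *: h) - grad g x) * enorm h <= K * dot h h * t.
  move=> /andP[t0 _]; have := gK (x + t *: h) x.
  generalize (grad g (x + t *: h)) (grad g x) => u v.
  rewrite addrAC subrr add0r enormZ ger0_norm// -enorm_sqr expr2 => le1.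
  by have := ler_wpM2r (enorm_ge0 h) le1; lra.
have up := @taylor_upper _ _ g x h (K * dot h h) dg.
have dgN : differentiable_everywhere (fun y => - g y) by move=> y; exact: differentiableN.
have lo := @taylor_upper _ _ (fun y => - g y) x h (K * dot h h) dgN.
have {up}: g (x + h) <= g x + dot (grad g x) h + K * dot h h / 2.
  by apply: up => t t01; apply: le_trans (dot_le _ _) (bound _ t01).
have {lo}: - g (x + h) <= - g x + dot (- grad g x) h + K * dot h h / 2.
  rewrite -gradN//; apply: lo => t t01; rewrite !gradN//.
  by apply: le_trans (dot_le _ _) _; rewrite -opprD enormN; exact: bound.
rewrite dotNl; generalize (dot (grad g x) h) => c h1 h2.
by rewrite ler_norml; apply/andP; split; lra.
Qed.
End LipschitzGradient.

(** * Random vectors with a prescribed mean *)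

Section MeanVector.
Context (R : realType) (n : nat) d (Xi : measurableType d) (Q : probability Xi R).
Variables (g : Xi -> 'rV[R]_n) (gbar : 'rV[R]_n).
Hypothesis gE : forall j, Q.-integrable setT (fun xi => (g xi 0 j)%:E) /\
  (\int[Q]_xi (g xi 0 j)%:E = (gbar 0 j)%:E)%E.

Lemma measurable_mean_vector : measurable_fun setT (g : Xi -> borel_rV R n).
Proof.
apply/measurable_rV => j; apply/measurable_EFinP.
by have [/measurable_int] := gE j.
Qed.

Lemma integrable_dot_mean v : Q.-integrable setT (EFin \o (fun xi => dot (g xi) v)).
Proof.
apply: integrable_sumr => j; under eq_fun do rewrite mulrC.
by apply: integrableZ; have [] := gE j.
Qed.

Lemma integral_dot_mean v : (\int[Q]_xi (dot (g xi) v)%:E = (dot gbar v)%:E)%E.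
Proof.
have i1 j : Q.-integrable setT (EFin \o (fun xi => g xi 0 j * v 0 j)).
  by under eq_fun do rewrite mulrC; apply: integrableZ; have [] := gE j.
rewrite integral_sumr// -sumEFin; apply: eq_bigr => j _.
under eq_integral do rewrite mulrC.
have [ig gbarE] := gE j.
by rewrite integralZ// gbarE -EFinM mulrC.
Qed.

Lemma second_moment_mean (s2 : R) :
  (\int[Q]_xi (enorm (g xi - gbar) ^+ 2)%:E <= s2%:E)%E ->
  (\int[Q]_xi (dot (g xi) (g xi))%:E <= (dot gbar gbar + s2)%:E)%E.
Proof.
move=> hs; have mg := measurable_mean_vector.
pose D xi := dot (g xi - gbar) (g xi - gbar).
have mD : measurable_fun setT D.
  by apply: measurable_dot; apply: measurable_rVB => //; exact: measurable_cst.
have {}hs : (\int[Q]_xi (D xi)%:E <= s2%:E)%E.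
  by under eq_integral do rewrite /D -enorm_sqr.
have iD : Q.-integrable setT (EFin \o D).
  apply: ge0_integrable => //; first by move=> xi; exact: dot_ge0.
  exact: le_lt_trans hs (ltry _).
have E xi : dot (g xi) (g xi) = D xi + (2 * dot (g xi) gbar - dot gbar gbar).
  by rewrite /D dotBl !dotBr (dotC gbar); lra.
under eq_integral do rewrite E.
have i2 : Q.-integrable setT (EFin \o (fun xi => 2 * dot (g xi) gbar)).
  by apply: integrableZ; exact: integrable_dot_mean.
have ic : Q.-integrable setT (EFin \o (fun=> dot gbar gbar)).
  exact: finite_measure_integrable_cst.
rewrite (integralDr iD); last exact: integrableBr.
rewrite integralBr// integralZ; last exact: integrable_dot_mean.
rewrite integral_dot_mean integral_cst_probability -EFinM -EFinB.
apply: le_trans (leeD2r _ hs) _.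
by rewrite -EFinD lee_fin; lra.
Qed.
End MeanVector.

Section MeanGradient.
Context (R : realType) (n : nat) d (Xi : measurableType d) (Q : probability Xi R).
Variables (g : 'rV[R]_n -> Xi -> 'rV[R]_n) (gbar : 'rV[R]_n -> 'rV[R]_n).
Hypothesis gE : forall x j, Q.-integrable setT (fun xi => (g x xi 0 j)%:E) /\
  (\int[Q]_xi (g x xi 0 j)%:E = (gbar x 0 j)%:E)%E.

Lemma mean_dotB_le x y v (K : R) :
  {ae Q, forall xi, dot (g x xi - g y xi) v <= K} -> dot (gbar x - gbar y) v <= K.
Proof.
move=> aeK; rewrite -lee_fin dotBl EFinB -!(integral_dot_mean (gE _)).
have i1 z := integrable_dot_mean (gE z) v.
rewrite -integralBr//; apply: ae_integral_le; first exact: integrableBr.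
by apply: filterS aeK => xi; rewrite dotBl.
Qed.

(** Testing the difference of the means against itself leaves a scalar expectation, bounded almost
    surely by Cauchy-Schwarz. Its use is to make the gradient of f continuous, hence Borel. *)
Lemma mean_lipschitz (K : R) : 0 <= K ->
  {ae Q, forall xi, forall x y, enorm (g x xi - g y xi) <= K * enorm (x - y)} ->
  forall x y, enorm (gbar x - gbar y) <= K * enorm (x - y).
Proof.
move=> K0 aeK x y; set z := gbar x - gbar y.
have [->|z0] := eqVneq (enorm z) 0; first by rewrite mulr_ge0// enorm_ge0.
have {}z0 : 0 < enorm z by rewrite lt_neqAle eq_sym z0 enorm_ge0.
rewrite -(ler_pM2r z0) -expr2 enorm_sqr; apply: mean_dotB_le.
apply: filterS aeK => xi /(_ x y) le1.
by apply: le_trans (dot_le _ _) _; rewrite ler_pM2r.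
Qed.

End MeanGradient.

(** * Zeroth-order estimates *)

Section MeanOf.
Context (R : realType) (n : nat) d (Om : measurableType d) (P : probability Om R).

(* [fine] sends an infinite integral to 0 *)
Definition mean_rV (G : Om -> 'rV[R]_n) : 'rV[R]_n :=
  \row_j fine (\int[P]_w (G w 0 j)%:E)%E.

Variable G : Om -> 'rV[R]_n.
Hypothesis mG : measurable_fun setT (G : Om -> borel_rV R n).

Let m2 : measurable_fun setT (fun w => dot (G w) (G w)).
Proof. exact: measurable_dot. Qed.

Lemma mean_rVP (C : R) : (\int[P]_w (dot (G w) (G w))%:E <= C%:E)%E ->
  forall j, P.-integrable setT (fun w => (G w 0 j)%:E) /\
    (\int[P]_w (G w 0 j)%:E = (mean_rV G 0 j)%:E)%E.
Proof.
move=> GC j.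
have i2 : P.-integrable setT (EFin \o (fun w => 1 + dot (G w) (G w))).
  apply: integrableDr; first exact: finite_measure_integrable_cst.
  apply: ge0_integrable => //; first by move=> w; exact: dot_ge0.
  exact: le_lt_trans GC (ltry _).
have i1 : P.-integrable setT (fun w => (G w 0 j)%:E).
  apply: le_integrable i2 => //.
    by apply/measurable_EFinP; exact: measurable_coord_comp.
  move=> w _ /=; rewrite lee_fin [leRHS]ger0_norm ?addr_ge0 ?dot_ge0//.
  apply: le_trans (ler_norm_enorm _ _) _.
  by rewrite -enorm_sqr; have := sqr_ge0 (enorm (G w) - 1); have := enorm_ge0 (G w); nra.
by split => //; rewrite mxE fineK//; exact: integrable_fin_num.
Qed.

(** Centring removes the cross term with [c], and subtracting the mean can only lower the second
    moment of [G]. *)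
Lemma second_moment_shift (C : R) c :
  (\int[P]_w (dot (G w) (G w))%:E <= C%:E)%E ->
  (\int[P]_w (dot (c + G w - mean_rV G) (c + G w - mean_rV G))%:E
    <= (dot c c + C)%:E)%E.
Proof.
move=> GC; have mE := mean_rVP GC; set m := mean_rV G in mE *.
have i1 v : P.-integrable setT (EFin \o (fun w => dot (G w) v)).
  exact: integrable_dot_mean.
have iG : P.-integrable setT (EFin \o (fun w => dot (G w) (G w))).
  apply: ge0_integrable => //; first by move=> w; exact: dot_ge0.
  exact: le_lt_trans GC (ltry _).
have E w : dot (c + G w - m) (c + G w - m) =
    dot (G w) (G w) + (2 * dot (G w) (c - m) + dot (c - m) (c - m)).
  rewrite addrAC; move: (c - m) => e.
  by rewrite dotDl !dotDr (dotC e (G w)); lra.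
under eq_integral do rewrite E.
have ic : P.-integrable setT (EFin \o (fun=> dot (c - m) (c - m))).
  exact: finite_measure_integrable_cst.
have i2 := integrableZ 2 (i1 (c - m)).
rewrite (integralDr iG); last exact: integrableDr.
rewrite integralDr// integralZ// (integral_dot_mean mE) integral_cst_probability.
rewrite -EFinM -EFinD; apply: le_trans (leeD2r _ GC) _.
rewrite -EFinD lee_fin; have := dot_ge0 m.
rewrite dotBl !dotBr (dotC c m); lra.
Qed.

(** Jensen for the squared norm: with z = E (G - W), |z|^2 = E <G - W, z> <= (E |G - W|^2 + |z|^2) /
    2. Here [W] is an unbiased estimate of [g], so the bias of [G] is at most its mean square
    distance to [W]. *)
Lemma mean_rV_dist (g : 'rV[R]_n) (W : Om -> 'rV[R]_n) (C beta : R) :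
  measurable_fun setT (W : Om -> borel_rV R n) ->
  (\int[P]_w (dot (G w) (G w))%:E <= C%:E)%E ->
  (forall j, P.-integrable setT (fun w => (W w 0 j)%:E) /\
    (\int[P]_w (W w 0 j)%:E = (g 0 j)%:E)%E) ->
  (\int[P]_w (dot (G w - W w) (G w - W w))%:E <= beta%:E)%E ->
  dot (mean_rV G - g) (mean_rV G - g) <= beta.
Proof.
move=> mW GC WE hb; have mE := mean_rVP GC; set m := mean_rV G in mE *.
set z := m - g.
have iR : P.-integrable setT (EFin \o (fun w => dot (G w - W w) (G w - W w))).
  apply: ge0_integrable; last exact: le_lt_trans hb (ltry _).
    by apply: measurable_dot; exact: measurable_rVB.
  by move=> w; exact: dot_ge0.
have ic (k : R) : P.-integrable setT (EFin \o (fun=> k)).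
  exact: finite_measure_integrable_cst.
have E : (dot z z)%:E = (\int[P]_w (dot (G w - W w) z)%:E)%E.
  under eq_integral do rewrite dotBl.
  rewrite integralBr; [|exact: integrable_dot_mean|exact: integrable_dot_mean].
  by rewrite (integral_dot_mean mE) (integral_dot_mean WE) -EFinB -dotBl.
have : ((dot z z)%:E <= \int[P]_w (2^-1 * dot (G w - W w) (G w - W w) + 2^-1 * dot z z)%:E)%E.
  rewrite E; apply: le_integral => //.
  - by under eq_fun do rewrite dotBl; apply: integrableBr; exact: integrable_dot_mean.
  - by apply: integrableDr => //; exact: integrableZ.
  - move=> w _; rewrite lee_fin; have := young_dot (G w - W w) z ltr01.
    by rewrite invr1; lra.
rewrite integralDr//; last exact: integrableZ.
rewrite integralZ// integral_cst_probability.
move=> h; have {}h := le_trans h (leeD2r _ (lee_wpmul2l _ hb)).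
have : ((dot z z)%:E <= 2^-1%:E * beta%:E + (2^-1 * dot z z)%:E)%E by apply: h; rewrite lee_fin.
rewrite -EFinM -EFinD lee_fin; lra.
Qed.
End MeanOf.

Lemma measurable_Gmu (R : realType) (n : nat) d (Xi : measurableType d)
    (F : 'rV[R]_n -> Xi -> R) (mu : R) d' (T : measurableType d')
    (x u : T -> 'rV[R]_n) (xi : T -> Xi) :
  measurable_fun setT (fun q : borel_rV R n * Xi => F q.1 q.2) ->
  measurable_fun setT (x : T -> borel_rV R n) ->
  measurable_fun setT (u : T -> borel_rV R n) -> measurable_fun setT xi ->
  measurable_fun setT
    ((fun w => ((F (x w + mu *: u w) (xi w) - F (x w) (xi w)) / mu) *: u w)
      : T -> borel_rV R n).
Proof.
move=> F_borel mx mu' mxi.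
have mF (a : T -> 'rV[R]_n) : measurable_fun setT (a : T -> borel_rV R n) ->
    measurable_fun setT (fun w => F (a w) (xi w)).
  by move=> ma; exact: (measurableT_comp F_borel (measurable_fun_pair ma mxi)).
apply: measurable_rVZ => //; apply: measurable_funM; last exact: measurable_cst.
apply: measurable_funB; apply: mF => //.
apply: measurable_rVD => //.
by apply: measurable_rVZ => //; exact: measurable_cst.
Qed.

(** * The oracle at a fixed point *)

Section OracleAtPoint.
Context (R : realType) (n : nat) d (Xi : measurableType d) (Q : probability Xi R).
Context dOm (Om : measurableType dOm) (P : probability Om R).
Local Notation V := 'rV[R]_n.
Variables (F : V -> Xi -> R) (Z : Om -> Xi) (Y : Om -> V).
Hypothesis F_borel : measurable_fun setT
  (fun q : borel_rV R n * Xi => F q.1 q.2).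
Hypothesis mZ : measurable_fun setT Z.
Hypothesis mY : measurable_fun setT (Y : Om -> borel_rV R n).
Hypothesis Z_law : forall B, measurable B -> P (Z @^-1` B) = Q B.
Hypothesis Y_gauss : std_gaussian P Y.
Hypothesis ZY : indep_rv P Z (Y : Om -> borel_rV R n).
Variables (x : V) (g : Xi -> V) (gbar : V) (mu K s2 : R).
Hypothesis mu_gt0 : 0 < mu.
Hypothesis gE : forall j, Q.-integrable setT (fun xi => (g xi 0 j)%:E) /\
  (\int[Q]_xi (g xi 0 j)%:E = (gbar 0 j)%:E)%E.
Hypothesis g_taylor : {ae Q, forall xi, forall h,
  `|F (x + h) xi - F x xi - dot (g xi) h| <= K / 2 * dot h h}.
Hypothesis g_moment2 : (\int[Q]_xi (dot (g xi) (g xi))%:E <= s2%:E)%E.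

Let mg : measurable_fun setT (g : Xi -> borel_rV R n).
Proof. exact: measurable_mean_vector gE. Qed.

Let mgZ : measurable_fun setT ((fun w => g (Z w)) : Om -> borel_rV R n).
Proof. exact: (measurableT_comp mg mZ). Qed.

Local Notation Gmu x xi u := (((F (x + mu *: u) xi - F x xi) / mu) *: u).
(** What the oracle would return if F were affine in x. It is an unbiased estimate of [gbar],
    because the direction is independent of the sample and has identity covariance; [Gx - W] is a
    Taylor remainder. *)
Let W w := dot (g (Z w)) (Y w) *: Y w.
Let Gx w := Gmu x (Z w) (Y w).

Let mW : measurable_fun setT (W : Om -> borel_rV R n).
Proof. by apply: measurable_rVZ => //; exact: measurable_dot. Qed.

Let mGx : measurable_fun setT (Gx : Om -> borel_rV R n).
Proof. by apply: measurable_Gmu => //; exact: measurable_cst. Qed.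

Lemma smoothed_directional_mean j :
  P.-integrable setT (fun w => (W w 0 j)%:E) /\
  (\int[P]_w (W w 0 j)%:E = (gbar 0 j)%:E)%E.
Proof.
have mi i k : measurable_fun setT (fun y : borel_rV R n => (y : V) 0 i * (y : V) 0 k).
  by apply: measurable_funM; exact: measurable_coord.
have ind i : indep_rv P (fun w => g (Z w) 0 i) (fun w => Y w 0 i * Y w 0 j).
  apply: (indep_rv_comp (f := fun xi => g xi 0 i)
    (g := fun y : borel_rV R n => (y : V) 0 i * (y : V) 0 j) ZY).
    exact: measurable_coord_comp.
  exact: mi.
have E w : W w 0 j = \sum_i g (Z w) 0 i * (Y w 0 i * Y w 0 j).
  by rewrite mxE mulr_suml; apply: eq_bigr => i _; rewrite mulrA.
have ig i : P.-integrable setT (EFin \o (fun w => g (Z w) 0 i)).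
  apply: (integrable_law mZ Z_law (f := fun xi => (g xi 0 i)%:E)).
  by have [] := gE i.
have iY i := integrable_gauss_coordM mY Y_gauss i j.
have iM i := integrableM_indep (ind i) (ig i) (iY i).
under eq_fun do rewrite E.
split; first exact: integrable_sumr.
rewrite integral_sumr// (bigD1 j)//= big1 ?adde0 => [|i ij]; last first.
  rewrite integralM_indep// integral_gauss_coordM// (negbTE ij).
  by rewrite mule0.
rewrite integralM_indep// integral_gauss_coordM// eqxx mule1.
rewrite (integral_law mZ Z_law (f := fun xi => (g xi 0 j)%:E)).
  by have [_ ->] := gE j.
by apply/measurable_EFinP; exact: measurable_coord_comp.
Qed.

Let W_moment2 : (\int[P]_w (dot (W w) (W w))%:E <= ((2 * n%:R + 4) * s2)%:E)%E.
Proof.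
have E w : dot (W w) (W w) = dot (g (Z w)) (Y w) ^+ 2 * dot (Y w) (Y w).
  by rewrite dotZl dotZr mulrA expr2.
under eq_integral do rewrite E.
pose phi (z : Xi * borel_rV R n) :=
  (dot (g z.1) (z.2 : V) ^+ 2 * dot (z.2 : V) (z.2 : V))%:E.
have m1 : measurable_fun setT ((fun z => g z.1) : Xi * borel_rV R n -> borel_rV R n).
  exact: (measurableT_comp mg (@measurable_fst _ _ _ _)).
have m2 : measurable_fun setT ((fun z => z.2) : Xi * borel_rV R n -> borel_rV R n).
  exact: measurable_snd.
have n0 : 0 <= 2 * n%:R + 4 :> R by rewrite addr_ge0// mulr_ge0.
apply: le_trans (_ : \int[P]_w ((2 * n%:R + 4) * dot (g (Z w)) (g (Z w)))%:E <= _)%E.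
  apply: (ge0_integral_indep_le mZ mY ZY (phi := phi)).
  - apply/measurable_EFinP; apply: measurable_funM; last exact: measurable_dot.
    by apply: measurable_funX; exact: measurable_dot.
  - by move=> z; rewrite lee_fin mulr_ge0 ?sqr_ge0 ?dot_ge0.
  - apply/measurable_EFinP; apply: measurable_funM; first exact: measurable_cst.
    exact: measurable_dot.
  - by move=> w; exact: (integral_gauss_dot2_norm mY Y_gauss (g (Z w))).
rewrite ge0_integralZ//; last 2 first.
- exact: measurable_dot.
- by move=> w; exact: dot_ge0.
rewrite EFinM; apply: lee_wpmul2l; first by rewrite lee_fin.
rewrite (ge0_integral_law mZ Z_law (f := fun xi => (dot (g xi) (g xi))%:E))//.
- by apply/measurable_EFinP; exact: measurable_dot.
- by move=> xi; rewrite lee_fin dot_ge0.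
Qed.

(** The Taylor remainder K/2 mu^2 |Y|^2, divided by mu, multiplies the direction; squaring gives (mu
    K / 2)^2 |Y|^6, and 15 n^3 bounds the sixth moment. *)
Definition smoothing_bias : R := (mu * K / 2) ^+ 2 * (15 * n%:R ^+ 3).
Local Notation beta := smoothing_bias.

Let remainder : (\int[P]_w (dot (Gx w - W w) (Gx w - W w))%:E <= beta%:E)%E.
Proof.
have mr : measurable_fun setT (fun w => dot (Gx w - W w) (Gx w - W w)).
  by apply: measurable_dot; exact: measurable_rVB.
have mb : measurable_fun setT (fun w => dot (Y w) (Y w) ^+ 3).
  by apply: measurable_funX; exact: measurable_dot.
have b0 w : 0 <= dot (Y w) (Y w) ^+ 3 by rewrite exprn_ge0// dot_ge0.
have k0 : 0 <= (mu * K / 2) ^+ 2 by exact: sqr_ge0.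
apply: le_trans (_ : \int[P]_w ((mu * K / 2) ^+ 2 * dot (Y w) (Y w) ^+ 3)%:E <= _)%E.
  apply: ae_ge0_le_integral => //.
  - by move=> w _; rewrite lee_fin dot_ge0.
  - exact/measurable_EFinP.
  - by move=> w _; rewrite lee_fin mulr_ge0.
  - by apply/measurable_EFinP; apply: measurable_funM => //; exact: measurable_cst.
  (* The exceptional set is the same for all displacements, so it may be pulled back along [Z] alone
     although the displacement [mu *: Y w] is random. *)
  have [N [mN N0 sN]] := g_taylor.
  exists (Z @^-1` N); split.
  - by rewrite -[_ @^-1` _]setTI; exact: mZ.
  - by rewrite -N0; exact: Z_law.
  move=> w /= nw; apply: sN => /= tz; apply: nw => _; rewrite lee_fin.
  have E : Gx w - W w = ((F (x + mu *: Y w) (Z w) - F x (Z w)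
      - dot (g (Z w)) (mu *: Y w)) / mu) *: Y w.
    rewrite /Gx /W -scalerBl; congr (_ *: _).
    by rewrite dotZr [RHS]mulrBl (mulrC mu) mulfK ?gt_eqF.
  rewrite E; set c := _ / mu; rewrite dotZl dotZr.
  have le1 : `|c| <= mu * K / 2 * dot (Y w) (Y w).
    rewrite normrM normfV (gtr0_norm mu_gt0) ler_pdivrMr//.
    apply: le_trans (tz _) _; rewrite dotZl dotZr.
    by rewrite le_eqVlt; apply/orP; left; apply/eqP; ring.
  have le2 : c ^+ 2 <= (mu * K / 2 * dot (Y w) (Y w)) ^+ 2.
    by rewrite -real_normK ?num_real// ler_sqr ?nnegrE// (le_trans _ le1).
  rewrite mulrA -expr2; apply: le_trans (ler_wpM2r (dot_ge0 _) le2) _.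
  by set k := mu * K / 2; rewrite exprMn -mulrA -exprSr.
rewrite ge0_integralZ//.
have -> : (beta%:E = ((mu * K / 2) ^+ 2)%:E * (15 * n%:R ^+ 3)%:E)%E by rewrite -EFinM.
apply: lee_wpmul2l; first by rewrite lee_fin.
exact: integral_gauss_norm6.
Qed.

Definition oracle_moment : R := 2 * ((2 * n%:R + 4) * s2) + 2 * beta.

Lemma Gmu_moment2 :
  (\int[P]_w (dot (Gmu x (Z w) (Y w)) (Gmu x (Z w) (Y w)))%:E
    <= oracle_moment%:E)%E.
Proof.
have mr : measurable_fun setT (fun w => dot (Gx w - W w) (Gx w - W w)).
  by apply: measurable_dot; exact: measurable_rVB.
have mw : measurable_fun setT (fun w => dot (W w) (W w)) by exact: measurable_dot.
have d0 (h : Om -> V) w : 0 <= dot (h w) (h w) by exact: dot_ge0.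
have c2 : measurable_fun setT (fun _ : Om => 2 : R) by exact: measurable_cst.
apply: le_trans (_ : \int[P]_w (2 * dot (W w) (W w)
    + 2 * dot (Gx w - W w) (Gx w - W w))%:E <= _)%E.
  apply: ge0_le_integralr.
  - exact: measurable_dot.
  - by apply: measurable_funD; apply: measurable_funM.
  - by move=> w; exact: dot_ge0.
  - by move=> w; rewrite -/(Gx w) -{1 2}[Gx w](subrK (W w)) addrC; exact: dotD_le.
rewrite ge0_integralDr; try by (apply: measurable_funM).
2: by move=> w; rewrite mulr_ge0// dot_ge0.
2: by move=> w; rewrite mulr_ge0// dot_ge0.
rewrite !ge0_integralZ//; last by move=> w; exact: dot_ge0.
have -> : (oracle_moment%:E = 2%:E * ((2 * n%:R + 4) * s2)%:E + 2%:E * beta%:E)%E.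
  by rewrite -!EFinM -EFinD.
apply: leeD; apply: lee_wpmul2l; rewrite ?lee_fin//; exact: remainder.
Qed.

Local Notation mean := (mean_rV P (fun w => Gmu x (Z w) (Y w))).

Lemma Gmu_bias : dot (mean - gbar) (mean - gbar) <= beta.
Proof. exact: (mean_rV_dist mGx mW Gmu_moment2 smoothed_directional_mean remainder). Qed.

Lemma Gmu_shift c :
  (\int[P]_w (dot (c + Gmu x (Z w) (Y w) - mean)
                  (c + Gmu x (Z w) (Y w) - mean))%:E
    <= (dot c c + oracle_moment)%:E)%E.
Proof. exact: (second_moment_shift mGx c Gmu_moment2). Qed.

End OracleAtPoint.

Lemma lipschitz_measurable (R : realType) (n m : nat) (h : 'rV[R]_n -> 'rV[R]_m) (K : R) :
  (forall x y, enorm (h x - h y) <= K * enorm (x - y)) ->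
  measurable_fun setT (h : borel_rV R n -> borel_rV R m).
Proof.
move=> hK; apply/measurable_rV => j.
suff cont (x : 'rV[R]_n) : (fun y => h y 0 j) @ nbhs x --> h x 0 j.
  by apply: continuous_measurable_rV => x; exact: cont.
have e0 : K * enorm (x - y) @[y --> x] --> (0 : R).
  have e1 : enorm (x - y) @[y --> x] --> (0 : R).
    rewrite -[X in _ --> X](@sqrtr0 R).
    apply: (cvg_comp (fun y => dot (x - y) (x - y)) (@Num.sqrt R)); last exact: sqrt_continuous.
    have dx : x - y @[y --> x] --> (0 : 'rV[R]_n).
      have cx : (fun _ : 'rV[R]_n => x) y @[y --> x] --> x by exact: (@cvg_cst _ x _ (nbhs x)).
      have ci : (fun y : 'rV[R]_n => y) y @[y --> x] --> x by exact: cvg_id.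
      by have := cvgB cx ci; rewrite subrr; apply.
    by have := cvg_dot _ dx dx; rewrite dot0l; apply.
  have cK : (fun _ : 'rV[R]_n => K) y @[y --> x] --> K by exact: (@cvg_cst _ K _ (nbhs x)).
  by have := cvgM cK e1; rewrite mulr0; apply.
apply: (cvgrPdist_lt (F := nbhs x) _ _).2 => e egt0.
have /cvgr_lt /(_ _ egt0) := e0.
apply: filterS => y; apply: le_lt_trans.
apply: le_trans (hK x y); apply: le_trans (ler_norm_enorm _ j).
by rewrite !mxE.
Qed.

Lemma measurable_mean_rV (R : realType) (n : nat) d (T : measurableType d)
    d' (Om : measurableType d') (P : probability Om R) (G : T -> Om -> 'rV[R]_n) :
  measurable_fun setT ((fun z => G z.1 z.2) : T * Om -> borel_rV R n) ->
  measurable_fun setT ((fun x => mean_rV P (G x)) : T -> borel_rV R n).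
Proof.
move=> mG; apply/measurable_rV => j; under eq_fun do rewrite mxE.
apply: (measurableT_comp (f := fine)) => //.
pose h (z : T * Om) := (G z.1 z.2 0 j)%:E.
have mh : measurable_fun setT h.
  by apply/measurable_EFinP; exact: measurable_coord_comp.
rewrite (_ : (fun x => _) =
    (fun x => \int[P]_w h^\+ (x, w)) \- (fun x => \int[P]_w h^\- (x, w)))%E.
  apply: emeasurable_funB.
    apply: (measurable_fun_fubini_tonelli_F h^\+%E) => //.
    exact: measurable_funepos.
  apply: (measurable_fun_fubini_tonelli_F h^\-%E) => //.
  exact: measurable_funeneg.
apply/funext => x; rewrite integralE; congr (_ - _)%E.
  by apply: eq_integral => w _; rewrite !funeposE.
by apply: eq_integral => w _; rewrite !funenegE.
Qed.

(** * Averages of oracle values at a random point *)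

Section Batch.
Context (R : realType) (n : nat) d (Xi : measurableType d) (Q : probability Xi R).
Local Notation V := 'rV[R]_n.
Variables (F : V -> Xi -> R) (g : V -> Xi -> V) (gbar : V -> V) (Dom : set V).
Variables (mu K s2 : R).
Hypothesis F_borel : measurable_fun setT
  (fun q : borel_rV R n * Xi => F q.1 q.2).
Hypothesis mu_gt0 : 0 < mu.
Hypothesis s2_ge0 : 0 <= s2.
Hypothesis gE : forall x j, Q.-integrable setT (fun xi => (g x xi 0 j)%:E) /\
  (\int[Q]_xi (g x xi 0 j)%:E = (gbar x 0 j)%:E)%E.
Hypothesis g_taylor : forall x, {ae Q, forall xi, forall h,
  `|F (x + h) xi - F x xi - dot (g x xi) h| <= K / 2 * dot h h}.
Hypothesis g_moment2 : forall x, Dom x ->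
  (\int[Q]_xi (dot (g x xi) (g x xi))%:E <= s2%:E)%E.
Hypothesis mgbar : measurable_fun setT (gbar : borel_rV R n -> borel_rV R n).

Local Notation Gmu x xi u := (((F (x + mu *: u) xi - F x xi) / mu) *: u).
Local Notation beta := (smoothing_bias n mu K).
Local Notation A := (oracle_moment n mu K s2).

Lemma smoothing_bias_ge0 : 0 <= beta.
Proof. by rewrite mulr_ge0 ?sqr_ge0// mulr_ge0// exprn_ge0. Qed.

Lemma oracle_moment_ge0 : 0 <= A.
Proof.
have b0 := smoothing_bias_ge0.
by rewrite addr_ge0// mulr_ge0// mulr_ge0// addr_ge0// mulr_ge0.
Qed.

Context dOm (Om : measurableType dOm) (P : probability Om R) (m : nat).
Variables (Z : nat -> Om -> Xi) (Y : nat -> Om -> V).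

Definition oracle_mean t (x : V) : V := mean_rV P (fun w => Gmu x (Z t w) (Y t w)).

(** A martingale in [k]: each oracle value is centred at its mean for the current point [x w], not
    at an overall expectation. *)
Definition fluct (x : Om -> V) (k : nat) (w : Om) : V :=
  \sum_(t < k) (Gmu (x w) (Z t w) (Y t w) - oracle_mean t (x w)).

Hypothesis mZ : forall t, (t < m)%N -> measurable_fun setT (Z t).
Hypothesis mY : forall t, (t < m)%N -> measurable_fun setT (Y t : Om -> borel_rV R n).

Lemma measurable_oracle_mean t : (t < m)%N ->
  measurable_fun setT (oracle_mean t : borel_rV R n -> borel_rV R n).
Proof.
move=> tm; apply: measurable_mean_rV; apply: (measurable_Gmu mu F_borel).
- exact: measurable_fst.
- exact: (measurableT_comp (mY tm) (@measurable_snd _ _ _ _)).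
- exact: (measurableT_comp (mZ tm) (@measurable_snd _ _ _ _)).
Qed.

(* [T] is [Om] with a coarser sigma-algebra *)
Lemma measurable_fluct d' (T : measurableType d') (i : T -> Om) (x : Om -> V) k :
  (k <= m)%N -> measurable_fun setT (x \o i : T -> borel_rV R n) ->
  (forall t, (t < k)%N -> measurable_fun setT (Z t \o i)) ->
  (forall t, (t < k)%N -> measurable_fun setT (Y t \o i : T -> borel_rV R n)) ->
  measurable_fun setT (fluct x k \o i : T -> borel_rV R n).
Proof.
move=> km mx mZi mYi; apply: measurable_rV_sum => t; apply: measurable_rVB.
  by apply: (measurable_Gmu mu F_borel) => //; [exact: mYi|exact: mZi].
apply: (measurableT_comp (f := oracle_mean t : borel_rV R n -> borel_rV R n) _ mx).
exact: measurable_oracle_mean (leq_trans (ltn_ord t) km).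
Qed.

Hypothesis Z_law : forall t, (t < m)%N -> forall B, measurable B -> P (Z t @^-1` B) = Q B.
Hypothesis Y_gauss : forall t, (t < m)%N -> std_gaussian P (Y t).
Hypothesis ZY : forall t, (t < m)%N -> indep_rv P (Z t) (Y t : Om -> borel_rV R n).

Variable x : Om -> V.
Hypothesis mx : measurable_fun setT (x : Om -> borel_rV R n).
Hypothesis xD : forall w, Dom (x w).
Hypothesis x_indep : forall t, (t < m)%N ->
  indep_rv P (fun w => (x w : borel_rV R n, fluct x t w : borel_rV R n))
             (fun w => (Z t w, Y t w : borel_rV R n)).

Let mfluct k : (k <= m)%N -> measurable_fun setT (fluct x k : Om -> borel_rV R n).
Proof.
move=> km; apply: (measurable_fluct (i := id)) => // t tk.
  exact: mZ (leq_trans tk km).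
exact: mY (leq_trans tk km).
Qed.

(* Given the past, the next summand is an independent centred perturbation, so it
   adds at most its own second moment. *)
Lemma fluct_moment2 k : (k <= m)%N ->
  (\int[P]_w (dot (fluct x k w) (fluct x k w))%:E <= (k%:R * A)%:E)%E.
Proof.
elim: k => [_|k IH km].
  under eq_integral do rewrite /fluct big_ord0 dot0l.
  by rewrite integral0 mul0r.
have mk := mfluct (ltnW km).
pose phi (z : (borel_rV R n * borel_rV R n) * (Xi * borel_rV R n)) :=
  (dot ((z.1.2 : V) + Gmu (z.1.1 : V) z.2.1 (z.2.2 : V) - oracle_mean k z.1.1)
       ((z.1.2 : V) + Gmu (z.1.1 : V) z.2.1 (z.2.2 : V) - oracle_mean k z.1.1))%:E.
have mphi : measurable_fun setT phi.
  have f1 : measurable_fun setT ((fun z => z.1.1) : (borel_rV R n * borel_rV R n) * (Xi * borel_rV R n) -> borel_rV R n).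
    exact: (measurableT_comp (@measurable_fst _ _ _ _) (@measurable_fst _ _ _ _)).
  apply/measurable_EFinP.
  have md : measurable_fun setT ((fun z => (z.1.2 : V) + Gmu (z.1.1 : V) z.2.1 (z.2.2 : V) - oracle_mean k z.1.1)
      : (borel_rV R n * borel_rV R n) * (Xi * borel_rV R n) -> borel_rV R n).
    apply: measurable_rVB; last exact: (measurableT_comp (measurable_oracle_mean km) f1).
    apply: measurable_rVD; first exact: (measurableT_comp (@measurable_snd _ _ _ _) (@measurable_fst _ _ _ _)).
    apply: (measurable_Gmu mu F_borel) => //.
      exact: (measurableT_comp (@measurable_snd _ _ _ _) (@measurable_snd _ _ _ _)).
    exact: (measurableT_comp (@measurable_fst _ _ _ _) (@measurable_snd _ _ _ _)).
  exact: measurable_dot.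
have phi0 z : (0 <= phi z)%E by rewrite lee_fin dot_ge0.
have mpx := measurable_fun_pair mx mk.
have mpy := measurable_fun_pair (mZ km) (mY km).
have E w : (dot (fluct x k.+1 w) (fluct x k.+1 w))%:E =
    phi ((x w, fluct x k w), (Z k w, Y k w)).
  by rewrite /phi /fluct big_ord_recr/= !addrA.
under eq_integral do rewrite E.
have md : measurable_fun setT (fun w => dot (fluct x k w) (fluct x k w)).
  exact: measurable_dot.
apply: le_trans (_ : \int[P]_w (dot (fluct x k w) (fluct x k w) + A)%:E <= _)%E.
  apply: (ge0_integral_indep_le mpx mpy (x_indep km) mphi phi0).
    by apply/measurable_EFinP; apply: measurable_funD => //; exact: measurable_cst.
  move=> w; rewrite /phi /=.
  apply: (Gmu_shift F_borel (mZ km) (mY km) (Z_law km) (Y_gauss km) (ZY km)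
    mu_gt0 (gE (x w)) (g_taylor (x w)) (g_moment2 (xD w))).
rewrite ge0_integralDr//.
- rewrite integral_cst_probability; apply: le_trans (leeD2r _ (IH (ltnW km))) _.
  by rewrite -EFinD lee_fin -natr1; lra.
- by move=> w; exact: dot_ge0.
- by move=> w; exact: oracle_moment_ge0.
Qed.

Hypothesis m_gt0 : (0 < m)%N.

Definition batch_error w : V :=
  m%:R^-1 *: (\sum_(t < m) Gmu (x w) (Z t w) (Y t w)) - gbar (x w).

Lemma measurable_batch_error :
  measurable_fun setT (batch_error : Om -> borel_rV R n).
Proof.
apply: measurable_rVB; last exact: measurableT_comp mx.
apply: measurable_rVZ; first exact: measurable_cst.
apply: measurable_rV_sum => t; apply: (measurable_Gmu mu F_borel) => //.
  exact: mY.
exact: mZ.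
Qed.

(** The error is an averaged fluctuation plus an average of biases, each of norm at most the square
    root of [beta]. The inequality holds path by path, so only the fluctuation is left for a moment
    bound (first phase) or a tail bound (second phase). *)
Lemma batch_error_le w :
  dot (batch_error w) (batch_error w) <=
  2 * (m%:R ^- 2 * dot (fluct x m w) (fluct x m w)) + 2 * beta.
Proof.
have m0 : 0 < m%:R :> R by rewrite ltr0n.
pose v t := oracle_mean t (x w) - gbar (x w).
have vb (t : 'I_m) : enorm (v t) <= Num.sqrt beta.
  rewrite ler_sqrt ?smoothing_bias_ge0//.
  have tm := ltn_ord t.
  exact: (Gmu_bias F_borel (mZ tm) (mY tm) (Z_law tm) (Y_gauss tm) (ZY tm)
    mu_gt0 (gE (x w)) (g_taylor (x w)) (g_moment2 (xD w))).
have E : batch_error w = m%:R^-1 *: fluct x m w + m%:R^-1 *: \sum_(t < m) v t.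
  rewrite -scalerDr /fluct -big_split/=.
  under [in RHS]eq_bigr do rewrite /v addrA subrK.
  rewrite big_split/= sumr_const card_ord scalerDr mulNrn scalerN.
  by rewrite -(scaler_nat m (gbar _)) scalerA mulVf ?scale1r ?gt_eqF.
rewrite E; apply: le_trans (dotD_le _ _) _; rewrite lerD//.
  by rewrite ler_pM2l// dotZl dotZr mulrA -exprVn expr2.
rewrite ler_pM2l// -enorm_sqr enormZ gtr0_norm ?invr_gt0//.
rewrite -[leRHS]sqr_sqrtr ?smoothing_bias_ge0// ler_sqr ?nnegrE ?sqrtr_ge0//; last first.
  by rewrite mulr_ge0 ?enorm_ge0// invr_ge0 ltW.
rewrite mulrC ler_pdivrMr//.
apply: le_trans (_ : \sum_(t < m) enorm (v t) <= _).
  elim/big_rec2 : _ => [|t a b _ le1]; first by rewrite enorm0.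
  by apply: le_trans (enormD _ _) _; rewrite lerD2l.
apply: le_trans (ler_sum _ (fun t _ => vb t)) _.
by rewrite sumr_const card_ord mulr_natr.
Qed.

Lemma batch_error_moment2 :
  (\int[P]_w (dot (batch_error w) (batch_error w))%:E
    <= (2 * (A / m%:R) + 2 * beta)%:E)%E.
Proof.
have m0 : 0 < m%:R :> R by rewrite ltr0n.
have md : measurable_fun setT (fun w => dot (fluct x m w) (fluct x m w)).
  by have mm := mfluct (leqnn m); exact: measurable_dot.
have f0 w : 0 <= dot (fluct x m w) (fluct x m w) by exact: dot_ge0.
have k0 : 0 <= m%:R ^- 2 :> R by rewrite invr_ge0 sqr_ge0.
have mdk : measurable_fun setT (fun w => m%:R ^- 2 * dot (fluct x m w) (fluct x m w)).
  by apply: measurable_funM => //; exact: measurable_cst.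
have mdk2 : measurable_fun setT (fun w => 2 * (m%:R ^- 2 * dot (fluct x m w) (fluct x m w))).
  by apply: measurable_funM => //; exact: measurable_cst.
apply: le_trans (ge0_le_integralr P _ _ _ batch_error_le) _.
- by have mb := measurable_batch_error; exact: measurable_dot.
- by apply: measurable_funD => //; exact: measurable_cst.
- by move=> w; exact: dot_ge0.
rewrite ge0_integralDr//.
- rewrite ge0_integralZ// => [|w]; last by rewrite mulr_ge0.
  rewrite ge0_integralZ// integral_cst_probability.
  apply: le_trans (_ : 2%:E * ((m%:R ^- 2)%:E * (m%:R * A)%:E) + (2 * beta)%:E <= _)%E.
    rewrite leeD2r// lee_wpmul2l ?lee_fin// lee_wpmul2l ?lee_fin//.
    exact: fluct_moment2.
  rewrite -!EFinM -EFinD lee_fin lerD2r ler_pM2l//.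
  by rewrite mulrA -exprVn expr2 -(mulrA _^-1) mulVf ?gt_eqF// mulr1 mulrC.
- by move=> w; rewrite !mulr_ge0.
- by move=> w; rewrite mulr_ge0 ?smoothing_bias_ge0.
Qed.

Lemma fluct_tail (t : R) : 0 < t ->
  (P [set w | (t < m%:R ^- 2 * dot (fluct x m w) (fluct x m w))%R]
     <= (A / (m%:R * t))%:E)%E.
Proof.
move=> t0; have m0 : 0 < m%:R :> R by rewrite ltr0n.
have md : measurable_fun setT (fun w => dot (fluct x m w) (fluct x m w)).
  by have mm := mfluct (leqnn m); exact: measurable_dot.
rewrite (_ : A / (m%:R * t) = m%:R ^- 2 * (m%:R * A) / t); last by field; lra.
apply: markov_ge0 => //.
- by apply: measurable_funM => //; exact: measurable_cst.
- by move=> w; rewrite mulr_ge0 ?dot_ge0// invr_ge0 sqr_ge0.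
rewrite ge0_integralZ ?invr_ge0 ?sqr_ge0//; last by move=> w; exact: dot_ge0.
rewrite EFinM; apply: lee_wpmul2l; last exact: fluct_moment2.
by rewrite lee_fin invr_ge0 sqr_ge0.
Qed.

End Batch.

(** * The generalized gradient *)

Section GeneralizedGradient.
Context {R : realType} {b : nat} {nn : 'I_b -> nat}.
Local Notation V := 'rV[R]_(dim nn).
Variables (X : forall s, set 'rV[R]_(nn s)) (chi phi : forall s, 'rV[R]_(nn s) -> R).
Arguments X s : clear implicits.
Arguments chi s : clear implicits.
Arguments phi s : clear implicits.
Hypothesis X_closed : forall s, closed (X s).
Hypothesis X_convex : forall s, convex_set (X s).
Hypothesis chi_cc : forall s, closed_convex_function (chi s).
Hypothesis phi_diff : forall s, differentiable_everywhere (phi s).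
Hypothesis phi_sc : forall s, strongly_convex1 (phi s).
Variable CndG : forall s, 'rV[R]_(nn s) -> 'rV[R]_(nn s) -> R -> R -> 'rV[R]_(nn s).
Arguments CndG s : clear implicits.
Hypothesis CndG_ok : cndg_procedure X chi phi CndG.
Variable a : R.
Hypothesis a_gt0 : 0 < a.
Local Notation prox s x g := (prox_block (X s) (chi s) (phi s) x g a).
Local Notation gg x g := (gen_grad X chi phi x g a).

Lemma CndG_approx s x g delta : 0 < delta -> X s x ->
  approx_prox (X s) (chi s) (phi s) x g a delta (CndG s x g a delta).
Proof.
move=> d0 Xx; have [h _] := @CndG_ok s _ _ a_gt0 d0.
exact: (cndg_returns_approx (@X_convex s) (@phi_diff s) (@phi_sc s) a_gt0 Xx (h _ _ Xx)).
Qed.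

(** The outputs of [CndG] at all positive accuracies are the approximate points from which the exact
    one is built. *)
Lemma prox_block_approx s x g : X s x ->
  approx_prox (X s) (chi s) (phi s) x g a 0 (prox s x g).
Proof.
move=> Xx; apply: prox_blockP => //.
by move=> delta d0; exists (CndG s x g a delta); exact: CndG_approx.
Qed.

Lemma gen_grad_block x g s :
  gg x g *m U R nn s = a^-1 *: (x *m U R nn s - prox s (x *m U R nn s) (g *m U R nn s)).
Proof. by rewrite /gen_grad mxrow_mulU. Qed.

Lemma gen_grad_lipschitz x g1 g2 : prodX X x ->
  dot (gg x g1 - gg x g2) (gg x g1 - gg x g2) <= dot (g1 - g2) (g1 - g2).
Proof.
move=> Xx; rewrite (dot_blocks (gg x g1 - _)) (dot_blocks (g1 - g2)).
apply: ler_sum => s _; rewrite !mulmxBl !gen_grad_block -scalerBr.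
set p1 := prox s _ _; set p2 := prox s _ _; set c := g1 *m _ - _.
rewrite (_ : _ - p1 - _ = p2 - p1); last by rewrite opprB addrC addrA subrK.
have : dot (p2 - p1) (p2 - p1) <= a ^+ 2 * dot c c.
  have := approx_prox_lipschitz a_gt0 (lexx 0)
    (prox_block_approx (g2 *m U R nn s) (Xx s)) (prox_block_approx (g1 *m U R nn s) (Xx s)).
  rewrite -/p1 -/p2 !mulr0 add0r -(opprB (g1 *m _)) -/c.
  by rewrite (dotNl c) (dotNr c) opprK.
move=> le1; rewrite dotZl dotZr mulrA -expr2 exprVn mulrC ler_pdivrMr ?exprn_gt0// mulrC.
exact: le1.
Qed.

(** [x1] is the selected candidate and [x0] a competitor. Replacing a gradient by its estimate moves
    each norm by at most the error, so p1 <= p0 + e1 + e0; squaring gives the factors 2 and 4. *)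
Lemma gen_grad_compare x0 x1 g0 g1 G0 G1 : prodX X x0 -> prodX X x1 ->
  enorm (gg x1 G1) <= enorm (gg x0 G0) ->
  dot (gg x1 g1) (gg x1 g1) <= 2 * dot (gg x0 g0) (gg x0 g0)
    + 4 * (dot (G1 - g1) (G1 - g1) + dot (G0 - g0) (G0 - g0)).
Proof.
move=> Xx0 Xx1.
have near x g G : prodX X x -> `|enorm (gg x g) - enorm (gg x G)| <= enorm (G - g).
  move=> Xx; have lip : enorm (gg x G - gg x g) <= enorm (G - g).
    by rewrite -ler_sqr ?nnegrE ?enorm_ge0// !enorm_sqr; exact: gen_grad_lipschitz.
  have t1 := enormD (gg x G - gg x g) (gg x g); have t2 := enormD (gg x g - gg x G) (gg x G).
  rewrite subrK in t1; rewrite subrK enormB in t2.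
  move: lip t1 t2; generalize (enorm (gg x G - gg x g)) (enorm (gg x g)) (enorm (gg x G)).
  by generalize (enorm (G - g)) => e p q r *; rewrite ler_norml; apply/andP; split; lra.
have := near x1 g1 G1 Xx1; have := near x0 g0 G0 Xx0; rewrite -!enorm_sqr.
move: (enorm_ge0 (gg x1 g1)) (enorm_ge0 (gg x0 g0)) (enorm_ge0 (G1 - g1)) (enorm_ge0 (G0 - g0)).
generalize (enorm (gg x1 g1)) (enorm (gg x0 g0)) (enorm (G1 - g1)) (enorm (G0 - g0))
  (enorm (gg x1 G1)) (enorm (gg x0 G0)) => p1 p0 e1 e0 q1 q0 p10 p00 e10 e00.
rewrite !ler_norml => /andP[h0 h0'] /andP[h1 h1'] le10.
have le : p1 <= p0 + (e1 + e0) by lra.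
have le2 : p1 ^+ 2 <= (p0 + (e1 + e0)) ^+ 2.
  by rewrite ler_sqr ?nnegrE// !addr_ge0.
have := sqr_ge0 (p0 - (e1 + e0)); have := sqr_ge0 (e1 - e0); lra.
Qed.

Lemma measurable_CndG d (T : measurableType d) s (x g : T -> V) (delta : R) :
  0 < delta ->
  measurable_fun setT (x : T -> borel_rV R (dim nn)) ->
  measurable_fun setT (g : T -> borel_rV R (dim nn)) ->
  (forall w, prodX X (x w)) ->
  measurable_fun setT ((fun w => CndG s (x w *m U R nn s) (g w *m U R nn s) a delta)
    : T -> borel_rV R (nn s)).
Proof.
move=> d0 mx mg Xx; have [_ mC] := @CndG_ok s _ _ a_gt0 d0.
have mX : measurable ([set p | X s p.1] : set (borel_rV R (nn s) * borel_rV R (nn s))).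
  have mXs : measurable (X s : set (borel_rV R (nn s))).
    rewrite -(setCK (X s)); apply: measurableC.
    by apply: sub_sigma_algebra; exact: closed_openC (@X_closed s).
  rewrite (_ : [set p | _] = (X s) `*` setT); first exact: measurableX.
  by apply/seteqP; split => p /=; [move=> ?; split|case].
have sub : (fun w => (x w *m U R nn s, g w *m U R nn s)) @` setT `<=` [set p | X s p.1].
  by move=> _ [w _ <-] /=; exact: Xx.
have mp := measurable_fun_pair (measurable_rV_mulmx (U R nn s) mx)
  (measurable_rV_mulmx (U R nn s) mg).
exact: (measurable_comp mX sub mC mp).
Qed.

(* The exact proximal point is the limit of the outputs of [CndG] at accuracy
   1/(k+1), which depend measurably on their arguments. *)
Lemma measurable_gen_grad d (T : measurableType d) (x g : T -> V) :
  measurable_fun setT (x : T -> borel_rV R (dim nn)) ->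
  measurable_fun setT (g : T -> borel_rV R (dim nn)) ->
  (forall w, prodX X (x w)) ->
  measurable_fun setT ((fun w => gg (x w) (g w)) : T -> borel_rV R (dim nn)).
Proof.
move=> mx mg Xx; apply: measurable_mxrow => s.
apply: measurable_rVZ; first exact: measurable_cst.
apply: measurable_rVB; first exact: measurable_rV_mulmx.
apply/measurable_rV => j.
pose e (k : nat) : R := k.+1%:R^-1.
have e0 k : 0 < e k by rewrite invr_gt0 ltr0n.
pose y k w : 'rV[R]_(nn s) := CndG s (x w *m U R nn s) (g w *m U R nn s) a (e k).
apply: (measurable_fun_cvg (h := fun k w => y k w 0 j)).
  by move=> k; apply: measurable_coord_comp; exact: measurable_CndG.
move=> w _; set p := prox s _ _.
have dist k : `|y k w 0 j - p 0 j| <= Num.sqrt (a * e k).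
  rewrite (_ : _ - _ = (y k w - p) 0 j); last by rewrite !mxE.
  apply: le_trans (ler_norm_enorm _ _) _; rewrite ler_sqrt; last by rewrite mulr_ge0// ltW.
  rewrite -[e k]addr0; apply: (@approx_prox_dist _ _ (X s) (chi s) (phi s)
    (x w *m U R nn s) (g w *m U R nn s) a a_gt0).
    exact: (CndG_approx _ (e0 k) (Xx w s)).
  exact: (prox_block_approx _ (Xx w s)).
have c0 : Num.sqrt (a * e k) @[k --> \oo] --> (0 : R).
  rewrite -[X in _ --> X](@sqrtr0 R).
  apply: (cvg_comp (fun k => a * e k) (@Num.sqrt R)); last exact: sqrt_continuous.
  have ca : (fun _ : nat => a) k @[k --> \oo] --> a by exact: cvg_cst.
  have ce : e k @[k --> \oo] --> (0 : R) by exact: cvg_harmonic.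
  by have := cvgM ca ce; rewrite mulr0; apply.
apply: (cvgrPdist_lt (F := \oo) _ _).2 => r r0.
have /cvgr_lt /(_ _ r0) := c0.
by apply: filterS => k; apply: le_lt_trans; rewrite distrC.
Qed.

Lemma descent_step (f : V -> R) (L : 'I_b -> R) (x G : V) s (delta : R) :
  differentiable_everywhere f ->
  (forall r (h : 'rV[R]_(nn r)) (t : R), 0 <= t <= 1 ->
    dot (grad f (x + t *: (h *m (U R nn r)^T)) - grad f x) (h *m (U R nn r)^T)
      <= L r * dot h h * t) ->
  0 < delta -> L s <= (2 * a)^-1 -> prodX X x ->
  let x' := \mxrow_r (if r == s then CndG r (x *m U R nn r) (G *m U R nn r) a delta
                      else x *m U R nn r) in
  prodX X x' /\
  Phi f chi x' + a / 4 * dot (gg x (grad f x) *m U R nn s) (gg x (grad f x) *m U R nn s)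
  <= Phi f chi x
     + 3 / 2 * a * dot ((G - grad f x) *m U R nn s) ((G - grad f x) *m U R nn s)
     + 2 * delta.
Proof.
move=> df smooth d0 La Xx x'.
have [CndGh _] := @CndG_ok s _ _ a_gt0 d0.
have ret := CndGh _ (G *m U R nn s) (Xx s).
set y := CndG s (x *m U R nn s) (G *m U R nn s) a delta in ret.
have Xy : X s y by exact: (cndg_returns_in (@X_convex s) (Xx s) ret).
have x'E r : x' *m U R nn r = if r == s then CndG r (x *m U R nn r) (G *m U R nn r) a delta
                              else x *m U R nn r.
  by rewrite mxrow_mulU.
split; first by move=> r; rewrite x'E; case: eqP => [->|_]; [exact: Xy|exact: Xx].
pose h : 'rV[R]_(nn s) := y - x *m U R nn s.
(* The increment is extended to a family over all blocks to match the form of [mulmx_trU]; its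
   member at [s] is [h]. *)
pose h' r : 'rV[R]_(nn r) := CndG r (x *m U R nn r) (G *m U R nn r) a delta - x *m U R nn r.
have hE : h *m (U R nn s)^T = \mxrow_r (if r == s then h' r else 0) by exact: (mulmx_trU h').
have x'D : x' = x + h *m (U R nn s)^T.
  apply: eq_blocks => r; rewrite x'E mulmxDl hE mxrow_mulU; case: eqP => _.
    by rewrite addrC subrK.
  by rewrite addr0.
have := taylor_upper df (smooth s h).
rewrite -x'D.
have bd := block_descent (@X_convex s) (@phi_diff s) (@phi_sc s) a_gt0 d0 La (Xx s) ret
  (prox_block_approx (grad f x *m U R nn s) (Xx s)).
rewrite dot_trU gen_grad_block mulmxBl => tay.
have phiE : \sum_r chi r (x' *m U R nn r) = \sum_r chi r (x *m U R nn r)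
    + (chi s y - chi s (x *m U R nn s)).
  rewrite [LHS](bigD1 s)//= [X in _ = X + _](bigD1 s)//= x'E eqxx -/y.
  rewrite (eq_bigr (fun r => chi r (x *m U R nn r))) => [|r /negbTE rs].
    by lra.
  by rewrite x'E rs.
move: tay bd; rewrite /Phi phiE -/h.
generalize (grad f x) => g; lra.
Qed.

End GeneralizedGradient.

(** * The random draws *)

Section LabelCode.
Context {S T m Tp : nat}.

(** An injection into a sum of products of ordinals, which makes the labels a finite type, so that
    events can be intersected and probabilities multiplied over all of them. *)
Definition label_code (l : draw_label S T m Tp) :
    ('I_S * 'I_T) + 'I_S + ('I_S * 'I_T * 'I_m) + ('I_S * 'I_T * 'I_m) + 'I_Tp + 'I_Tp :=
  match l with
  | LBlock i k => inl (inl (inl (inl (inl (i, k)))))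
  | LStop i => inl (inl (inl (inl (inr i))))
  | LSample i k t => inl (inl (inl (inr (i, k, t))))
  | LDir i k t => inl (inl (inr (i, k, t)))
  | LPostSample k => inl (inr k)
  | LPostDir k => inr k
  end.

Definition label_decode c : draw_label S T m Tp :=
  match c with
  | inl (inl (inl (inl (inl (i, k))))) => LBlock _ _ i k
  | inl (inl (inl (inl (inr i)))) => LStop _ _ _ i
  | inl (inl (inl (inr (i, k, t)))) => LSample _ i k t
  | inl (inl (inr (i, k, t))) => LDir _ i k t
  | inl (inr k) => LPostSample _ _ _ k
  | inr k => LPostDir _ _ _ k
  end.

Lemma label_codeK : cancel label_code label_decode.
Proof. by case. Qed.
End LabelCode.

HB.instance Definition _ S T m Tp :=
  Finite.copy (draw_label S T m Tp) (can_type (@label_codeK S T m Tp)).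

Section Draws.
Context {R : realType} {dOm : measure_display} {Om : measurableType dOm}.
Context {P : probability Om R} {dXi : measure_display} {Xi : measurableType dXi}.
Context {Q : probability Xi R} {b n S T m Tp : nat} {p : 'I_b -> R} {PR : 'I_T -> R}.
Variable D : draws (R := R) Om Xi b n S T.
Hypothesis D_law : draws_law P Q m Tp p PR D.
Local Notation label := (draw_label S T m Tp).

Definition draw_events (l : label) : set (set Om) := draw_sigma D l.
Local Notation G := draw_events.

Lemma draw_eventsT l : G l setT.
Proof.
by case: l => *; exists setT; rewrite ?setTI ?preimage_setT//; exact: measurableT.
Qed.

Lemma draw_eventsI l : setI_closed (G l).
Proof.
by case: l => [i k|i|i k t|i k t|k|k] _ _ [A mA <-] [B mB <-]; exists (A `&` B);
  rewrite ?setTI ?preimage_setI//; exact: measurableI.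
Qed.

Lemma draw_events_measurable l : G l `<=` measurable.
Proof. by case: D_law. Qed.

(** Independence is stated for injective finite families of labels; enumerating all labels gives one
    product formula, and smaller families are recovered with trivial events. *)
Lemma draw_events_indep (A : label -> set Om) : (forall l, G l (A l)) ->
  P (\bigcap_l A l) = (\prod_l P (A l))%E.
Proof.
move=> GA; have [_ [ind _]] := D_law.
pose e : 'I_#|{: label}| -> label := enum_val.
have := ind _ e (@enum_val_inj _ _) (A \o e) (fun r => GA (e r)).
rewrite (_ : \bigcap_(r in _) _ = \bigcap_l A l) => [->|].
  by rewrite [RHS](reindex _ (onW_bij _ (@enum_val_bij label))).
apply/seteqP; split => w h l _ /=; last exact: h.
by have := h (enum_rank l) Logic.I; rewrite /= /e enum_rankK.
Qed.

Local Notation sub J := (subspace_events G J).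
Local Notation gen := (measurable_subspace_gen draw_eventsT).

Lemma measurable_block_eq (J : pred label) i k s (kT : (k < T)%N) :
  J (LBlock _ _ i (Ordinal kT)) ->
  measurable (block D i k @^-1` [set s] : set (sub J)).
Proof.
move=> Jl; apply: sub_sigma_algebra; apply: (gen_events_sub draw_eventsT Jl).
by exists [set s] => //; rewrite setTI.
Qed.

Lemma measurable_stop_eq (J : pred label) i k : J (LStop _ _ _ i) ->
  measurable (stop D i @^-1` [set k] : set (sub J)).
Proof.
move=> Jl; apply: sub_sigma_algebra; apply: (gen_events_sub draw_eventsT Jl).
by exists [set k] => //; rewrite setTI.
Qed.

Lemma measurable_sample (J : pred label) i k t
    (kT : (k < T)%N) (tm : (t < m)%N) :
  J (LSample _ i (Ordinal kT) (Ordinal tm)) -> measurable_fun setT (sample D i k t : sub J -> Xi).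
Proof. by move=> Jl; apply: (gen Jl) => B mB; exists B; rewrite ?setTI. Qed.

Lemma measurable_dir (J : pred label) i k t
    (kT : (k < T)%N) (tm : (t < m)%N) :
  J (LDir _ i (Ordinal kT) (Ordinal tm)) -> measurable_fun setT (dir D i k t : sub J -> borel_rV R n).
Proof. by move=> Jl; apply: (gen Jl) => B mB; exists B; rewrite ?setTI. Qed.

Lemma measurable_post_sample (J : pred label) k (kTp : (k < Tp)%N) :
  J (LPostSample _ _ _ (Ordinal kTp)) -> measurable_fun setT (post_sample D k : sub J -> Xi).
Proof. by move=> Jl; apply: (gen Jl) => B mB; exists B; rewrite ?setTI. Qed.

Lemma measurable_post_dir (J : pred label) k (kTp : (k < Tp)%N) :
  J (LPostDir _ _ _ (Ordinal kTp)) -> measurable_fun setT (post_dir D k : sub J -> borel_rV R n).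
Proof. by move=> Jl; apply: (gen Jl) => B mB; exists B; rewrite ?setTI. Qed.

Lemma draws_indep_rv (J K : pred label) d1 (T1 : measurableType d1)
    d2 (T2 : measurableType d2) (X : Om -> T1) (Y : Om -> T2) :
  (forall l, ~~ (J l && K l)) ->
  measurable_fun setT (X : sub J -> T1) ->
  measurable_fun setT (Y : sub K -> T2) -> indep_rv P X Y.
Proof.
exact: (indep_rv_subspace draw_eventsT draw_eventsI draw_events_measurable
  draw_events_indep).
Qed.

Lemma measurable_draws (J : pred label) d' (T' : measurableType d') (X : Om -> T') :
  measurable_fun setT (X : sub J -> T') -> measurable_fun setT X.
Proof. exact: (measurable_subspace draw_events_measurable). Qed.

End Draws.

(** * Runs of the method *)

Section Run.
Context {R : realType} {dOm : measure_display} {Om : measurableType dOm}.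
Context {P : probability Om R} {dXi : measure_display} {Xi : measurableType dXi}.
Context {Q : probability Xi R} {b : nat} {nn : 'I_b -> nat} {S T m Tp : nat}.
Context {p : 'I_b -> R} {PR : 'I_T -> R}.
Local Notation n := (dim nn).
Local Notation V := 'rV[R]_n.
Variable D : draws (R := R) Om Xi b n S T.
Hypothesis D_law : draws_law P Q m Tp p PR D.
Hypothesis p_unif : forall s, p s = b%:R^-1.
Hypothesis PR_unif : forall k, PR k = T%:R^-1.
Variables (F : V -> Xi -> R) (g : V -> Xi -> V) (gbar : V -> V) (Dom : set V).
Variables (mu K s2 : R).
Hypothesis F_borel : measurable_fun setT
  (fun q : borel_rV R n * Xi => F q.1 q.2).
Hypothesis mu_gt0 : 0 < mu.
Hypothesis s2_ge0 : 0 <= s2.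
Hypothesis gE : forall x j, Q.-integrable setT (fun xi => (g x xi 0 j)%:E) /\
  (\int[Q]_xi (g x xi 0 j)%:E = (gbar x 0 j)%:E)%E.
Hypothesis g_taylor : forall x, {ae Q, forall xi, forall h,
  `|F (x + h) xi - F x xi - dot (g x xi) h| <= K / 2 * dot h h}.
Hypothesis g_moment2 : forall x, Dom x ->
  (\int[Q]_xi (dot (g x xi) (g x xi))%:E <= s2%:E)%E.
Hypothesis mgbar : measurable_fun setT (gbar : borel_rV R n -> borel_rV R n).

Definition blk s (z : V) : R := dot (z *m U R nn s) (z *m U R nn s).

Variables (step : 'I_b -> V -> V -> V) (obj : V -> R) (calP : V -> V).
Variables (a delta low : R) (x1 : V).
Hypothesis a_gt0 : 0 < a.
Hypothesis delta_ge0 : 0 <= delta.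
Hypothesis step_dom : forall s x G, Dom x -> Dom (step s x G).
Hypothesis step_descent : forall s x G, Dom x ->
  obj (step s x G) + a / 4 * blk s (calP x) <=
  obj x + 3 / 2 * a * blk s (G - gbar x) + 2 * delta.
Hypothesis measurable_step : forall d (Z : measurableType d) s (x G : Z -> V),
  measurable_fun setT (x : Z -> borel_rV R n) ->
  measurable_fun setT (G : Z -> borel_rV R n) -> (forall w, Dom (x w)) ->
  measurable_fun setT ((fun w => step s (x w) (G w)) : Z -> borel_rV R n).
Hypothesis measurable_calP : forall d (Z : measurableType d) (x : Z -> V),
  measurable_fun setT (x : Z -> borel_rV R n) -> (forall w, Dom (x w)) ->
  measurable_fun setT ((fun w => calP (x w)) : Z -> borel_rV R n).
Hypothesis x1_dom : Dom x1.
Hypothesis obj_low : forall x, Dom x -> low <= obj x.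
Hypothesis b_gt0 : (0 < b)%N.
Hypothesis T_gt0 : (0 < T)%N.
Hypothesis m_gt0 : (0 < m)%N.

Local Notation label := (draw_label S T m Tp).
Local Notation sub J := (subspace_events (@draw_events R _ Om _ Xi b n S T m Tp D) J).
Local Notation beta := (smoothing_bias n mu K).
Local Notation A := (oracle_moment n mu K s2).

Definition batch_mean i k x w : V :=
  m%:R^-1 *: \sum_(t < m) (((F (x + mu *: dir D i k t w) (sample D i k t w)
    - F x (sample D i k t w)) / mu) *: dir D i k t w).

(** The run is analysed for any measurable [step] that preserves [Dom] and satisfies the descent
    inequality; [opt_runE] identifies the actual method as an instance. *)
Fixpoint iterate (i : 'I_S) (k : nat) (w : Om) : V :=
  if k is k'.+1 then
    step (block D i k' w) (iterate i k' w) (batch_mean i k' (iterate i k' w) w)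
  else x1.

(* The draws made before sample t of step k in run i *)
Definition past (i : 'I_S) (k t : nat) (l : label) : bool :=
  match l with
  | LBlock i' k' => (i' == i) && (k' < k)%N
  | LSample i' k' t' | LDir i' k' t' =>
      (i' == i) && ((k' < k) || (k' == k :> nat) && (t' < t))%N
  | _ => false
  end.

Definition run_label (i : 'I_S) (l : label) : bool :=
  match l with
  | LBlock i' _ | LStop i' | LSample i' _ _ | LDir i' _ _ => i' == i
  | _ => false
  end.

Definition draw_at (i : 'I_S) (k t : nat) (l : label) : bool :=
  match l with
  | LSample i' k' t' | LDir i' k' t' => [&& i' == i, k' == k :> nat & t' == t :> nat]
  | _ => false
  end.

Lemma iterate_dom i k w : Dom (iterate i k w).
Proof. by elim: k => //= k IH; exact: step_dom. Qed.

Lemma past_mono i k k' t t' l :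
  (k <= k')%N -> ((k < k')%N || (t <= t')%N) -> past i k t l -> past i k' t' l.
Proof. by case: l => //= i' => [k0|k0 t0|k0 t0] *; lia. Qed.

Lemma measurable_batch_mean (J : pred label) i k (x : Om -> V) : (k < T)%N ->
  measurable_fun setT (x : sub J -> borel_rV R n) ->
  (forall l, past i k m l -> J l) ->
  measurable_fun setT ((fun w => batch_mean i k (x w) w) : sub J -> borel_rV R n).
Proof.
move=> kT mx pJ; apply: measurable_rVZ; first exact: measurable_cst.
apply: measurable_rV_sum => t; apply: (measurable_Gmu mu F_borel mx).
  by apply: (measurable_dir (kT := kT) (tm := ltn_ord t)); apply: pJ => /=; rewrite !eqxx ltn_ord orbT.
by apply: (measurable_sample (kT := kT) (tm := ltn_ord t)); apply: pJ => /=; rewrite !eqxx ltn_ord orbT.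
Qed.

(** Adaptedness: the iterate is a function of the draws of earlier steps, hence independent of the
    block and of the samples of step k. *)
Lemma measurable_iterate i k : (k <= T)%N ->
  measurable_fun setT (iterate i k : sub (past i k 0) -> borel_rV R n).
Proof.
elim: k => [_|k IH kT]; first exact: measurable_cst.
have mk : measurable_fun setT (iterate i k : sub (past i k.+1 0) -> borel_rV R n).
  apply: (measurable_subspace_mono _ (IH (ltnW kT))).
  by move=> l; apply: past_mono => //; rewrite ltnSn.
pose h s w := step s (iterate i k w) (batch_mean i k (iterate i k w) w).
apply: (measurable_finite_choice (T := sub (past i k.+1 0)) (T' := borel_rV R n) (c := block D i k) (h := h)).
  have Jk : past i k.+1 0 (LBlock _ _ i (Ordinal kT)) by rewrite /= eqxx ltnSn.
  by move=> s; exact: (measurable_block_eq s Jk).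
move=> s; apply: measurable_step => // [|w]; last exact: iterate_dom.
apply: measurable_batch_mean => // l.
by apply: past_mono => //; rewrite ltnSn.
Qed.

Definition step_error i k w : V :=
  batch_mean i k (iterate i k w) w - gbar (iterate i k w).

Section OneStep.
Variables (i : 'I_S) (k : nat).
Hypothesis kT : (k < T)%N.
Local Notation ko := (Ordinal kT).
Local Notation x := (iterate i k).

Let mx (J : pred label) : (forall l, past i k 0 l -> J l) ->
  measurable_fun setT (x : sub J -> borel_rV R n).
Proof.
by move=> pJ; apply: (measurable_subspace_mono pJ); exact: measurable_iterate (ltnW kT).
Qed.

Lemma step_error_moment2 :
  (\int[P]_w (dot (step_error i k w) (step_error i k w))%:E
    <= (2 * (A / m%:R) + 2 * beta)%:E)%E.
Proof.
have [_ [_ [[_ _ Zlaw Ylaw] _]]] := D_law.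
have mxT : measurable_fun setT (x : Om -> borel_rV R n).
  exact: (measurable_draws D_law (mx (J := xpredT) (fun _ _ => isT))).
have mZ (J : pred label) t (tm : (t < m)%N) : J (LSample _ i ko (Ordinal tm)) ->
  measurable_fun setT (sample D i k t : sub J -> Xi) by exact: measurable_sample.
have mY (J : pred label) t (tm : (t < m)%N) : J (LDir _ i ko (Ordinal tm)) ->
  measurable_fun setT (dir D i k t : sub J -> borel_rV R n) by exact: measurable_dir.
have mZT t : (t < m)%N -> measurable_fun setT (sample D i k t).
  by move=> tm; apply: (measurable_draws D_law (mZ xpredT t tm isT)).
have mYT t : (t < m)%N -> measurable_fun setT (dir D i k t : Om -> borel_rV R n).
  by move=> tm; apply: (measurable_draws D_law (mY xpredT t tm isT)).
apply: (batch_error_moment2 (Z := sample D i k) (Y := dir D i k) F_borel mu_gt0 s2_ge0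
  gE g_taylor g_moment2 mgbar mZT mYT _ _ _ mxT (iterate_dom i k) _ m_gt0).
- by move=> t tm B mB; exact: (Zlaw i ko (Ordinal tm)).
- by move=> t tm; exact: (Ylaw i ko (Ordinal tm)).
- move=> t tm; apply: (draws_indep_rv D_law (J := pred1 (LSample _ i ko (Ordinal tm)))
    (K := pred1 (LDir _ i ko (Ordinal tm)))).
  + by move=> l; apply/negP => /andP[/eqP-> /eqP].
  + by apply: (mZ _ t tm); rewrite /= eqxx.
  + by apply: (mY _ t tm); rewrite /= eqxx.
(* The iterate and the first t summands belong to the draws before sample t, which are disjoint from
   the sample and direction numbered t. *)
- move=> t tm; apply: (draws_indep_rv D_law (J := past i k t) (K := draw_at i k t)).
  + by case => [i' k'|i'|i' k' t'|i' k' t'|k'|k'] /=; apply/negP; lia.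
  + apply: measurable_fun_pair.
      by apply: mx => l; apply: past_mono => //; rewrite orbT.
    apply: (measurable_fluct mu F_borel P mZT mYT (i := id : sub (past i k t) -> Om) (ltnW tm)).
    * by apply: mx => l; apply: past_mono => //; rewrite orbT.
    * move=> t' t't; apply: (mZ _ t' (ltn_trans t't tm)).
      by rewrite /= !eqxx t't orbT.
    * move=> t' t't; apply: (mY _ t' (ltn_trans t't tm)).
      by rewrite /= !eqxx t't orbT.
  + apply: measurable_fun_pair.
      by apply: (mZ _ t tm); rewrite /= !eqxx.
    by apply: (mY _ t tm); rewrite /= !eqxx.
Qed.

(** [past i k m] contains all the samples of step k but not its block index. The whole batch may
    thus be treated as drawn before the block, and a uniform block picks out 1/b of the squared
    norm. *)
Lemma integral_random_block (z : Om -> V) :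
  measurable_fun setT (z : sub (past i k m) -> borel_rV R n) ->
  (\int[P]_w (blk (block D i k w) (z w))%:E
    = (b%:R^-1)%:E * \int[P]_w (dot (z w) (z w))%:E)%E.
Proof.
move=> mz; have [_ [_ [[blaw _ _ _] _]]] := D_law.
have mblk s : measurable_fun setT ((fun w => blk s (z w)) : sub (past i k m) -> R).
  by apply: measurable_dot; exact: measurable_rV_mulmx.
have mblkT s : measurable_fun setT (fun w => blk s (z w)).
  exact: (measurable_draws D_law (mblk s)).
have me s : measurable (block D i k @^-1` [set s]).
  apply: (sigma_events_measurable (draw_events_measurable D_law) (J := xpredT)).
  exact: (measurable_block_eq (J := xpredT) s (kT := kT) isT).
rewrite (integral_finite_choice (c := block D i k) (p := b%:R^-1) (h := fun s w => blk s (z w))).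
- rewrite -ge0_sume_distrr; last by move=> s _; apply: integral_ge0 => w _; rewrite lee_fin dot_ge0.
  rewrite -ge0_integral_sumr//; last by move=> s w; exact: dot_ge0.
  congr (_ * _)%E; apply: eq_integral => w _.
  by rewrite (dot_blocks (z w)).
- by move=> s; rewrite -(p_unif s); exact: (blaw i ko s).
- exact: me.
- exact: mblkT.
- by move=> s w; exact: dot_ge0.
- move=> s; apply: (draws_indep_rv D_law (J := pred1 (LBlock _ _ i ko)) (K := past i k m)).
  + case => //= i' k'; apply/negP => /andP[/eqP[-> ->]]; rewrite eqxx/=; lia.
  + rewrite (_ : (fun w => _) = \1_(block D i k @^-1` [set s])).
      apply: measurable_indic.
      have Jk : pred1 (LBlock _ _ i ko : label) (LBlock _ _ i ko) by rewrite /= eqxx.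
      exact: (measurable_block_eq s Jk).
    apply/funext => w; rewrite indicE; congr (nat_of_bool _)%:R.
    by apply/eqP/idP => [ci|]; [apply/mem_set|move/set_mem].
  + exact: mblk.
Qed.

End OneStep.

Local Notation N := (2 * (A / m%:R) + 2 * beta).

(* The descent inequality is summed path by path; only then is the expectation
   taken, where the uniform index i_k, independent of x_k and of the samples of
   step k, turns the square of one block into 1/b of the whole square. *)
Lemma sum_calP_moment2 i :
  (\sum_(k < T) \int[P]_w (dot (calP (iterate i k w)) (calP (iterate i k w)))%:E
    <= (4 * b%:R / a * (obj x1 - low + 2 * delta * T%:R) + 6 * T%:R * N)%:E)%E.
Proof.
pose q k w := blk (block D i k w) (calP (iterate i k w)).
pose e k w := blk (block D i k w) (step_error i k w).
have tele k w : obj (iterate i k w) + a / 4 * \sum_(j < k) q j w <=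
    obj x1 + 3 / 2 * a * \sum_(j < k) e j w + 2 * delta * k%:R.
  elim: k => [|k IH]; first by rewrite !big_ord0 !mulr0 !addr0.
  rewrite !big_ord_recr/= -[k.+1%:R]natr1.
  have := step_descent (block D i k w) (batch_mean i k (iterate i k w) w) (iterate_dom i k w).
  rewrite -/(step_error i k w) -/(q k w) -/(e k w); move: IH.
  set h := obj (iterate i k w); set h' := obj (step _ _ _); lra.
have c0 : 0 <= 4 / a by rewrite divr_ge0// ltW.
have bnd w : \sum_(j < T) q j w <=
    4 / a * (obj x1 - low + 2 * delta * T%:R) + 6 * \sum_(j < T) e j w.
  have := tele T w; have := obj_low (iterate_dom i T w).
  set h := obj (iterate i T w) => h1 h2.
  have h3 : a / 4 * \sum_(j < T) q j w <=
      (obj x1 - low + 2 * delta * T%:R) + 3 / 2 * a * \sum_(j < T) e j w by lra.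
  have := ler_wpM2l c0 h3.
  have a1 : 4 / a * (a / 4) = 1 by field; rewrite gt_eqF.
  have a2 : 4 / a * (3 / 2 * a) = 6 by field; rewrite gt_eqF.
  by rewrite mulrA a1 mul1r mulrDr mulrA a2.
have mit (J : pred label) (k : 'I_T) : (forall l, past i k 0 l -> J l) ->
    measurable_fun setT (iterate i k : sub J -> borel_rV R n).
  move=> pJ; apply: (measurable_subspace_mono pJ).
  exact: measurable_iterate (ltnW (ltn_ord k)).
have pm (k : 'I_T) l : past i k 0 l -> past i k m l by apply: past_mono; rewrite ?orbT.
have mcal (k : 'I_T) : measurable_fun setT
    ((fun w => calP (iterate i k w)) : sub (past i k m) -> borel_rV R n).
  by apply: measurable_calP => [|w]; [exact: mit (pm k)|exact: iterate_dom].
have merr (k : 'I_T) : measurable_fun setT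
    ((fun w => step_error i k w) : sub (past i k m) -> borel_rV R n).
  apply: measurable_rVB.
    by apply: (measurable_batch_mean (ltn_ord k)) => //; exact: mit (pm k).
  exact: (measurableT_comp mgbar (mit _ _ (pm k))).
have mblk (k : 'I_T) (z : Om -> V) :
    measurable_fun setT (z : sub (past i k m) -> borel_rV R n) ->
    measurable_fun setT (fun w => blk (block D i k w) (z w)).
  move=> /(measurable_draws D_law) mz.
  apply: (measurable_finite_choice (c := block D i k) (h := fun s w => blk s (z w))).
    move=> s; apply: (sigma_events_measurable (draw_events_measurable D_law) (J := xpredT)).
    exact: (measurable_block_eq (J := xpredT) s (kT := ltn_ord k) isT).
  by move=> s; apply: measurable_dot; exact: measurable_rV_mulmx.
have mq (k : 'I_T) := mblk k _ (mcal k); have me (k : 'I_T) := mblk k _ (merr k).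
have blk0 s z : 0 <= blk s z by exact: dot_ge0.
have b0 : 0 < b%:R :> R by rewrite ltr0n.
pose Mk (k : 'I_T) := (\int[P]_w (dot (calP (iterate i k w)) (calP (iterate i k w)))%:E)%E.
have Mk0 k : (0 <= Mk k)%E by apply: integral_ge0 => w _; rewrite lee_fin dot_ge0.
have Eq (k : 'I_T) : (\int[P]_w (q k w)%:E = (b%:R^-1)%:E * Mk k)%E.
  exact: (integral_random_block (ltn_ord k) (mcal k)).
have Ee (k : 'I_T) : (\int[P]_w (e k w)%:E <= (b%:R^-1 * N)%:E)%E.
  rewrite (integral_random_block (ltn_ord k) (merr k)) EFinM.
  apply: lee_wpmul2l; first by rewrite lee_fin invr_ge0 ltW.
  exact: step_error_moment2.
set C := 4 / a * (obj x1 - low + 2 * delta * T%:R) in bnd *.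
have C0 : 0 <= C.
  by rewrite mulr_ge0// addr_ge0 ?subr_ge0 ?obj_low// !mulr_ge0.
have q0 (k : 'I_T) w : 0 <= q k w by exact: blk0.
have e0 (k : 'I_T) w : 0 <= e k w by exact: blk0.
have mS : measurable_fun setT (fun w => \sum_(j < T) e j w) by exact: measurable_sum.
have mS6 : measurable_fun setT (fun w => 6 * \sum_(j < T) e j w).
  by apply: measurable_funM => //; exact: measurable_cst.
have S0 w : 0 <= \sum_(j < T) e j w by apply: sumr_ge0 => j _; exact: e0.
have : (\int[P]_w (\sum_(j < T) q j w)%:E <=
    \int[P]_w (C + 6 * \sum_(j < T) e j w)%:E)%E.
  apply: ge0_le_integralr => //.
  - exact: measurable_sum.
  - by apply: measurable_funD => //; exact: measurable_cst.
  - by move=> w; apply: sumr_ge0 => j _; exact: q0.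
rewrite ge0_integral_sumr//.
rewrite (eq_bigr _ (fun k _ => Eq k)) -ge0_sume_distrr//.
rewrite ge0_integralDr//; last by move=> w; rewrite mulr_ge0.
rewrite integral_cst_probability ge0_integralZ// ge0_integral_sumr//.
set M := (\sum_(k < T) Mk k)%E => h.
have {}h : ((b%:R^-1)%:E * M <= (C + 6 * (T%:R * (b%:R^-1 * N)))%:E)%E.
  apply: le_trans h _.
  have -> : ((C + 6 * (T%:R * (b%:R^-1 * N)))%:E = C%:E + 6%:E * (T%:R * (b%:R^-1 * N))%:E)%E.
    by rewrite -EFinM -EFinD.
  apply: leeD => //; rewrite lee_wpmul2l ?lee_fin//.
  apply: le_trans (lee_sum _ (fun k _ => Ee k)) _.
  by rewrite sumEFin lee_fin sumr_const card_ord -[leLHS]mulr_natl.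
have := lee_wpmul2l (_ : 0 <= (b%:R : R)%:E)%E h.
rewrite muleA -!EFinM mulfV ?gt_eqF// mul1e => {}h.
apply: le_trans (h _) _; first by rewrite lee_fin ltW.
rewrite lee_fin le_eqVlt; apply/orP; left; apply/eqP.
by rewrite /C; set NN := N; field; rewrite !gt_eqF.
Qed.

Definition run_output i w : V := iterate i (stop D i w) w.

Lemma run_output_dom i w : Dom (run_output i w).
Proof. exact: iterate_dom. Qed.

Lemma measurable_run_output i :
  measurable_fun setT (run_output i : sub (run_label i) -> borel_rV R n).
Proof.
apply: (measurable_finite_choice (T := sub (run_label i)) (T' := borel_rV R n)
  (c := stop D i) (h := fun k w => iterate i k w)).
  have Jl : run_label i (LStop _ _ _ i) by rewrite /= eqxx.
  by move=> k; exact: (measurable_stop_eq k Jl).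
move=> k; have mk := measurable_iterate (i := i) (ltnW (ltn_ord k)).
apply: (measurable_subspace_mono _ mk).
by case => //= [i' k'|i' k' t'|i' k' t'] /andP[].
Qed.

(** The stopping index is uniform and independent of every iterate, so the moment at the output is
    the average of the moments over the T steps. *)
Lemma run_output_moment2 i :
  (\int[P]_w (dot (calP (run_output i w)) (calP (run_output i w)))%:E
    <= (4 * b%:R / a * (obj x1 - low + 2 * delta * T%:R) / T%:R + 6 * N)%:E)%E.
Proof.
have [_ [_ [[_ slaw _ _] _]]] := D_law.
have mcal (k : 'I_T) (J : pred label) : (forall l, past i k 0 l -> J l) ->
    measurable_fun setT ((fun w => calP (iterate i k w)) : sub J -> borel_rV R n).
  move=> pJ; apply: measurable_calP => [|w]; last exact: iterate_dom.
  apply: (measurable_subspace_mono pJ).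
  exact: measurable_iterate (ltnW (ltn_ord k)).
have msq (k : 'I_T) (J : pred label) : (forall l, past i k 0 l -> J l) ->
    measurable_fun setT ((fun w => dot (calP (iterate i k w)) (calP (iterate i k w))) : sub J -> R).
  by move=> pJ; apply: measurable_dot; exact: mcal.
have T0 : 0 < T%:R :> R by rewrite ltr0n.
rewrite (integral_finite_choice (c := stop D i) (p := T%:R^-1)
  (h := fun k w => dot (calP (iterate i k w)) (calP (iterate i k w)))).
- rewrite -ge0_sume_distrr; last first.
    by move=> k _; apply: integral_ge0 => w _; rewrite lee_fin dot_ge0.
  apply: le_trans (lee_wpmul2l _ (sum_calP_moment2 i)) _.
    by rewrite lee_fin invr_ge0 ltW.
  rewrite -EFinM lee_fin le_eqVlt; apply/orP; left; apply/eqP.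
  by set NN := N; field; rewrite !gt_eqF.
- by move=> k; rewrite -(PR_unif k); exact: slaw.
- move=> k; apply: (sigma_events_measurable (draw_events_measurable D_law) (J := xpredT)).
  exact: (measurable_stop_eq (J := xpredT) k isT).
- by move=> k; apply: (measurable_draws D_law (msq k xpredT _)).
- by move=> k w; exact: dot_ge0.
- move=> k; apply: (draws_indep_rv D_law (J := pred1 (LStop _ _ _ i)) (K := past i k 0)).
  + by case => [i' k'|i'|i' k' t'|i' k' t'|k'|k'] //=; rewrite andbF.
  + rewrite (_ : (fun w => _) = \1_(stop D i @^-1` [set k])).
      apply: measurable_indic.
      have Jl : pred1 (LStop _ _ _ i : label) (LStop _ _ _ i) by rewrite /= eqxx.
      exact: (measurable_stop_eq k Jl).
    apply/funext => w; rewrite indicE; congr (nat_of_bool _)%:R.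
    by apply/eqP/idP => [ci|]; [apply/mem_set|move/set_mem].
  + exact: msq.
Qed.

Lemma all_runs_tail (t B : R) : 0 < t ->
  (forall i, \int[P]_w (dot (calP (run_output i w)) (calP (run_output i w)))%:E <= B%:E)%E ->
  (P (\big[setI/setT]_(i <- enum 'I_S)
      [set w | (t < dot (calP (run_output i w)) (calP (run_output i w)))%R])
    <= ((B / t) ^+ S)%:E)%E.
Proof.
move=> t0 hB; pose E i := [set w | t < dot (calP (run_output i w)) (calP (run_output i w))].
have msq i : measurable_fun setT
    ((fun w => dot (calP (run_output i w)) (calP (run_output i w))) : sub (run_label i) -> R).
  have mc : measurable_fun setT ((fun w => calP (run_output i w)) : sub (run_label i) -> borel_rV R n).
    by apply: measurable_calP => [|w]; [exact: measurable_run_output|exact: run_output_dom].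
  exact: measurable_dot.
have EJ i : measurable (E i : set (sub (run_label i))).
  have mt : measurable_fun setT ((fun w => t < dot (calP (run_output i w)) (calP (run_output i w)))
      : sub (run_label i) -> bool).
    by apply: measurable_fun_ltr => //; exact: measurable_cst.
  by have := mt measurableT [set true] I; rewrite setTI.
have Ele i : (P (E i) <= (B / t)%:E)%E.
  apply: (markov_ge0 (measurable_draws D_law (msq i)) _ t0 (hB i)).
  by move=> w; exact: dot_ge0.
rewrite (sigma_events_prod (draw_eventsT D) (draw_eventsI (D := D))
  (draw_events_measurable D_law) (draw_events_indep D_law) (J := run_label)) ?enum_uniq//; last first.
  move=> i j l /negP ij; apply/negP.
  by case: l => [i' k'|i'|i' k' t'|i' k' t'|k'|k'] //= /andP[/eqP e1 /eqP e2];
    apply: ij; rewrite -e1 -e2.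
rewrite -[in leRHS](size_enum_ord S); elim: (enum 'I_S) => [|i r IH].
  by rewrite big_nil expr0.
rewrite big_cons /= exprS EFinM; apply: lee_pmul => //.
  by apply: prode_ge0 => j _.
exact: Ele.
Qed.

Definition post_past (t : nat) (l : label) : bool :=
  match l with
  | LPostSample k | LPostDir k => (k < t)%N
  | _ => true
  end.

Definition post_at (t : nat) (l : label) : bool :=
  match l with
  | LPostSample k | LPostDir k => k == t :> nat
  | _ => false
  end.

Definition post_error i w : V :=
  Tp%:R^-1 *: \sum_(t < Tp) (((F (run_output i w + mu *: post_dir D t w) (post_sample D t w)
    - F (run_output i w) (post_sample D t w)) / mu) *: post_dir D t w)
  - gbar (run_output i w).

(** The output of run i uses no draw of the second phase, so the samples are fresh for it and the
    batch estimates apply. The bad set concerns the fluctuation alone, the bias being bounded on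
    every path. The sets of different runs share samples and are not independent. *)
Lemma post_error_tail i (t : R) : 0 < t -> (0 < Tp)%N ->
  exists2 B : set Om, measurable B /\ (P B <= (A / (Tp%:R * t))%:E)%E &
    forall w, ~ B w -> dot (post_error i w) (post_error i w) <= 2 * t + 2 * beta.
Proof.
move=> t0 Tp0; have [_ [_ [_ [Zlaw Ylaw]]]] := D_law.
have mZ (J : pred label) k (kTp : (k < Tp)%N) : J (LPostSample _ _ _ (Ordinal kTp)) ->
  measurable_fun setT (post_sample D k : sub J -> Xi) by exact: measurable_post_sample.
have mY (J : pred label) k (kTp : (k < Tp)%N) : J (LPostDir _ _ _ (Ordinal kTp)) ->
  measurable_fun setT (post_dir D k : sub J -> borel_rV R n) by exact: measurable_post_dir.
have mZT k : (k < Tp)%N -> measurable_fun setT (post_sample D k).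
  by move=> km; apply: (measurable_draws D_law (mZ xpredT k km isT)).
have mYT k : (k < Tp)%N -> measurable_fun setT (post_dir D k : Om -> borel_rV R n).
  by move=> km; apply: (measurable_draws D_law (mY xpredT k km isT)).
have Zl k : (k < Tp)%N -> forall B, measurable B -> P (post_sample D k @^-1` B) = Q B.
  by move=> km B mB; exact: (Zlaw (Ordinal km)).
have Yl k : (k < Tp)%N -> std_gaussian P (post_dir D k).
  by move=> km; exact: (Ylaw (Ordinal km)).
have ind k : (k < Tp)%N -> indep_rv P (post_sample D k) (post_dir D k : Om -> borel_rV R n).
  move=> km; apply: (draws_indep_rv D_law (J := pred1 (LPostSample _ _ _ (Ordinal km)))
    (K := pred1 (LPostDir _ _ _ (Ordinal km)))).
  - by move=> l; apply/negP => /andP[/eqP-> /eqP].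
  - by apply: (mZ _ k km); rewrite /= eqxx.
  - by apply: (mY _ k km); rewrite /= eqxx.
have mx (J : pred label) : (forall l, run_label i l -> J l) ->
    measurable_fun setT (run_output i : sub J -> borel_rV R n).
  by move=> pJ; apply: (measurable_subspace_mono pJ); exact: measurable_run_output.
have mxT : measurable_fun setT (run_output i : Om -> borel_rV R n).
  exact: (measurable_draws D_law (mx xpredT (fun _ _ => isT))).
have rp k l : run_label i l -> post_past k l.
  by case: l.
have xind k : (k < Tp)%N -> indep_rv P
    (fun w => (run_output i w : borel_rV R n,
      fluct F mu P (post_sample D) (post_dir D) (run_output i) k w : borel_rV R n))
    (fun w => (post_sample D k w, post_dir D k w : borel_rV R n)).
  move=> km; apply: (draws_indep_rv D_law (J := post_past k) (K := post_at k)).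
  - by case => [i' k'|i'|i' k' t'|i' k' t'|k'|k'] /=; apply/negP; lia.
  - apply: measurable_fun_pair; first exact: mx (rp k).
    apply: (measurable_fluct mu F_borel P mZT mYT (i := id : sub (post_past k) -> Om) (ltnW km)).
    + exact: mx (rp k).
    + by move=> k' k'k; apply: (mZ _ k' (ltn_trans k'k km)).
    + by move=> k' k'k; apply: (mY _ k' (ltn_trans k'k km)).
  - apply: measurable_fun_pair.
      by apply: (mZ _ k km); rewrite /= eqxx.
    by apply: (mY _ k km); rewrite /= eqxx.
pose fl w := fluct F mu P (post_sample D) (post_dir D) (run_output i) Tp w.
exists [set w | (t < Tp%:R ^- 2 * dot (fl w) (fl w))%R].
  split; last exact: (fluct_tail F_borel mu_gt0 s2_ge0 gE g_taylor g_moment2 mZT mYT Zl Yl ind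
    mxT (run_output_dom i) xind Tp0 t0).
  have mfl : measurable_fun setT (fl : Om -> borel_rV R n).
    apply: (measurable_fluct mu F_borel P mZT mYT (i := id) (leqnn _) mxT) => k km.
      exact: mZT.
    exact: mYT.
  have mt : measurable_fun setT (fun w => t < Tp%:R ^- 2 * dot (fl w) (fl w)).
    apply: measurable_fun_ltr; first exact: measurable_cst.
    by apply: measurable_funM; [exact: measurable_cst|exact: measurable_dot].
  by have := mt measurableT [set true] I; rewrite setTI.
move=> w /negP; rewrite -leNgt => le1.
apply: le_trans (batch_error_le F_borel mu_gt0 gE g_taylor g_moment2 mZT mYT Zl Yl ind
  (run_output_dom i) Tp0 w) _.
by rewrite lerD2r ler_pM2l.
Qed.

(* The bad event is covered by [E1] (every run outputs a point with a large
   gradient) and [E2] (some estimate of the second phase is far off). *)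
Lemma two_phase_tail (xs : Om -> V) (eps t B : R) : 0 < eps -> 0 < t -> (0 < Tp)%N ->
  t + beta <= eps / 32 ->
  (forall i, \int[P]_w (dot (calP (run_output i w)) (calP (run_output i w)))%:E <= B%:E)%E ->
  measurable_fun setT (xs : Om -> borel_rV R n) ->
  (forall w, exists i, xs w = run_output i w /\
    forall j, dot (calP (xs w)) (calP (xs w)) <=
      2 * dot (calP (run_output j w)) (calP (run_output j w))
      + 4 * (dot (post_error i w) (post_error i w) + dot (post_error j w) (post_error j w))) ->
  (P [set w | (eps < dot (calP (xs w)) (calP (xs w)))%R]
    <= ((B / (eps / 4)) ^+ S + S%:R * (A / (Tp%:R * t)))%:E)%E.
Proof.
move=> eps0 t0 Tp0 tb hB mxs xsP.
have /choice[Bad BadP] : forall i, exists B : set Om,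
    (measurable B /\ (P B <= (A / (Tp%:R * t))%:E)%E) /\
    forall w, ~ B w -> dot (post_error i w) (post_error i w) <= 2 * t + 2 * beta.
  by move=> i; have [B' ? ?] := post_error_tail i t0 Tp0; exists B'.
pose E i := [set w | eps / 4 < dot (calP (run_output i w)) (calP (run_output i w))].
have mlt (f : Om -> R) c : measurable_fun setT f -> measurable [set w | c < f w].
  move=> mf; have mt : measurable_fun setT (fun w => c < f w).
    by apply: measurable_fun_ltr => //; exact: measurable_cst.
  by have := mt measurableT [set true] I; rewrite setTI.
have mE i : measurable (E i).
  apply: mlt; have mc : measurable_fun setT ((fun w => calP (run_output i w)) : Om -> borel_rV R n).
    apply: measurable_calP => [|w]; last exact: run_output_dom.
    exact: (measurable_draws D_law (measurable_run_output (i := i))).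
  exact: measurable_dot.
pose E1 := \big[setI/setT]_(i <- enum 'I_S) E i.
pose E2 := \big[setU/set0]_(i <- enum 'I_S) Bad i.
have mE1 : measurable E1 by apply: big_ind => //; exact: measurableI.
have mE2 : measurable E2 by apply: bigsetU_measurable => i _; exact: (BadP i).1.1.
have sub12 : [set w | eps < dot (calP (xs w)) (calP (xs w))] `<=` E1 `|` E2.
  move=> w /= bad; have [//|/not_orP[nE1 nE2]] := pselect ((E1 `|` E2) w).
  have good i : dot (post_error i w) (post_error i w) <= 2 * t + 2 * beta.
    by apply: (BadP i).2 => Bi; apply: nE2; rewrite /E2 -bigcup_seq; exists i; rewrite //= mem_enum.
  have [i [_ xsi]] := xsP w.
  have [j nj] : exists j, ~ E j w.
    apply/existsNP => allE; apply: nE1; rewrite /E1 -bigcap_seq => j _; exact: allE.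
  have {}nj : dot (calP (run_output j w)) (calP (run_output j w)) <= eps / 4.
    by rewrite leNgt; apply/negP.
  (* With the competitor below eps/4, the bound is 2 (eps/4) + 4 * 2 * (2 t + 2 beta) = eps/2 + 16
     (t + beta) <= eps, as t + beta <= eps/32. *)
  have := xsi j; have := good i; have := good j; lra.
have mbad : measurable [set w | eps < dot (calP (xs w)) (calP (xs w))].
  apply: mlt; have mc : measurable_fun setT ((fun w => calP (xs w)) : Om -> borel_rV R n).
    apply: measurable_calP => // w; have [i [-> _]] := xsP w; exact: run_output_dom.
  exact: measurable_dot.
have t4 : 0 < eps / 4 by rewrite divr_gt0.
apply: le_trans (le_measure P _ _ sub12) _; rewrite ?inE//; first exact: measurableU.
apply: le_trans (measureU2 P mE1 mE2) _; rewrite EFinD; apply: leeD.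
  exact: all_runs_tail.
rewrite /E2 -[in S%:R](size_enum_ord S); elim: (enum 'I_S) => [|i r IH].
  by rewrite big_nil measure0 mul0r.
rewrite big_cons /= -natr1 mulrDl mul1r addrC EFinD.
apply: le_trans (measureU2 P _ _) _; first exact: (BadP i).1.1.
  by apply: bigsetU_measurable => j _; exact: (BadP j).1.1.
by apply: leeD => //; exact: (BadP i).1.2.
Qed.

End Run.

(** * Choice of the parameters *)

Section ParameterArithmetic.
Context {R : realType}.

Lemma nceil_ge (x : R) : x <= (nceil x)%:R.
Proof.
apply: le_trans (ceil_ge x) _; rewrite -[(nceil x)%:R]/((nceil x)%:Z%:~R) ler_int.
by rewrite /nceil abszE ler_norm.
Qed.

Lemma nceil_le (x : R) (k : nat) : 0 <= x -> x <= k%:R -> (nceil x <= k)%N.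
Proof.
move=> x0 xk; rewrite /nceil -lez_nat abszE ger0_norm; last first.
  by rewrite -(ler_int R) (le_trans x0)// ceil_ge.
by rewrite ceil_le_int.
Qed.

Lemma nceil_lt (x : R) : 0 <= x -> (nceil x)%:R < x + 1.
Proof.
move=> x0; rewrite -ltrBlDr; have := gt_pred_ceil x.
rewrite intrB /nceil -[X in _ -> X - _ < _]/((Posz _)%:~R) abszE ger0_norm//.
by rewrite -(ler_int R) (le_trans x0)// ceil_ge.
Qed.

Variables (om n4 v c D Lf Dt eps b Tt : R).
Hypotheses (om3 : 3 <= om) (n4_4 : 4 <= n4) (v0 : 0 <= v) (c0 : 0 < c) (Dt0 : 0 < Dt).
Hypotheses (eps0 : 0 < eps) (b1 : 1 <= b) (Tt0 : 0 < Tt).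
Hypothesis Tt3 : 8 ^+ 2 * om * b * n4 * (17 * Lf ^+ 2 * D ^+ 2 + 8 * c) / eps <= Tt.
Hypothesis Tt4 : b ^+ 2 * om ^+ 2 *
  (8 * 32 * Num.sqrt (n4 * v) / eps * (2 * Dt + c / Dt)) ^+ 2 <= Tt.
Local Notation q := (Num.max (om * Num.sqrt (n4 * v * Tt) / Dt) (om * n4)).
Local Notation y := (Num.sqrt (n4 * v)).
Local Notation tau := (Num.sqrt Tt).

Let n4_gt0 : 0 < n4. Proof. exact: lt_le_trans n4_4. Qed.
Let om_gt0 : 0 < om. Proof. exact: lt_le_trans om3. Qed.
Let b_gt0 : 0 < b. Proof. exact: lt_le_trans b1. Qed.

(** In this section n4, v, c and D stand for n + 4, 2 M^2 + sigma^2, Lhat^2 DPhi^2 + Lhat and DPhi.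
    The bound on [mu] reduces the left side to 15/4 times b n4 Lf^2 D^2 / Tt. The third term of Tt
    with om >= 3 makes that quotient at most eps/3264, where 3264 = 64 * 3 * 17. *)
Lemma bias_bound (mu n : R) : 0 <= n <= n4 -> 0 < mu ->
  mu <= D / n4 * Num.sqrt (b / Tt) ->
  (mu * Lf / 2) ^+ 2 * (15 * n ^+ 3) <= eps / 800.
Proof.
move=> /andP[n0 nn4] mu0 mule.
move: (om3) (c0) (eps0) => o3 cc ee.
have n40 := n4_gt0.
have bT0 : 0 <= b / Tt by rewrite divr_ge0 ?(ltW b_gt0) ?(ltW Tt0).
have mu2 : mu ^+ 2 <= D ^+ 2 / n4 ^+ 2 * (b / Tt).
  rewrite -[b / Tt]sqr_sqrtr// -exprVn -!exprMn ler_sqr ?nnegrE//; first exact: ltW.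
  exact: le_trans (ltW mu0) mule.
have n3 : n ^+ 3 <= n4 ^+ 3 by apply: lerXn2r; rewrite ?nnegrE// ltW.
have le1 : (mu * Lf / 2) ^+ 2 * (15 * n ^+ 3) <= 15 / 4 * (mu ^+ 2 * (Lf ^+ 2 * n4 ^+ 3)).
  have := ler_wpM2l (mulr_ge0 (sqr_ge0 mu) (sqr_ge0 Lf)) n3; lra.
apply: le_trans le1 _.
have Ln : 0 <= Lf ^+ 2 * n4 ^+ 3 by rewrite mulr_ge0 ?sqr_ge0// exprn_ge0// ltW.
have le2 : mu ^+ 2 * (Lf ^+ 2 * n4 ^+ 3) <= b * n4 * (Lf ^+ 2 * D ^+ 2) / Tt.
  apply: le_trans (ler_wpM2r Ln mu2) _; rewrite le_eqVlt; apply/orP; left; apply/eqP.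
  by field; rewrite !gt_eqF.
have h3 : 8 ^+ 2 * om * b * n4 * (17 * Lf ^+ 2 * D ^+ 2 + 8 * c) <= Tt * eps.
  by rewrite -ler_pdivrMr.
have z0 : 0 <= b * n4 * (Lf ^+ 2 * D ^+ 2).
  apply: mulr_ge0; first by apply: mulr_ge0; exact: ltW.
  by apply: mulr_ge0; exact: sqr_ge0.
have z1 : 0 <= om * b * n4 * c by do 3 (apply: mulr_ge0; last exact: ltW); exact: ltW.
have z2 : 3 * (b * n4 * (Lf ^+ 2 * D ^+ 2)) <= om * (b * n4 * (Lf ^+ 2 * D ^+ 2)).
  by rewrite ler_wpM2r.
have le3 : b * n4 * (Lf ^+ 2 * D ^+ 2) / Tt <= eps / 3264.
  by rewrite ler_pdivrMr//; lra.
lra.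
Qed.

Let y0 : 0 <= y. Proof. exact: sqrtr_ge0. Qed.
Let tau0 : 0 < tau. Proof. by rewrite sqrtr_gt0. Qed.
Let y2 : y ^+ 2 = n4 * v. Proof. by rewrite sqr_sqrtr// mulr_ge0// ltW. Qed.
Let tau2 : tau ^+ 2 = Tt. Proof. by rewrite sqr_sqrtr// ltW. Qed.

Let sqrtE : Num.sqrt (n4 * v * Tt) = y * tau.
Proof. by rewrite sqrtrM// mulr_ge0// ltW. Qed.

(** The square root of the lower bound on Tt given by its fourth term. *)
Let key : 256 * b * om * y * (2 * Dt + c / Dt) <= tau * eps.
Proof.
move: (om3) (n4_4) (v0) (c0) (Dt0) (eps0) (b1) (Tt0) => o3 n44 vv cc dd ee bb tt.
have cD : 0 < c / Dt by rewrite divr_gt0.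
have : b * om * (8 * 32 * y / eps * (2 * Dt + c / Dt)) <= tau.
  rewrite -ler_sqr ?nnegrE ?(ltW tau0)//; last first.
    by rewrite !mulr_ge0 ?invr_ge0 ?addr_ge0 ?(ltW cD) ?mulr_ge0 ?(ltW Dt0) ?(ltW b_gt0) ?(ltW om_gt0) ?(ltW eps0).
  by rewrite tau2 !exprMn -!exprMn; move: Tt4; rewrite !exprMn; lra.
move=> h; have := ler_wpM2r (ltW eps0) h.
rewrite (_ : _ * eps = 256 * b * om * y * (2 * Dt + c / Dt))//.
by field; rewrite !gt_eqF.
Qed.

(* The minimum with Tt in [batch_size] is inactive. *)
Lemma batch_dominates : om * n4 <= Tt -> om ^+ 2 * n4 * v / Dt ^+ 2 <= Tt -> q <= Tt.
Proof.
move=> h1 h2; rewrite ge_max h1 andbT sqrtE; move: Dt0 => dd.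
rewrite ler_pdivrMr// mulrA.
have : om * y <= tau * Dt.
  rewrite -ler_sqr ?nnegrE ?mulr_ge0 ?(ltW om_gt0) ?(ltW tau0) ?(ltW Dt0)//.
  by rewrite !exprMn y2 tau2 mulrA -ler_pdivrMr ?exprn_gt0.
move=> h; apply: le_trans (ler_wpM2r (ltW tau0) h) _.
by rewrite mulrAC -expr2 tau2.
Qed.

(** The budget of eps/8. Since q >= 12, rounding gives T' <= 13/12 q, and the two alternatives of q
    are handled by the third and the fourth term of Tt; with Tt <= 2 T T' this bounds the first
    summand by 13/192 eps. Since b om^2 >= 9, n4 v / T' <= eps/4608, where 4608 = 9 * 512, so the
    variance costs eps/96. The remaining 36 beta cost at most 9/200 eps. *)
Lemma optimization_bound (T' T A beta : R) : 0 < T -> q <= T' -> T' <= q + 1 ->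
  Tt <= 2 * T * T' -> 0 <= beta -> beta <= eps / 800 -> A <= 4 * (n4 * v) + 2 * beta ->
  8 * b * c / T + 6 * (2 * (A / T') + 2 * beta) <= eps / 8.
Proof.
move=> T0 qT' T'q TT beta0 betale Ale.
move: (om3) (n4_4) (v0) (c0) (Dt0) (eps0) (b1) (Tt0) => o3 n44 vv cc dd ee bb tt.
move: key om_gt0 n4_gt0 b_gt0 => key' om0 n40 b0.
have q12 : 12 <= q.
  rewrite le_max; apply/orP; right.
  by apply: (@le_trans _ _ (3 * 4)); [lra|apply: ler_pM].
have T'0 : 0 < T' by lra.
have k1 : 256 * b * c * q <= eps * Tt.
  have [le|le] := leP (om * Num.sqrt (n4 * v * Tt) / Dt) (om * n4).
    have h3 : 8 ^+ 2 * om * b * n4 * (17 * Lf ^+ 2 * D ^+ 2 + 8 * c) <= Tt * eps.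
      by rewrite -ler_pdivrMr.
    have z0 : 0 <= om * (b * n4 * (Lf ^+ 2 * D ^+ 2)).
      apply: mulr_ge0; first exact: ltW.
      apply: mulr_ge0; first by apply: mulr_ge0; exact: ltW.
      by apply: mulr_ge0; exact: sqr_ge0.
    have z1 : 0 <= om * b * n4 * c by do 3 (apply: mulr_ge0; last exact: ltW); exact: ltW.
    lra.
  rewrite sqrtE.
  have z : 0 <= b * om * y * Dt by rewrite !mulr_ge0 ?(ltW b_gt0) ?(ltW om_gt0) ?(ltW Dt0).
  have h : 256 * b * om * y * (c / Dt) <= tau * eps by lra.
  have := ler_wpM2r (ltW tau0) h.
  rewrite [tau * eps * tau]mulrAC -expr2 tau2 [Tt * eps]mulrC; apply: le_trans.
  by rewrite le_eqVlt; apply/orP; left; apply/eqP; ring.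
have k2 : 8 * b * c / T <= 13 / 192 * eps.
  rewrite ler_pdivrMr//.
  have bc : 0 <= b * c by rewrite mulr_ge0 ?ltW.
  have T'q2 : T' <= 13 / 12 * q by lra.
  have := ler_wpM2l bc T'q2.
  have := ler_wpM2l (ltW eps0) TT.
  move=> h1 h2.
  have h3 : 256 * b * c * (12 / 13 * T') <= eps * (2 * T * T') by lra.
  have h4 : T' * (256 * b * c * (12 / 13)) <= T' * (eps * 2 * T) by lra.
  by move: h4; rewrite ler_pM2l//; lra.
have k3 : n4 * v / T' <= eps / 4608.
  rewrite ler_pdivrMr// -y2.
  have z : 0 <= b * om * y * (c / Dt) by rewrite !mulr_ge0 ?invr_ge0 ?(ltW b_gt0) ?(ltW om_gt0) ?(ltW Dt0) ?(ltW c0).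
  have h : 512 * b * om * y * Dt <= tau * eps by lra.
  have h1 : om * (y * tau) / Dt <= T' by apply: le_trans qT'; rewrite -sqrtE le_max lexx.
  have h2 := ler_wpM2l (ltW eps0) h1.
  have oy : 0 <= om * y / Dt by rewrite !mulr_ge0 ?invr_ge0 ?(ltW om_gt0) ?(ltW Dt0).
  have h3 := ler_wpM2l oy h.
  have e3 : om * y / Dt * (512 * b * om * y * Dt) = 512 * b * om ^+ 2 * y ^+ 2.
    by field; rewrite gt_eqF.
  have e4 : om * y / Dt * (tau * eps) = eps * (om * (y * tau) / Dt) by ring.
  rewrite e3 e4 in h3.
  have bom : 9 <= b * om ^+ 2.
    have : 3 ^+ 2 <= om ^+ 2 by rewrite lerXn2r ?nnegrE// ltW.
    have := sqr_ge0 om; have := ler_wpM2r (sqr_ge0 om) b1; lra.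
  have := ler_wpM2r (sqr_ge0 y) bom; lra.
have k4 : A / T' <= 4 * (n4 * v / T') + 2 * beta.
  rewrite ler_pdivrMr// mulrDl.
  have -> : 4 * (n4 * v / T') * T' = 4 * (n4 * v) by field; rewrite gt_eqF.
  have : beta * 1 <= beta * T' by apply: ler_wpM2l => //; lra.
  lra.
lra.
Qed.

End ParameterArithmetic.

(** * Number of runs and samples of the second phase *)

Section PostArithmetic.
Context {R : realType}.

(** The threshold eps/64 is the share of the fluctuation in each estimate. The second alternative of
    the maximum makes the part 4 n4 v of [A] contribute at most Lambda/4; the first makes the part 2
    beta negligible. *)
Lemma post_bound (n4 v eps Lambda A beta Sr Tp : R) : 4 <= n4 -> 0 <= v -> 0 < eps ->
  0 < Lambda -> 0 <= Sr -> 0 <= beta -> beta <= eps / 800 -> 0 <= A ->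
  A <= 4 * (n4 * v) + 2 * beta ->
  32 * n4 * (2 * (Sr + 1)) / Lambda * Num.max 1 (16 * v / eps) <= Tp ->
  Sr * (A / (Tp * (eps / 64))) <= Lambda / 2.
Proof.
move=> n44 v0 eps0 L0 S0 beta0 betale A0 Ale Tple.
set w := 32 * n4 * (2 * (Sr + 1)) / Lambda in Tple.
have w0 : 0 < w by rewrite divr_gt0// !mulr_gt0//; lra.
have T1 : w <= Tp.
  by apply: le_trans Tple; rewrite -[leLHS]mulr1 ler_pM2l// le_max lexx.
have T2 : w * (16 * v / eps) <= Tp.
  by apply: le_trans Tple; rewrite ler_pM2l// le_max lexx orbT.
have Tp0 : 0 < Tp by apply: lt_le_trans T1.
have wL : w * Lambda = 64 * (n4 * (Sr + 1)).
  by rewrite /w; field; rewrite gt_eqF.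
have T1' : 64 * (n4 * (Sr + 1)) <= Tp * Lambda.
  by rewrite -wL ler_pM2r.
have T2' : 1024 * (n4 * v * (Sr + 1)) <= Tp * Lambda * eps.
  have := ler_wpM2r (mulr_ge0 (ltW L0) (ltW eps0)) T2.
  have -> : w * (16 * v / eps) * (Lambda * eps) = 16 * v * (w * Lambda).
    by field; rewrite gt_eqF.
  by rewrite wL; lra.
rewrite mulrA ler_pdivrMr; last by rewrite !mulr_gt0.
have nv : 0 <= n4 * v by rewrite mulr_ge0//; lra.
have h1 := ler_wpM2l S0 Ale.
have h2 : Sr * beta <= Sr * (eps / 800) by rewrite ler_wpM2l.
have h3 := ler_wpM2r (ltW eps0) T1'.
have h4 : 4 * (Sr + 1) * eps <= n4 * (Sr + 1) * eps.
  by apply: ler_wpM2r; [exact: ltW|apply: ler_wpM2r => //; lra].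
have h5 : 0 <= Sr * eps by rewrite mulr_ge0// ltW.
have h6 : 0 <= Tp * Lambda * eps by rewrite !mulr_ge0// ltW.
lra.
Qed.

Lemma S_cP (Lambda : R) : 0 < Lambda < 1 ->
  (0 < S_c Lambda)%N /\ 2^-1 ^+ S_c Lambda <= Lambda / 2.
Proof.
move=> /andP[L0 L1].
have ln20 : 0 < ln (2 : R) by rewrite ln_gt0// ltr1n.
have q1 : 1 < 2 / Lambda by rewrite ltr_pdivlMr//; lra.
have q0 : 0 < ln (2 / Lambda) / ln 2 by rewrite divr_gt0// ln_gt0.
have := nceil_ge (ln (2 / Lambda) / ln 2); rewrite -/(S_c Lambda) => Sge.
split; first by rewrite -(ltr_nat R); apply: lt_le_trans Sge.
have : ln (2 / Lambda) <= ln (2 ^+ S_c Lambda).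
  by rewrite lnXn// -[leRHS]mulr_natl -ler_pdivrMr.
rewrite ler_ln ?posrE ?exprn_gt0 ?divr_gt0// => h.
rewrite exprVn -[leRHS]invrK invf_div lef_pV2// posrE ?exprn_gt0//.
by rewrite divr_gt0.
Qed.

End PostArithmetic.

(** * Extrema over the blocks *)

Section BlockExtrema.
Context {R : realType} {b : nat}.
Implicit Types a L : 'I_b -> R.
Hypothesis b_gt0 : (0 < b)%N.

Lemma le_max_block a s : a s <= max_block a.
Proof.
apply: sup_ubound; last by exists s.
exists (\sum_r `|a r|) => _ [r _ <-].
rewrite (bigD1 r)//=; apply: le_trans (ler_norm _) _; rewrite lerDl.
exact: sumr_ge0.
Qed.

Lemma min_block_ge a m : (forall s, m <= a s) -> m <= min_block a.
Proof.
move=> ma; apply: lb_le_inf; first by exists (a (Ordinal b_gt0)); exists (Ordinal b_gt0).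
by move=> _ [r _ <-].
Qed.

Lemma min_block_le a m s : (forall s, m <= a s) -> min_block a <= a s.
Proof.
move=> ma; apply: inf_lbound; last by exists s.
by exists m => _ [r _ <-].
Qed.

Lemma min_block_gt0 a : (forall s, 0 < a s) -> 0 < min_block a.
Proof.
move=> a0; have [s _ smin] := @arg_minP _ _ _ (Ordinal b_gt0) xpredT a isT.
by apply: lt_le_trans (a0 s) _; apply: min_block_ge => r; exact: smin.
Qed.

Lemma omegaL_ge3 L : (forall s, 0 < L s) -> 3 <= omegaL L.
Proof.
move=> L0; have c0 := min_block_gt0 L0.
have : 1 <= Lhat L / Lcheck L.
  rewrite ler_pdivlMr// mul1r.
  apply: le_trans (le_max_block L (Ordinal b_gt0)).
  by apply: (min_block_le (m := 0)) => s; exact: ltW.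
by rewrite /omegaL; lra.
Qed.

(** With a constant stepsize all weights are equal, and their common value is positive because L_s /
    (2 Lhat) <= 1/2. *)
Lemma output_pmf_unif (L : 'I_b -> R) (T : nat) (k : 'I_T) : (forall s, 0 < L s) ->
  output_pmf (fun=> b%:R^-1) L (fun=> (2 * Lhat L)^-1) k = T%:R^-1.
Proof.
move=> L0; rewrite /output_pmf; set w := _ * min_block _.
have H0 : 0 < Lhat L by apply: lt_le_trans (L0 (Ordinal b_gt0)) (le_max_block _ _).
have w0 : 0 < w.
  rewrite mulr_gt0 ?invr_gt0 ?mulr_gt0//; apply: min_block_gt0 => s.
  rewrite mulr_gt0 ?invr_gt0 ?ltr0n// subr_gt0 ltr_pdivrMr ?mulr_gt0// mul1r.
  by have := le_max_block L s; rewrite -/(Lhat L); lra.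
have T0 : T%:R != 0 :> R by rewrite pnatr_eq0 -lt0n; exact: leq_ltn_trans (ltn_ord k).
by rewrite sumr_const card_ord -mulr_natr; field; rewrite T0 gt_eqF.
Qed.
End BlockExtrema.

(** * Consequences of the assumptions on the stochastic gradient *)

Section StochasticGradient.
Context (R : realType) (b : nat) (nn : 'I_b -> nat).
Local Notation V := 'rV[R]_(dim nn).
Context (dXi : measure_display) (Xi : measurableType dXi) (Q : probability Xi R).
Variables (F : V -> Xi -> R) (f : V -> R) (X : forall s, set 'rV[R]_(nn s)).
Variables (sigma Lf M : R) (L : 'I_b -> R).
Hypothesis Lf_gt0 : 0 < Lf.
Hypothesis A1 : assumption1 Q F f X sigma.
Hypothesis A2 : assumption2 Q F Lf L.
Hypothesis A3 : assumption3 f X M.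

Lemma grad_mean x j : Q.-integrable setT (fun xi => (grad (F ^~ xi) x 0 j)%:E) /\
  (\int[Q]_xi (grad (F ^~ xi) x 0 j)%:E = (grad f x 0 j)%:E)%E.
Proof. by have [_ _ _ h _] := A1. Qed.

Lemma stochastic_taylor x : {ae Q, forall xi, forall h,
  `|F (x + h) xi - F x xi - dot (grad (F ^~ xi) x) h| <= Lf / 2 * dot h h}.
Proof.
have [_ _ dF _ _] := A1.
apply: filterS2 dF A2 => xi dxi [lip _] h.
exact: (taylor_abs x h dxi lip).
Qed.

Lemma stochastic_moment2 x : prodX X x ->
  (\int[Q]_xi (dot (grad (F ^~ xi) x) (grad (F ^~ xi) x))%:E <= (M ^+ 2 + sigma ^+ 2)%:E)%E.
Proof.
move=> Xx; have [_ _ _ _ var] := A1.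
apply: le_trans (second_moment_mean (grad_mean x) (var x Xx)) _.
rewrite lee_fin lerD2r -enorm_sqr; have := A3 Xx; have := enorm_ge0 (grad f x).
generalize (enorm (grad f x)) => e e0 eM.
by rewrite ler_sqr ?nnegrE// (le_trans e0).
Qed.

Lemma measurable_grad_mean :
  measurable_fun setT (grad f : borel_rV R (dim nn) -> borel_rV R (dim nn)).
Proof.
apply: (lipschitz_measurable (K := Lf)); apply: (mean_lipschitz grad_mean (ltW Lf_gt0)).
by apply: filterS A2 => xi [lip _].
Qed.

(** The blockwise Lipschitz bound holds for almost every sample. Tested against the displacement
    [h], it becomes scalar and passes to the expectation. *)
Lemma grad_block_smooth r (h : 'rV[R]_(nn r)) (t : R) (x : V) : 0 <= t <= 1 ->
  dot (grad f (x + t *: (h *m (U R nn r)^T)) - grad f x) (h *m (U R nn r)^T)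
    <= L r * dot h h * t.
Proof.
move=> /andP[t0 _]; apply: (mean_dotB_le grad_mean).
apply: filterS A2 => xi [_ /(_ r x (t *: h))].
rewrite dot_trU mulmxBl scalemxAl.
generalize (grad (F ^~ xi) (x + t *: h *m (U R nn r)^T)) (grad (F ^~ xi) x) => u v.
rewrite enormZ ger0_norm// => le1; apply: le_trans (dot_le _ _) _.
apply: le_trans (ler_wpM2r (enorm_ge0 h) le1) _.
by rewrite -(enorm_sqr h) expr2 le_eqVlt; apply/orP; left; apply/eqP; ring.
Qed.
End StochasticGradient.

(** * The optimization runs as instances of the abstract scheme *)

Section RealizedRun.
Context {R : realType} {b : nat} {nn : 'I_b -> nat} {S T : nat}.
Context {dOm : measure_display} {Om : measurableType dOm}.
Context {dXi : measure_display} {Xi : measurableType dXi}.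
Local Notation V := 'rV[R]_(dim nn).
Variable CndG : forall s, 'rV[R]_(nn s) -> 'rV[R]_(nn s) -> R -> R -> 'rV[R]_(nn s).
Arguments CndG s : clear implicits.

Definition block_step (a delta : R) (s : 'I_b) (x G : V) : V :=
  \mxrow_r (if r == s then CndG r (x *m U R nn r) (G *m U R nn r) a delta
            else x *m U R nn r).

(** Transfers the analysis of [iterate] to the program of the statement. The second component gives
    the oracle count, [m] evaluations per step on every path. *)
Lemma opt_runE (F : V -> Xi -> R) (L : 'I_b -> R) (mu : R) (m : nat) (x1 : V)
    (D : draws (R := R) Om Xi b (dim nn) S T) i w k :
  opt_run CndG F L mu m x1 D i w k =
  (iterate (m := m) D F mu (block_step (2 * Lhat L)^-1 (3 * T%:R)^-1) x1 i k w, (k * m)%N).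
Proof.
by elim: k => // k IH; rewrite /opt_run /= -/(opt_run _ _ _ _ _ _ _ _ _ _) IH mulSn addnC.
Qed.

End RealizedRun.

Theorem corollary8
    (R : realType) (b : nat) (hb : (0 < b)%N) (nn : 'I_b -> nat)
    (* the problem *)
    (dXi : measure_display) (Xi : measurableType dXi) (Q : probability Xi R)
    (F : 'rV[R]_(dim nn) -> Xi -> R) (f : 'rV[R]_(dim nn) -> R)
    (X : forall s, set 'rV[R]_(nn s))
    (chi phi : forall s, 'rV[R]_(nn s) -> R)
    (Phistar sigma Lf M : R) (L : 'I_b -> R)
    (F_borel : measurable_fun setT
       (fun q : borel_rV R (dim nn) * Xi => F q.1 q.2))
    (X_closed : forall s, closed (X s))
    (X_convex : forall s, convex_set (X s))
    (chi_cc : forall s, closed_convex_function (chi s))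
    (Phistar_min : is_minimum (prodX X) (Phi f chi) Phistar)
    (phi_diff : forall s, differentiable_everywhere (phi s))
    (phi_sc : forall s, strongly_convex1 (phi s))
    (Lf_gt0 : 0 < Lf) (L_gt0 : forall s, 0 < L s)
    (A1 : assumption1 Q F f X sigma)
    (A2 : assumption2 Q F Lf L)
    (A3 : assumption3 f X M)
    (* the parameters of the two-phase method *)
    (CndG : forall s,
       'rV[R]_(nn s) -> 'rV[R]_(nn s) -> R -> R -> 'rV[R]_(nn s))
    (CndG_ok : cndg_procedure X chi phi CndG)
    (x1 : 'rV[R]_(dim nn)) (x1_X : prodX X x1)
    (DPhi : R) (DPhiE : DPhi = Num.sqrt ((Phi f chi x1 - Phistar) / Lhat L))
    (Dt : R) (Dt_gt0 : 0 < Dt)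
    (eps Lambda : R) (eps_gt0 : 0 < eps) (Lambda01 : 0 < Lambda < 1)
    (S Tt Tpost T' T : nat)
    (SE : S = S_c Lambda)
    (TtE : Tt = Ttilde_c (dim nn) L Lf M sigma DPhi Dt eps)
    (TpostE : Tpost = Tpost_c (dim nn) S M sigma eps Lambda)
    (T'E : T' = batch_size (dim nn) L M sigma Dt Tt)
    (TE : T = (Tt %/ T')%N)
    (mu : R) (mu_gt0 : 0 < mu)
    (mu_le : mu <= DPhi / ((dim nn)%:R + 4) * Num.sqrt (b%:R / Tt%:R))
    (* its random draws and its output *)
    (dOm : measure_display) (Om : measurableType dOm) (P : probability Om R)
    (D : draws (R := R) Om Xi b (dim nn) S T)
    (D_law : draws_law P Q T' Tpost (fun=> b%:R^-1)
       (output_pmf (fun=> b%:R^-1) L (fun=> (2 * Lhat L)^-1) (T := T)) D)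
    (xstar : Om -> 'rV[R]_(dim nn))
    (xstar_rv : measurable_fun setT (xstar : Om -> borel_rV R (dim nn)))
    (xstar_argmin : forall w,
       let xb := xbar CndG F L mu T' x1 D w in
       let score i := enorm (gen_grad X chi phi (xb i)
         (Gpost F mu Tpost D w (xb i)) (2 * Lhat L)^-1) in
       exists i, xstar w = xb i /\ forall j, score i <= score j) :
  (P [set w | (eps < enorm (gen_grad X chi phi (xstar w)
                (grad f (xstar w)) (2 * Lhat L)^-1) ^+ 2)%R]
     <= Lambda%:E)%E
  /\ (forall w, (oracle_calls CndG F L mu T' Tpost x1 D w
                   <= S_c Lambda
                      * (Ttilde_c (dim nn) L Lf M sigma DPhi Dt eps
                         + Tpost_c (dim nn) (S_c Lambda) M sigma eps Lambda))%N).
Proof.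
set H := Lhat L in DPhiE D_law xstar_argmin *; set n := dim nn in D_law xstar_rv mu_le *.
have H0 : 0 < H by apply: lt_le_trans (L_gt0 (Ordinal hb)) (le_max_block _ _).
have om3 := omegaL_ge3 hb L_gt0.
set om := omegaL L in om3 *.
pose n4 : R := n%:R + 4; pose v : R := 2 * M ^+ 2 + sigma ^+ 2.
pose c : R := H ^+ 2 * DPhi ^+ 2 + H.
have n44 : 4 <= n4 by rewrite lerDr.
have v0 : 0 <= v by rewrite addr_ge0 ?sqr_ge0// mulr_ge0 ?sqr_ge0.
have c0 : 0 < c by rewrite ltr_wpDl// mulr_ge0 ?sqr_ge0.
have b1 : 1 <= b%:R :> R by rewrite ler1n.
pose m1 := om * n4; pose m2 := om ^+ 2 * n4 * v / Dt ^+ 2.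
pose m3 := 8 ^+ 2 * om * b%:R * n4 * (17 * Lf ^+ 2 * DPhi ^+ 2 + 8 * c) / eps.
pose m4 := b%:R ^+ 2 * om ^+ 2 * (8 * 32 * Num.sqrt (n4 * v) / eps * (2 * Dt + c / Dt)) ^+ 2.
have TtE' : Tt = nceil (Num.max m1 (Num.max m2 (Num.max m3 m4))) by exact: TtE.
have Ttge : Num.max m1 (Num.max m2 (Num.max m3 m4)) <= Tt%:R by rewrite TtE'; exact: nceil_ge.
have [Tt1 [Tt2 [Tt3 Tt4]]] : m1 <= Tt%:R /\ m2 <= Tt%:R /\ m3 <= Tt%:R /\ m4 <= Tt%:R.
  by move: Ttge; rewrite !ge_max => /andP[? /andP[? /andP[? ?]]].
have m12 : 12 <= m1.
  by apply: (@le_trans _ _ (3 * 4)); [lra|rewrite /m1; apply: ler_pM].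
have Tt0 : 0 < Tt%:R :> R by apply: lt_le_trans Tt1; apply: lt_le_trans m12.
pose q := Num.max (om * Num.sqrt (n4 * v * Tt%:R) / Dt) (om * n4).
have qT : q <= Tt%:R.
  exact: (batch_dominates om3 n44 v0 Dt_gt0 Tt0 Tt1 Tt2).
have T'E' : T' = nceil q.
  by rewrite T'E /batch_size; congr nceil; rewrite -/n4 -/v -/om; exact: min_l.
have q12 : 12 <= q by apply: le_trans m12 _; rewrite le_max lexx orbT.
have q0 : 0 <= q by apply: le_trans q12.
have qT' : q <= T'%:R by rewrite T'E'; exact: nceil_ge.
have T'q : T'%:R <= q + 1 by rewrite T'E' ltW// nceil_lt.
have T'Tt : (T' <= Tt)%N by rewrite T'E' nceil_le.
have T'0 : (0 < T')%N by rewrite -(ltr_nat R); apply: lt_le_trans qT'; apply: lt_le_trans q12.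
have T0 : (0 < T)%N by rewrite TE divn_gt0.
(* Rounding Tt / T' down to T >= 1 loses at most a factor 2: Tt < (T + 1) T' <= 2 T T'. *)
have TT : Tt%:R <= 2 * T%:R * T'%:R :> R.
  rewrite -!natrM ler_nat TE.
  have := ltn_ceil Tt T'0; have : (0 < Tt %/ T')%N by rewrite divn_gt0.
  move: (Tt %/ T')%N => k k0 /ltnW lt; apply: leq_trans lt _.
  by rewrite leq_mul2r mul2n -addnn -addn1 leq_add2l k0 orbT.
(* A positive [mu] below a multiple of [DPhi] forces [DPhi] to be positive. Its radicand is then
   positive too, and squaring [DPhi] recovers the initial gap over Lhat. *)
have Dp : 0 < DPhi.
  rewrite lt_neqAle; apply/andP; split; last by rewrite DPhiE sqrtr_ge0.
  apply: contraTneq mu_gt0 => D0; rewrite -leNgt; apply: le_trans mu_le _.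
  by rewrite -D0 mul0r mul0r.
have gap : Phi f chi x1 - Phistar = H * DPhi ^+ 2.
  have g0 : 0 < (Phi f chi x1 - Phistar) / H by move: Dp; rewrite DPhiE sqrtr_gt0.
  by rewrite DPhiE sqr_sqrtr ?(ltW g0)// mulrC divfK ?gt_eqF.
pose a : R := (2 * H)^-1; pose delta : R := (3 * T%:R)^-1.
have a0 : 0 < a by rewrite invr_gt0 mulr_gt0.
have Tr0 : 0 < T%:R :> R by rewrite ltr0n.
have d0 : 0 < delta by rewrite invr_gt0 mulr_gt0.
have La s : L s <= (2 * a)^-1.
  rewrite /a invfM invrK mulrA mulVf ?mul1r//; exact: le_max_block.
pose step := block_step CndG a delta.
pose gbar := grad f.
pose calP x := gen_grad X chi phi x (gbar x) a.
have df : differentiable_everywhere f by have [_ h _ _ _] := A1.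
have stepP s x G : prodX X x -> prodX X (step s x G) /\
    Phi f chi (step s x G) + a / 4 * blk s (calP x) <=
    Phi f chi x + 3 / 2 * a * blk s (G - gbar x) + 2 * delta.
  move=> Xx; exact: (descent_step X_closed X_convex chi_cc phi_diff phi_sc CndG_ok a0 G
    df (fun r h t => grad_block_smooth A1 A2 h x) d0 (La s) Xx).
have step_dom s x G (Xx : prodX X x) : prodX X (step s x G) := (stepP s x G Xx).1.
have step_desc s x G (Xx : prodX X x) := (stepP s x G Xx).2.
have mstep d (Z : measurableType d) s (x G : Z -> 'rV[R]_n) :
    measurable_fun setT (x : Z -> borel_rV R n) ->
    measurable_fun setT (G : Z -> borel_rV R n) -> (forall w, prodX X (x w)) ->
    measurable_fun setT ((fun w => step s (x w) (G w)) : Z -> borel_rV R n).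
  move=> mx mG Xx; apply: measurable_mxrow => r; case: (r == s).
    exact: (measurable_CndG X_closed CndG_ok a0 d0 mx mG Xx).
  exact: measurable_rV_mulmx.
have mgbar : measurable_fun setT (gbar : borel_rV R n -> borel_rV R n).
  exact: (measurable_grad_mean Lf_gt0 A1 A2).
have mcalP d (Z : measurableType d) (x : Z -> 'rV[R]_n) :
    measurable_fun setT (x : Z -> borel_rV R n) -> (forall w, prodX X (x w)) ->
    measurable_fun setT ((fun w => calP (x w)) : Z -> borel_rV R n).
  move=> mx Xx; apply: (measurable_gen_grad X_closed X_convex chi_cc phi_diff phi_sc CndG_ok a0 mx _ Xx).
  exact: measurableT_comp mgbar mx.
pose s2 := M ^+ 2 + sigma ^+ 2.
have s20 : 0 <= s2 by rewrite addr_ge0 ?sqr_ge0.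
pose beta := smoothing_bias n mu Lf; pose A := oracle_moment n mu Lf s2.
have beta0 : 0 <= beta by exact: smoothing_bias_ge0.
have A0 : 0 <= A by exact: oracle_moment_ge0.
have beta_le : beta <= eps / 800.
  apply: (bias_bound om3 n44 c0 eps_gt0 b1 Tt0 Tt3 _ mu_gt0 mu_le).
  by apply/andP; split; [exact: ler0n|rewrite /n4 lerDl ler0n].
have A_le : A <= 4 * (n4 * v) + 2 * beta.
  rewrite /A /oracle_moment -/beta lerD2r /n4 /v /s2.
  have nM : 0 <= n%:R * M ^+ 2 by rewrite mulr_ge0 ?sqr_ge0.
  have := sqr_ge0 M; have := sqr_ge0 sigma; lra.
have p_unif (s : 'I_b) : (fun=> b%:R^-1) s = b%:R^-1 :> R by [].
have PR_unif (k : 'I_T) := output_pmf_unif hb k L_gt0.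
have low x : prodX X x -> Phistar <= Phi f chi x by have [_] := Phistar_min; apply.
have taylor := stochastic_taylor A1 A2.
have mom2 x : prodX X x -> _ := stochastic_moment2 A1 A3 (x := x).
have hB i := run_output_moment2 D_law p_unif PR_unif F_borel mu_gt0 s20 (grad_mean A1)
  taylor mom2 mgbar a0 (ltW d0) step_dom step_desc mstep mcalP x1_X low hb T0 T'0 i.
rewrite -/A -/beta gap in hB.
have b0 : 0 < b%:R :> R by apply: lt_le_trans b1.
have hB8 i : (\int[P]_w (dot (calP (run_output (m := T') D F mu step x1 i w))
    (calP (run_output (m := T') D F mu step x1 i w)))%:E <= (eps / 8)%:E)%E.
  apply: le_trans (hB i) _; rewrite lee_fin.
  have ob := optimization_bound om3 n44 v0 c0 Dt_gt0 eps_gt0 b1 Tt0 Tt3 Tt4 Tr0 qT' T'q TT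
    beta0 beta_le A_le.
  apply: le_trans ob; rewrite lerD2r ler_pM2r ?invr_gt0//.
  (* The accuracies add up to 2/3 <= 1, and c = H (H DPhi^2 + 1) has room for that 1. *)
  have -> : 2 * delta * T%:R = 2 / 3 by rewrite /delta; field; rewrite gt_eqF.
  have -> : 4 * b%:R / a = 8 * (b%:R * H) by rewrite /a invrK; ring.
  have bH : 0 <= b%:R * H by rewrite mulr_ge0 ?ltW.
  have -> : 8 * b%:R * c = 8 * (b%:R * H) * (H * DPhi ^+ 2 + 1) by rewrite /c; ring.
  apply: ler_wpM2l; first by rewrite mulr_ge0.
  by rewrite lerD2l ler_pdivrMr// mul1r ler_nat.
have [L0 L1] := andP Lambda01.
have [S0 hS] := S_cP Lambda01; rewrite -SE in S0 hS.
have Tpge : 32 * n4 * (2 * (S%:R + 1)) / Lambda * Num.max 1 (16 * v / eps) <= Tpost%:R.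
  by rewrite TpostE; exact: nceil_ge.
have Tp0 : (0 < Tpost)%N.
  rewrite -(ltr_nat R); apply: lt_le_trans Tpge.
  rewrite mulr_gt0//; last by rewrite lt_max ltr01.
  by rewrite divr_gt0// !mulr_gt0 ?(lt_le_trans _ n44)// ltr_wpDl.
have post := post_bound n44 v0 eps_gt0 L0 (ler0n R S) beta0 beta_le A0 A_le Tpge.
have xbE w i : xbar CndG F L mu T' x1 D w i = run_output (m := T') D F mu step x1 i w.
  by rewrite /xbar opt_runE.
have xsP w : exists i, xstar w = run_output (m := T') D F mu step x1 i w /\
    forall j, dot (calP (xstar w)) (calP (xstar w)) <=
      2 * dot (calP (run_output (m := T') D F mu step x1 j w))
              (calP (run_output (m := T') D F mu step x1 j w))
      + 4 * (dot (post_error (m := T') (Tp := Tpost) D F gbar mu step x1 i w)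
                 (post_error (m := T') (Tp := Tpost) D F gbar mu step x1 i w)
           + dot (post_error (m := T') (Tp := Tpost) D F gbar mu step x1 j w)
                 (post_error (m := T') (Tp := Tpost) D F gbar mu step x1 j w)).
  have [i [xi sc]] := xstar_argmin w; exists i; rewrite xi xbE; split => // j.
  have := sc j; rewrite !xbE => le.
  have Xi' k : prodX X (run_output (m := T') D F mu step x1 k w).
    by apply: run_output_dom => //; exact: x1_X.
  exact: (gen_grad_compare X_closed X_convex chi_cc phi_diff phi_sc CndG_ok a0
    (gbar _) (gbar _) (Xi' j) (Xi' i) le).
split.
  (* The allowance eps/32 for one estimate is split into eps/64 for its fluctuation and the rest for
     the bias, which is at most eps/800. *)
  have tb : eps / 64 + beta <= eps / 32 by clear -beta_le eps_gt0; lra.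
  have e64 : 0 < eps / 64 by rewrite divr_gt0.
  have := two_phase_tail D_law F_borel mu_gt0 s20 (grad_mean A1) taylor mom2 a0 (ltW d0)
    step_dom mstep mcalP x1_X hb T0 T'0 eps_gt0 e64 Tp0 tb hB8 xstar_rv xsP.
  rewrite -/A => tail.
  rewrite (_ : [set w | _] = [set w | eps < dot (calP (xstar w)) (calP (xstar w))]); last first.
    by apply/seteqP; split => w /=; rewrite enorm_sqr.
  apply: le_trans tail _; rewrite lee_fin.
  have -> : eps / 8 / (eps / 4) = 2^-1 by field; rewrite gt_eqF.
  by rewrite [leRHS](splitr Lambda) lerD.
move=> w; rewrite /oracle_calls -SE -TtE -TpostE.
have calls i : (opt_run CndG F L mu T' x1 D i w T).2 = (T * T')%N by rewrite opt_runE.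
rewrite (eq_bigr _ (fun i _ => calls i)) sum_nat_const card_ord -mulnDr leq_mul2l leq_add2r TE.
by rewrite leq_trunc_div orbT.
Qed.
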